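(* Let $Q\subset\mathbb C$ be a convex locally closed set with $0\in Q$, and let $H(Q)$ be the space of germs of holomorphic functions on $Q$ with its projective limit topology and the Duhamel product $\ast$. For a set $T\subset H(Q)$ the following assertions are equivalent: (i) $T$ is a proper closed ideal in the algebra $(H(Q),\ast)$, where proper means $T\neq\{0\}$ and $T\ne H(Q)$. (ii) There exists an integer $n\ge 0$ such that $$T=\{h\in H(Q)\,:\, h^{(j)}(0)=0,\ 0\le j\le n\}.$$
   Context: A convex set $Q\subset\mathbb C$ is called locally closed here if it has a countable fundamental sequence of compact subsets, i.e. an increasing sequence $(Q_n)_{n\in\mathbb N}$ of compact subsets of $Q$ such that each compact subset of $Q$ is contained in some $Q_n$. With $0\in Q$, the sequence $(Q_n)$ is chosen with all $Q_n$ convex and $0\in Q_1$. For each $n$, $H(Q_n)$ is the space of (germs of) functions holomorphic on some open neighborhood of $Q_n$, with its natural inductive limit topology (inductive limit of the Fréchet spaces $H(U)$ over open neighborhoods $U$ of $Q_n$). $H(Q)$ is the vector space of all (germs of) functions holomorphic on some open neighborhood of $Q$; algebraically $H(Q)=\bigcap_n H(Q_n)$, and $H(Q)$ is endowed with the topology of the projective limit $\mathrm{proj}_{\leftarrow n}H(Q_n)$. The Duhamel product on $H(Q)$ is $$(v\ast w)(z)=w(0)v(z)+\int_0^z v(\xi)w'(z-\xi)\,d\xi,\qquad v,w\in H(Q),$$ where the integral is taken along the segment $[0,z]$ and $z$ ranges over the union of convex domains $G_n$, $n\in\mathbb N$, such that $Q_n\subset G_n$ and $v,w$ are holomorphic on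 each $G_n$. With $\ast$ as multiplication $H(Q)$ is an (associative, commutative) algebra. *)

(* Defs.v *)
(* Stdlib real numbers, with Coquelicot for complex analysis. *)
From Stdlib Require Import Reals Lra List Classical ClassicalChoice ClassicalEpsilon.
From Stdlib Require Import FunctionalExtensionality PropExtensionality ProofIrrelevance.
From Coquelicot Require Import Coquelicot.

Open Scope C_scope.

Definition Cincl (A B : C -> Prop) : Prop := forall z, A z -> B z.

Definition Cconvex (A : C -> Prop) : Prop :=
  forall (x y : C) (t : R), A x -> A y -> (0 <= t <= 1)%R ->
    A ((1 - RtoC t) * x + RtoC t * y).

Definition Ccompact (K : C -> Prop) : Prop :=
  forall F : (C -> Prop) -> Prop,
    (forall U, F U -> open U) ->
    (forall z, K z -> exists U, F U /\ U z) ->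
    exists l : list (C -> Prop),
      (forall U, In U l -> F U) /\ (forall z, K z -> exists U, In U l /\ U z).

Definition fundamental_sequence (Q : C -> Prop) (Qs : nat -> C -> Prop) : Prop :=
  (forall n, Ccompact (Qs n)) /\
  (forall n, Cincl (Qs n) Q) /\
  (forall n, Cincl (Qs n) (Qs (S n))) /\
  (forall L, Ccompact L -> Cincl L Q -> exists n, Cincl L (Qs n)).

Definition locally_closed (Q : C -> Prop) : Prop :=
  exists Qs, fundamental_sequence Q Qs.

Definition open_nbhd (A U : C -> Prop) : Prop := open U /\ Cincl A U.

Definition holomorphic_on (U : C -> Prop) (f : C -> C) : Prop :=
  forall z, U z -> ex_derive f z.

(* Functions are total; only their values near the set matter. *)
Definition germ_eq (A : C -> Prop) (f g : C -> C) : Prop :=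
  exists U, open_nbhd A U /\ forall z, U z -> f z = g z.

(* Germs along A of arbitrary functions, as equivalence classes for [germ_eq].
   The spaces H(A) are the subsets [Hol A] below. *)
Definition germs (A : C -> Prop) : Type :=
  { c : (C -> C) -> Prop | exists f, c = germ_eq A f }.

Definition germ (A : C -> Prop) (f : C -> C) : germs A :=
  exist _ (germ_eq A f) (ex_intro _ f eq_refl).

Definition rep {A : C -> Prop} (a : germs A) : C -> C :=
  proj1_sig (constructive_indefinite_description _ (proj2_sig a)).

Definition Hol (A : C -> Prop) (a : germs A) : Prop :=
  exists f U, open_nbhd A U /\ holomorphic_on U f /\ a = germ A f.

Definition gzero (A : C -> Prop) : germs A := germ A (fun _ => 0).

Definition gadd {A : C -> Prop} (a b : germs A) : germs A :=
  germ A (fun z => rep a z + rep b z).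

Definition gscal {A : C -> Prop} (c : C) (a : germs A) : germs A :=
  germ A (fun z => c * rep a z).

(* Meaningful when B is included in A. *)
Definition restr {A : C -> Prop} (B : C -> Prop) (a : germs A) : germs B :=
  germ B (rep a).

(* [C_derive] is a limit along the horizontal direction: it is the complex
   derivative wherever the function is complex differentiable. *)
Definition Cderive_n (f : C -> C) (j : nat) : C -> C := Nat.iter j C_derive f.

(* h^(j)(0), meaningful when A contains 0. *)
Definition deriv0 {A : C -> Prop} (j : nat) (a : germs A) : C :=
  Cderive_n (rep a) j 0.

Definition segment_integral (F : C -> C) (a b : C) : C :=
  RInt (V := C_R_CompleteNormedModule)
    (fun t : R => F (a + RtoC t * (b - a)) * (b - a)) 0 1.

(* On germs along a convex A containing 0 this only involves values of v and w
   near A: the points z whose segment [0, z] lies in a given neighbourhood of A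
   form a neighbourhood of A ([open_nbhd_star], [gduhamel_germ]). *)
Definition duhamel (v w : C -> C) : C -> C := fun z =>
  w 0 * v z + segment_integral (fun xi => v xi * C_derive w (z - xi)) 0 z.

Definition gduhamel {A : C -> Prop} (v w : germs A) : germs A :=
  germ A (duhamel (rep v) (rep w)).

(* Neighbourhood of 0 in the Frechet space H(U) of functions holomorphic on U,
   with the topology of uniform convergence on compact subsets of U. *)
Definition frechet_nbhd0 (U : C -> Prop) (N : (C -> C) -> Prop) : Prop :=
  exists (L : C -> Prop) (eps : R),
    Ccompact L /\ Cincl L U /\ (0 < eps)%R /\
    forall f, holomorphic_on U f -> (forall z, L z -> (Cmod (f z) < eps)%R) -> N f.

Definition absolutely_convex {A : C -> Prop} (V : germs A -> Prop) : Prop :=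
  forall (a b : germs A) (c d : C), V a -> V b -> (Cmod c + Cmod d <= 1)%R ->
    V (gadd (gscal c a) (gscal d b)).

(* Base of neighbourhoods of 0 for the locally convex inductive limit topology
   of H(K) = ind H(U), U ranging over the open neighbourhoods of K: the finest
   locally convex topology for which every H(U) -> H(K) is continuous. *)
Definition ind_nbhd0 (K : C -> Prop) (V : germs K -> Prop) : Prop :=
  (forall a, V a -> Hol K a) /\
  absolutely_convex V /\
  (forall U, open_nbhd K U -> frechet_nbhd0 U (fun f => V (germ K f))).

Definition ind_open (K : C -> Prop) (O : germs K -> Prop) : Prop :=
  (forall a, O a -> Hol K a) /\
  (forall a, O a -> exists V, ind_nbhd0 K V /\ forall b, V b -> O (gadd a b)).

(* Initial topology on H(Q) for the restrictions H(Q) -> H(Q_n): the base is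
   made of finite intersections of preimages of open sets. *)
Definition proj_open (Q : C -> Prop) (Qs : nat -> C -> Prop)
    (O : germs Q -> Prop) : Prop :=
  (forall a, O a -> Hol Q a) /\
  (forall a, O a ->
    exists (N : nat) (P : forall n, germs (Qs n) -> Prop),
      (forall n, (n <= N)%nat -> ind_open (Qs n) (P n) /\ P n (restr (Qs n) a)) /\
      (forall b, Hol Q b -> (forall n, (n <= N)%nat -> P n (restr (Qs n) b)) -> O b)).

Definition proj_closed (Q : C -> Prop) (Qs : nat -> C -> Prop)
    (T : germs Q -> Prop) : Prop :=
  proj_open Q Qs (fun a => Hol Q a /\ ~ T a).

Definition duhamel_ideal (Q : C -> Prop) (T : germs Q -> Prop) : Prop :=
  T (gzero Q) /\
  (forall a b, T a -> T b -> T (gadd a b)) /\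
  (forall c a, T a -> T (gscal c a)) /\
  (forall v a, Hol Q v -> T a -> T (gduhamel v a) /\ T (gduhamel a v)).

Definition proper (Q : C -> Prop) (T : germs Q -> Prop) : Prop :=
  ~ (forall h, T h <-> h = gzero Q) /\ ~ (forall h, T h <-> Hol Q h).

(* The operations above do not depend on the chosen representatives. *)

Lemma germ_eq_refl A f : germ_eq A f f.
Proof.
  exists (fun _ => True); split; [split|]; try easy.
  apply open_true.
Qed.

Lemma germ_eq_sym A f g : germ_eq A f g -> germ_eq A g f.
Proof. intros [U [HU E]]; exists U; split; auto; intros; symmetry; auto. Qed.

Lemma open_nbhd_and A U V :
  open_nbhd A U -> open_nbhd A V -> open_nbhd A (fun z => U z /\ V z).
Proof.
  intros [oU iU] [oV iV]; split; [now apply open_and|].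
  intros z Hz; split; auto.
Qed.

Lemma germ_eq_trans A f g h : germ_eq A f g -> germ_eq A g h -> germ_eq A f h.
Proof.
  intros [U [HU E]] [V [HV E']].
  exists (fun z => U z /\ V z); split; [now apply open_nbhd_and|].
  intros z [Uz Vz]; rewrite E; auto.
Qed.

Lemma germP A f g : germ A f = germ A g <-> germ_eq A f g.
Proof.
  split; intros H.
  - apply (f_equal (@proj1_sig _ _)) in H; cbn in H.
    rewrite H; apply germ_eq_refl.
  - apply subset_eq_compat; apply functional_extensionality; intros h.
    apply propositional_extensionality; split; intros H'.
    + apply germ_eq_trans with f; auto using germ_eq_sym.
    + apply germ_eq_trans with g; auto.
Qed.

Lemma repK A (a : germs A) : germ A (rep a) = a.
Proof.
  unfold rep; destruct (constructive_indefinite_description _ _) as [f Hf]; cbn.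
  destruct a as [c Hc]; cbn in *; apply subset_eq_compat; auto.
Qed.

Lemma rep_germ A f : germ_eq A (rep (germ A f)) f.
Proof. apply germP, repK. Qed.

Lemma gadd_germ A f g : gadd (germ A f) (germ A g) = germ A (fun z => f z + g z).
Proof.
  apply germP.
  destruct (rep_germ A f) as [U [HU E]], (rep_germ A g) as [V [HV E']].
  exists (fun z => U z /\ V z); split; [now apply open_nbhd_and|].
  intros z [Uz Vz]; rewrite E, E'; auto.
Qed.

Lemma gscal_germ A c f : gscal c (germ A f) = germ A (fun z => c * f z).
Proof.
  apply germP; destruct (rep_germ A f) as [U [HU E]].
  exists U; split; auto; intros z Uz; rewrite E; auto.
Qed.

Lemma restr_germ (A B : C -> Prop) f :
  Cincl B A -> restr B (germ A f) = germ B f.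
Proof.
  intros BA; apply germP; destruct (rep_germ A f) as [U [[oU iU] E]].
  exists U; split; auto; split; auto; intros z Bz; auto.
Qed.

Lemma C_derive_ext_open (U : C -> Prop) f g :
  open U -> (forall z, U z -> f z = g z) ->
  forall z, U z -> C_derive f z = C_derive g z.
Proof.
  intros oU E z Uz; unfold C_derive, C_lim.
  assert (L : Rbar_locally' (fst z) (fun x : R => f (x, snd z) = g (x, snd z))).
  { destruct (oU z Uz) as [d Hd]; exists d; intros y Hy _; apply E, Hd.
    split; [exact Hy | apply ball_center]. }
  rewrite (E z Uz); f_equal; apply f_equal; apply Lim_ext_loc;
    revert L; apply filter_imp; intros y ->; reflexivity.
Qed.

Lemma deriv0_germ (A : C -> Prop) j f :
  A 0 -> deriv0 j (germ A f) = Cderive_n f j 0.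
Proof.
  intros A0; unfold deriv0; destruct (rep_germ A f) as [U [[oU iU] E]].
  enough (H : forall z, U z -> Cderive_n (rep (germ A f)) j z = Cderive_n f j z)
    by auto.
  induction j as [|j IH]; [exact E|].
  exact (C_derive_ext_open U _ _ oU IH).
Qed.

Lemma open_nbhd_star (A U : C -> Prop) :
  Cconvex A -> A 0 -> open_nbhd A U ->
  exists V, open_nbhd A V /\
    forall z (t : R), V z -> (0 <= t <= 1)%R -> U (RtoC t * z).
Proof.
  intros cA A0 [oU iU].
  pose (S z := forall t : R, (0 <= t <= 1)%R -> U (RtoC t * z)).
  exists (fun z => locally z S); split; [split|].
  - intros z Hz; apply (locally_locally z S Hz).
  - intros z Az.
    assert (D : forall t : R, exists d : posreal, (0 <= t <= 1)%R ->
        forall (s : R) (y : C), (Rabs (s - t) < d)%R -> ball z d y -> U (RtoC s * y)).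
    { intros t; destruct (excluded_middle_informative (0 <= t <= 1)%R) as [Ht|Ht].
      2:{ exists (mkposreal 1 Rlt_0_1); tauto. }
      assert (Utz : U (RtoC t * z)).
      { apply iU; replace (RtoC t * z) with ((1 - RtoC t) * 0 + RtoC t * z) by ring.
        now apply cA. }
      assert (cont : continuous (T := prod_UniformSpace R_UniformSpace C_UniformSpace)
          (U := C_UniformSpace)
          (fun p : R * C => @scal R_AbsRing C_R_NormedModule (fst p) (snd p)) (t, z)).
      { apply (continuous_scal (K := R_AbsRing) (V := C_R_NormedModule)
          (U := prod_UniformSpace R_UniformSpace C_UniformSpace)
          (fun p : R * C => fst p) (fun p : R * C => snd p) (t, z)).
        - apply continuous_fst.
        - apply continuous_snd. }
      assert (SE : forall (s : R) (y : C),
          @scal R_AbsRing C_R_NormedModule s y = RtoC s * y).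
      { intros s [y1 y2]; unfold scal, Cmult; cbn; unfold prod_scal, scal; cbn.
        unfold mult; cbn; f_equal; ring. }
      rewrite <- SE in Utz.
      destruct (cont U (oU _ Utz)) as [d Hd].
      exists d; intros _ s y Hs Hy; rewrite <- SE.
      apply (Hd (s, y)); split; [exact Hs | exact Hy]. }
    destruct (choice _ D) as [delta Hdelta].
    destruct (compactness_value_1d 0 1 delta) as [d Hd].
    exists d; intros y Hy t Ht; apply NNPP; intros H.
    apply (Hd t Ht); intros [u [Hu [Hut Hdu]]]; apply H.
    apply (Hdelta u Hu t y Hut).
    apply ball_le with d; auto.
  - intros z t Hz Ht; exact (locally_singleton z S Hz t Ht).
Qed.

Lemma gduhamel_germ (A : C -> Prop) v w :
  Cconvex A -> A 0 -> gduhamel (germ A v) (germ A w) = germ A (duhamel v w).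
Proof.
  intros cA A0; apply germP.
  destruct (rep_germ A v) as [U1 [HU1 E1]], (rep_germ A w) as [U2 [HU2 E2]].
  destruct (open_nbhd_star A _ cA A0 (open_nbhd_and A _ _ HU1 HU2)) as [V [HV HS]].
  exists V; split; auto; intros z Vz.
  assert (S1 : forall t : R, (0 <= t <= 1)%R -> U1 (RtoC t * z))
    by (intros t Ht; apply (HS z t Vz Ht)).
  assert (S2 : forall t : R, (0 <= t <= 1)%R -> U2 (RtoC t * z))
    by (intros t Ht; apply (HS z t Vz Ht)).
  unfold duhamel; f_equal.
  - rewrite E1, E2; auto; [apply (proj2 HU2), A0|].
    replace z with (RtoC 1 * z) by ring; apply S1; lra.
  - unfold segment_integral.
    apply (RInt_ext (V := C_R_CompleteNormedModule)); intros t.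
    rewrite Rmin_left, Rmax_right by lra; intros Ht; cbn beta; f_equal; f_equal.
    + apply E1; replace (0 + RtoC t * (z - 0)) with (RtoC t * z) by ring.
      apply S1; lra.
    + apply (C_derive_ext_open U2); [apply HU2 | exact E2 |].
      replace (z - (0 + RtoC t * (z - 0))) with (RtoC (1 - t) * z)
        by (rewrite RtoC_minus; ring).
      apply S2; lra.
Qed.

(* Main.v *)
Require Import Defs.
From Stdlib Require Import Reals Lra Lia Factorial Wf_nat List.
From Stdlib Require Import Classical ClassicalEpsilon.
From Stdlib Require Import FunctionalExtensionality PropExtensionality.
From Coquelicot Require Import Coquelicot.

Open Scope C_scope.

(** The algebra of germs is, from the point of view of its ideals, a discrete
    valuation ring whose valuation is the order of vanishing at 0.

    Write [conv v k z] for the integral of [v xi * k (z - xi)] over the segment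
    from 0 to [z], so that [v * w = w(0) v + conv v w'].  Differentiating under
    the integral sign and integrating by parts gives
    [(conv v k)' = k(0) v + conv v k'] ([Cderivable_convolution]).  Two facts
    follow.  First, [v * w] is the derivative of [conv v w], and [conv] is
    symmetric, so [*] is commutative ([duhamel_comm]).  Second, if [w(0) = 0]
    then [(v * w)' = v * w'], while [(v * w)(0) = v(0) w(0)] always.  Hence [v * w]
    vanishes at 0 at least to the order of [w] ([Cderive_n_duhamel]), and, when [h]
    and [f] both vanish to order [m], the equation [u * h = f] is equivalent to
    [u * h^(m) = f^(m)] ([duhamel_lift]).

    If [g(0) <> 0], the equation [u * g = f] is a Volterra equation of the second
    kind, [g(0) u + conv u g' = f].  Its Neumann series converges locally
    uniformly on every domain that is star-shaped about 0, so it has a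
    holomorphic solution on the whole domain on which [f] and [g] live
    ([Volterra_equation], [duhamel_divide]).  Since a convex set containing 0 has
    a basis of star-shaped open neighbourhoods, a germ [h] of order exactly [m]
    divides every germ of order at least [m] ([germ_divides]).

    Let [T] be a nonzero proper ideal and let [m] be the least order of an element
    of [T]; it is finite, because a germ all of whose derivatives vanish at 0 is
    zero ([germ_deriv0_zero]).  By divisibility [T] is the set of all germs of order
    at least [m], and [m] is positive because [T] is not the whole algebra
    ([proper_ideal_vanishing]).  Conversely, the germs of order greater than [n] form
    an ideal; it is closed because Cauchy's estimates make each functional
    [h |-> h^(j)(0)] continuous already on the first step of the projective
    system ([vanishing_closed]).

    The complex analysis needed for this is built from the mere existence of the
    complex derivative: Goursat's theorem on triangles yields local primitives, a
    homotopy argument yields Cauchy's formula for functions with a continuous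
    derivative, hence for these primitives, and finally for all holomorphic
    functions. *)

(** * Complex-valued functions: derivatives, continuity, integrals *)

(** Over the complex numbers several structures on the same carrier coexist
    (a normed module over the reals, one over the complex numbers, and the normed
    field itself).  These notations fix, once and for all, the one that is meant. *)
Notation Ccontinuous f x := (continuous (U := C_UniformSpace) f x).
Notation Cderivable f z l := (is_derive (K := C_AbsRing) (V := C_NormedModule) f (z : C) (l : C)).
Notation CInt F := (RInt (V := C_R_CompleteNormedModule) F 0 1).
Notation ex_CInt F := (ex_RInt (V := C_R_CompleteNormedModule) F 0 1).
Notation is_CInt F l := (is_RInt (V := C_R_NormedModule) F 0 1 (l : C)).

(** Carriers such as [NormedModule.sort] hide from [ring] that an equation lives
    in the complex field. *)
Ltac Cring := match goal with |- @eq _ ?x ?y => change (@eq C x y); ring end.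

Lemma norm_C_R (z : C) : @norm R_AbsRing C_R_NormedModule z = Cmod z.
Proof.
  destruct z as [x y]; unfold norm; cbn; unfold prod_norm, Cmod; cbn.
  f_equal; unfold norm; cbn; unfold abs; cbn; rewrite !Rmult_1_r.
  now rewrite <- !Rabs_mult, !Rabs_pos_eq by (apply Rle_0_sqr).
Qed.

Lemma scal_C_R (t : R) (z : C) : @scal R_AbsRing C_R_NormedModule t z = RtoC t * z.
Proof.
  destruct z as [x y]; unfold scal, Cmult; cbn; unfold prod_scal, scal; cbn.
  unfold mult; cbn; f_equal; ring.
Qed.

(** Neighbourhoods are defined by squares, derivatives by the modulus; everything
    below is phrased with the modulus. *)
Lemma locally_Cmod (z : C) (P : C -> Prop) :
  locally (T := C_UniformSpace) z P <->
  exists d : R, (0 < d)%R /\ forall y, (Cmod (y - z) < d)%R -> P y.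
Proof.
  split.
  - intros [d Hd]; exists d; split; [apply cond_pos|].
    intros y Hy; apply Hd, C_NormedModule_mixin_compat1, Hy.
  - intros [d [d0 Hd]].
    assert (s2 : (0 < sqrt 2)%R) by (apply sqrt_lt_R0; lra).
    assert (p : (0 < d / sqrt 2)%R) by (apply Rdiv_lt_0_compat; lra).
    exists (mkposreal _ p); intros y Hy; apply Hd.
    replace d with (sqrt 2 * (mkposreal _ p))%R by (cbn; field; lra).
    now apply C_NormedModule_mixin_compat2.
Qed.

Lemma Ccontinuous_eps {T : UniformSpace} (f : T -> C) (x : T) :
  Ccontinuous f x <->
  forall e : R, (0 < e)%R -> locally x (fun y => (Cmod (f y - f x) < e)%R).
Proof.
  split.
  - intros H e e0; apply (H (fun w => (Cmod (w - f x) < e)%R)).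
    apply locally_Cmod; exists e; split; auto.
  - intros H P HP; apply locally_Cmod in HP; destruct HP as [d [d0 Hd]].
    unfold filtermap; generalize (H d d0); apply filter_imp; auto.
Qed.

Lemma Cderivable_eps (f : C -> C) (z l : C) :
  Cderivable f z l <->
  forall e : R, (0 < e)%R -> exists d : R, (0 < d)%R /\ forall y, (Cmod (y - z) < d)%R ->
    (Cmod (f y - f z - l * (y - z)) <= e * Cmod (y - z))%R.
Proof.
  split.
  - intros [_ H] e e0.
    assert (K := H z (fun P HP => HP) (mkposreal e e0)).
    apply locally_C, locally_Cmod in K.
    destruct K as [d [d0 Hd]]; exists d; split; auto; intros y Hy.
    rewrite (Cmult_comm l); exact (Hd y Hy).
  - intros H; split; [apply is_linear_scal_l|].
    intros x Hx e.
    replace x with z by (exact (is_filter_lim_locally_unique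
      (V := AbsRing_NormedModule C_AbsRing) z x Hx)).
    apply locally_C, locally_Cmod.
    destruct (H e (cond_pos e)) as [d [d0 Hd]].
    exists d; split; auto; intros y Hy; specialize (Hd y Hy).
    rewrite (Cmult_comm l) in Hd; exact Hd.
Qed.

Lemma Cderivable_continuous (f : C -> C) (z l : C) : Cderivable f z l -> Ccontinuous f z.
Proof.
  intros H; assert (K := ex_derive_continuous (K := C_AbsRing) (V := C_NormedModule) f z
    (ex_intro _ l H)).
  intros P HP; apply (locally_C z (fun y => P (f y))), (K P HP).
Qed.

(** The product and chain rules are available for the field seen as a module over
    itself, whose neighbourhoods differ from those of the complex plane only in
    presentation. *)
Lemma Cderivable_AbsRing (f : C -> C) (z l : C) :
  is_derive (K := C_AbsRing) (V := AbsRing_NormedModule C_AbsRing) f z l <-> Cderivable f z l.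
Proof.
  split; intros [_ D]; (split; [apply is_linear_scal_l | intros x Hx e; exact (D x Hx e)]).
Qed.

Lemma Cderivable_ext (f g : C -> C) (z l : C) : (forall y, f y = g y) -> Cderivable f z l -> Cderivable g z l.
Proof. intros E; apply is_derive_ext; exact E. Qed.

Lemma Cderivable_ext_loc (f g : C -> C) (z l : C) :
  locally (T := C_UniformSpace) z (fun y => f y = g y) -> Cderivable f z l -> Cderivable g z l.
Proof. intros E; apply is_derive_ext_loc, locally_C, E. Qed.

Lemma Cderivable_const (c z : C) : Cderivable (fun _ => c) z 0.
Proof. apply (is_derive_const (K := C_AbsRing) (V := C_NormedModule)). Qed.

Lemma Cderivable_id (z : C) : Cderivable (fun y => y) z 1.
Proof.
  apply Cderivable_eps; intros e e0; exists 1%R; split; [lra|]; intros y _.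
  replace (y - z - 1 * (y - z)) with (RtoC 0) by ring; rewrite Cmod_0.
  assert (h := Cmod_ge_0 (y - z)); nra.
Qed.

Lemma Cderivable_plus (f g : C -> C) (z a b : C) :
  Cderivable f z a -> Cderivable g z b -> Cderivable (fun y => f y + g y) z (a + b).
Proof. apply (is_derive_plus (K := C_AbsRing) (V := C_NormedModule)). Qed.

Lemma Cderivable_minus (f g : C -> C) (z a b : C) :
  Cderivable f z a -> Cderivable g z b -> Cderivable (fun y => f y - g y) z (a - b).
Proof. apply (is_derive_minus (K := C_AbsRing) (V := C_NormedModule)). Qed.

Lemma Cderivable_mult (f g : C -> C) (z a b : C) :
  Cderivable f z a -> Cderivable g z b ->
  Cderivable (fun y => f y * g y) z (a * g z + f z * b).
Proof.
  intros Hf%Cderivable_AbsRing Hg%Cderivable_AbsRing; apply Cderivable_AbsRing.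
  apply (is_derive_mult (K := C_AbsRing) f g z a b Hf Hg); exact Cmult_comm.
Qed.

Lemma Cderivable_comp (f g : C -> C) (z a b : C) :
  Cderivable f (g z) a -> Cderivable g z b -> Cderivable (fun y => f (g y)) z (b * a).
Proof.
  intros Hf Hg%Cderivable_AbsRing.
  exact (is_derive_comp (K := C_AbsRing) (V := C_NormedModule) f g z a b Hf Hg).
Qed.

Lemma Cderivable_inv (z : C) : z <> 0 -> Cderivable (fun y => / y) z (- / (z * z)).
Proof.
  intros nz; apply Cderivable_eps; intros e e0.
  assert (m0 : (0 < Cmod z)%R) by now apply Cmod_gt_0.
  (* d <= |z| / 2 keeps |y| above |z| / 2, so the error (y - z)^2 / (y z^2) is at most
     2 |y - z|^2 / |z|^3. *)
  set (d := Rmin (Cmod z / 2) (e * (Cmod z * Cmod z * Cmod z) / 2)).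
  assert (m3 : (0 < Cmod z * Cmod z * Cmod z)%R)
    by (repeat apply Rmult_lt_0_compat; auto).
  assert (em : (0 < e * (Cmod z * Cmod z * Cmod z))%R) by now apply Rmult_lt_0_compat.
  exists d; split; [unfold d; apply Rmin_glb_lt; lra|].
  intros y Hy.
  assert (h1 : (Cmod (y - z) < Cmod z / 2)%R) by (eapply Rlt_le_trans; [exact Hy|apply Rmin_l]).
  assert (h2 : (Cmod (y - z) <= e * (Cmod z * Cmod z * Cmod z) / 2)%R)
    by (eapply Rlt_le, Rlt_le_trans; [exact Hy|apply Rmin_r]).
  assert (my : (Cmod z / 2 < Cmod y)%R).
  { assert (T := Cmod_triangle y (z - y)).
    replace (y + (z - y)) with z in T by ring.
    replace (z - y) with (- (y - z)) in T by ring; rewrite Cmod_opp in T; lra. }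
  assert (ny : y <> 0) by (apply Cmod_gt_0; lra).
  replace (/ y - / z - - / (z * z) * (y - z)) with ((y - z) * (y - z) / (y * (z * z)))
    by (field; auto).
  rewrite Cmod_div by (repeat apply Cmult_neq_0; auto).
  rewrite !Cmod_mult.
  set (a := Cmod (y - z)) in *; set (b := Cmod z) in *; set (c := Cmod y) in *.
  assert (a0 : (0 <= a)%R) by apply Cmod_ge_0.
  apply (Rmult_le_reg_r (c * (b * b))%R); [repeat apply Rmult_lt_0_compat; lra|].
  replace (a * a / (c * (b * b)) * (c * (b * b)))%R with (a * a)%R by (field; lra).
  replace (e * a * (c * (b * b)))%R with (a * (e * (c * (b * b))))%R by ring.
  apply Rmult_le_compat_l; auto.
  apply Rle_trans with (1 := h2).
  replace (e * (b * b * b) / 2)%R with (e * (b / 2 * (b * b)))%R by field.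
  apply Rmult_le_compat_l; [lra|]; apply Rmult_le_compat_r; [|lra].
  apply Rlt_le, Rmult_lt_0_compat; auto.
Qed.

Section cont.
Context {T : UniformSpace}.
Implicit Types f g : T -> C.

Lemma Ccontinuous_const (c : C) (x : T) : Ccontinuous (fun _ => c) x.
Proof. apply continuous_const. Qed.

Lemma Ccontinuous_plus f g x :
  Ccontinuous f x -> Ccontinuous g x -> Ccontinuous (fun y => f y + g y) x.
Proof. apply (continuous_plus (K := C_AbsRing) (V := C_NormedModule)). Qed.

Lemma Ccontinuous_minus f g x :
  Ccontinuous f x -> Ccontinuous g x -> Ccontinuous (fun y => f y - g y) x.
Proof. apply (continuous_minus (K := C_AbsRing) (V := C_NormedModule)). Qed.

Lemma Ccontinuous_mult f g x :
  Ccontinuous f x -> Ccontinuous g x -> Ccontinuous (fun y => f y * g y) x.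
Proof.
  intros Hf Hg.
  refine (continuous_scal (K := C_AbsRing) (V := C_NormedModule) f g x _ Hg).
  intros P HP; apply locally_C in HP; exact (Hf P HP).
Qed.

Lemma Ccontinuous_comp (f : C -> C) g x :
  Ccontinuous g x -> Ccontinuous f (g x) -> Ccontinuous (fun y => f (g y)) x.
Proof. apply (continuous_comp g f). Qed.

Lemma Ccontinuous_inv g x : g x <> 0 -> Ccontinuous g x -> Ccontinuous (fun y => / g y) x.
Proof.
  intros n H; apply (Ccontinuous_comp Cinv g); auto.
  eapply Cderivable_continuous, Cderivable_inv, n.
Qed.

Lemma Ccontinuous_RtoC (f : T -> R) x : continuous f x -> Ccontinuous (fun y => RtoC (f y)) x.
Proof.
  intros H; apply Ccontinuous_eps; intros e e0.
  generalize (proj1 (filterlim_locally f (f x)) H (mkposreal e e0)).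
  apply filter_imp; intros y Hy; rewrite <- RtoC_minus, Cmod_R; exact Hy.
Qed.

Lemma Ccontinuous_Cmod f x : Ccontinuous f x -> continuous (fun y => Cmod (f y)) x.
Proof.
  intros H; apply filterlim_locally; intros e.
  generalize (proj1 (Ccontinuous_eps f x) H e (cond_pos e)).
  apply filter_imp; intros y Hy; unfold ball; cbn; unfold AbsRing_ball, abs, minus; cbn.
  change (Rabs (Cmod (f y) - Cmod (f x)) < e)%R.
  assert (T1 := Cmod_triangle (f y - f x) (f x)).
  assert (T2 := Cmod_triangle (f x - f y) (f y)).
  replace (f y - f x + f x) with (f y) in T1 by ring.
  replace (f x - f y + f y) with (f x) in T2 by ring.
  replace (f x - f y) with (- (f y - f x)) in T2 by ring; rewrite Cmod_opp in T2.
  apply Rabs_def1; lra.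
Qed.
End cont.

Lemma ex_CInt_continuous (F : R -> C) :
  (forall t, (0 <= t <= 1)%R -> Ccontinuous F t) -> ex_CInt F.
Proof.
  intros H; apply (ex_RInt_continuous (V := C_R_CompleteNormedModule)).
  rewrite Rmin_left, Rmax_right by lra; exact H.
Qed.

Lemma is_CInt_CInt (F : R -> C) : (forall t, (0 <= t <= 1)%R -> Ccontinuous F t) -> is_CInt F (CInt F).
Proof. intros H; apply (RInt_correct (V := C_R_CompleteNormedModule)), ex_CInt_continuous, H. Qed.

Lemma is_CInt_ext (F G : R -> C) (l : C) : (forall t, (0 <= t <= 1)%R -> F t = G t) -> is_CInt F l -> is_CInt G l.
Proof.
  intros E; apply is_RInt_ext; rewrite Rmin_left, Rmax_right by lra.
  intros; apply E; lra.
Qed.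

Lemma CInt_ext (F G : R -> C) : (forall t, (0 <= t <= 1)%R -> F t = G t) -> CInt F = CInt G.
Proof.
  intros E; apply (RInt_ext (V := C_R_CompleteNormedModule)).
  rewrite Rmin_left, Rmax_right by lra; intros; apply E; lra.
Qed.

Lemma is_CInt_unique (F : R -> C) (l : C) : is_CInt F l -> CInt F = l.
Proof. apply (is_RInt_unique (V := C_R_CompleteNormedModule)). Qed.

Lemma is_CInt_plus (F G : R -> C) (a b : C) : is_CInt F a -> is_CInt G b -> is_CInt (fun t => F t + G t) (a + b).
Proof. apply (is_RInt_plus (V := C_R_NormedModule)). Qed.

Lemma is_CInt_minus (F G : R -> C) (a b : C) : is_CInt F a -> is_CInt G b -> is_CInt (fun t => F t - G t) (a - b).
Proof. apply (is_RInt_minus (V := C_R_NormedModule)). Qed.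

(** Integrals are real-linear by construction; multiplication by a complex scalar
    has to be checked on real and imaginary parts. *)
Lemma is_CInt_scal (c : C) (F : R -> C) (a : C) : is_CInt F a -> is_CInt (fun t => c * F t) (c * a).
Proof.
  destruct c as [p q]; intros H.
  assert (H1 := is_RInt_fct_extend_fst (U := R_NormedModule) (V := R_NormedModule) _ _ _ _ H).
  assert (H2 := is_RInt_fct_extend_snd (U := R_NormedModule) (V := R_NormedModule) _ _ _ _ H).
  apply (is_RInt_fct_extend_pair (U := R_NormedModule) (V := R_NormedModule)); cbn.
  - apply (is_RInt_minus (V := R_NormedModule));
      apply (is_RInt_scal (V := R_NormedModule)); assumption.
  - apply (is_RInt_plus (V := R_NormedModule));
      apply (is_RInt_scal (V := R_NormedModule)); assumption.
Qed.

Lemma is_CInt_const (c : C) : is_CInt (fun _ => c) c.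
Proof.
  assert (H := is_RInt_const (V := C_R_NormedModule) 0 1 c).
  rewrite scal_C_R in H; replace (RtoC (1 - 0) * c) with c in H; auto.
  rewrite RtoC_minus; Cring.
Qed.

Lemma is_CInt_bound (F : R -> C) (G : R -> R) (l : C) (m : R) :
  (forall t, (0 <= t <= 1)%R -> (Cmod (F t) <= G t)%R) ->
  is_CInt F l -> is_RInt (V := R_NormedModule) G 0 1 m -> (Cmod l <= m)%R.
Proof.
  intros H HF HG; rewrite <- norm_C_R.
  apply (norm_RInt_le (V := C_R_NormedModule) F G 0 1 l m); auto; [lra|].
  intros; rewrite norm_C_R; auto.
Qed.

Lemma is_CInt_le (F : R -> C) (l : C) (M : R) :
  (forall t, (0 <= t <= 1)%R -> (Cmod (F t) <= M)%R) -> is_CInt F l -> (Cmod l <= M)%R.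
Proof.
  intros H HF; apply (is_CInt_bound F (fun _ => M) l M H HF).
  assert (K := is_RInt_const (V := R_NormedModule) 0 1 M).
  unfold scal in K; cbn in K; unfold mult in K; cbn in K.
  replace ((1 - 0) * M)%R with M in K by ring; exact K.
Qed.

(** A complex derivative is in particular a real differential, which is what the
    chain rule along a curve needs. *)
Lemma is_derive_C_along (f : C -> C) (g : R -> C) (t : R) (l d : C) :
  Cderivable f (g t) l -> is_derive (V := C_R_NormedModule) g t d ->
  is_derive (V := C_R_NormedModule) (fun s => f (g s)) t (l * d).
Proof.
  intros Hf Hg.
  assert (Df : filterdiff (U := C_R_NormedModule) (V := C_R_NormedModule) f
      (locally (T := C_R_NormedModule) (g t)) (fun y : C => (l * y)%C)).
  { split.
    - split.
      + intros x y; apply Cmult_plus_distr_l.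
      + intros k x; rewrite !scal_C_R; Cring.
      + exists (Cmod l + 1)%R; split; [assert (h := Cmod_ge_0 l); lra|].
        intros x; rewrite !norm_C_R, Cmod_mult.
        assert (h := Cmod_ge_0 x); nra.
    - intros x Hx e.
      replace x with (g t)
        by (exact (is_filter_lim_locally_unique (V := C_R_NormedModule) (g t) x Hx)).
      apply locally_Cmod.
      destruct (proj1 (Cderivable_eps f (g t) l) Hf e (cond_pos e)) as [r [r0 Hr]].
      exists r; split; auto; intros y Hy; rewrite !norm_C_R; exact (Hr y Hy). }
  assert (K := filterdiff_comp' (U := R_NormedModule) (V := C_R_NormedModule)
    (W := C_R_NormedModule) g f t (fun y => scal y d) (fun y : C => (l * y)%C) Hg Df).
  refine (filterdiff_ext_lin _ _ _ K _).
  intros y; rewrite !scal_C_R; Cring.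
Qed.

Lemma is_derive_affine (a b : C) (t : R) :
  is_derive (V := C_R_NormedModule) (fun s : R => a + RtoC s * b) t b.
Proof.
  assert (H : is_derive (V := C_R_NormedModule)
     (fun s : R => @scal R_AbsRing C_R_NormedModule s b) t b).
  { assert (K := is_derive_scal_l (V := C_R_NormedModule) (fun s : R => s) t 1 b
      (is_derive_id t)).
    rewrite scal_C_R in K; replace (RtoC 1 * b) with b in K by Cring; exact K. }
  assert (K := is_derive_plus (V := C_R_NormedModule) _ _ t _ _
    (is_derive_const (V := C_R_NormedModule) a t) H).
  rewrite plus_zero_l in K.
  apply (is_derive_ext (V := C_R_NormedModule)) with (2 := K).
  intros s; rewrite scal_C_R; reflexivity.
Qed.

Lemma is_CInt_derive (F dF : R -> C) :
  (forall t, (0 <= t <= 1)%R -> is_derive (V := C_R_NormedModule) F t (dF t)) ->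
  (forall t, (0 <= t <= 1)%R -> Ccontinuous dF t) ->
  is_CInt dF (F 1%R - F 0%R).
Proof.
  intros H K; apply (is_RInt_derive (V := C_R_CompleteNormedModule) F dF);
    rewrite Rmin_left, Rmax_right by lra; auto.
Qed.

Lemma Ccontinuous_affine (a b : C) (t : R) : Ccontinuous (fun s : R => a + RtoC s * b) t.
Proof.
  apply Ccontinuous_plus; [apply Ccontinuous_const|].
  apply Ccontinuous_mult; [|apply Ccontinuous_const].
  apply Ccontinuous_RtoC, continuous_id.
Qed.

Lemma is_CInt_segment (f f' : C -> C) (a b : C) :
  (forall t : R, (0 <= t <= 1)%R ->
     Cderivable f (a + RtoC t * (b - a)) (f' (a + RtoC t * (b - a))) /\
     Ccontinuous f' (a + RtoC t * (b - a))) ->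
  is_CInt (fun t => f' (a + RtoC t * (b - a)) * (b - a)) (f b - f a).
Proof.
  intros H.
  replace (f b) with (f (a + RtoC 1 * (b - a))) by (f_equal; ring).
  replace (f a) with (f (a + RtoC 0 * (b - a))) by (f_equal; ring).
  apply (is_CInt_derive (fun t : R => f (a + RtoC t * (b - a)))).
  - intros t Ht; apply is_derive_C_along; [apply H, Ht | apply is_derive_affine].
  - intros t Ht; apply Ccontinuous_mult; [|apply Ccontinuous_const].
    apply (Ccontinuous_comp f'); [apply Ccontinuous_affine | apply H, Ht].
Qed.

(** Compactness of the unit interval turns a property that holds locally near each
    point of the slice over [z0] into a property of a whole strip. *)
Lemma tube (z0 : C) (P : R -> C -> Prop) :
  (forall t, (0 <= t <= 1)%R ->
    locally (T := prod_UniformSpace R_UniformSpace C_UniformSpace) (t, z0)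
      (fun p => P (fst p) (snd p))) ->
  exists d : R, (0 < d)%R /\ forall t z, (0 <= t <= 1)%R -> (Cmod (z - z0) < d)%R -> P t z.
Proof.
  intros H.
  assert (D : forall t : R, exists d : posreal, (0 <= t <= 1)%R ->
        forall (s : R) (y : C), (Rabs (s - t) < d)%R -> ball z0 d y -> P s y).
  { intros t; destruct (excluded_middle_informative (0 <= t <= 1)%R) as [Ht|Ht].
    2:{ exists (mkposreal 1 Rlt_0_1); tauto. }
    destruct (H t Ht) as [d Hd]; exists d; intros _ s y Hs Hy.
    apply (Hd (s, y)); split; [exact Hs | exact Hy]. }
  destruct (choice _ D) as [delta Hdelta].
  destruct (compactness_value_1d 0 1 delta) as [d Hd].
  exists d; split; [apply cond_pos|]; intros t z Ht Hz.
  apply NNPP; intros N; apply (Hd t Ht); intros [u [Hu [Hut Hdu]]]; apply N.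
  apply (Hdelta u Hu t z Hut).
  apply ball_le with d; auto; apply C_NormedModule_mixin_compat1, Hz.
Qed.

(** * Differentiation under the integral sign *)

Notation RxC := (prod_UniformSpace R_UniformSpace C_UniformSpace).

Lemma Ccontinuous_fst_slice (g : R -> C -> C) (t : R) (z : C) :
  continuous (T := RxC) (U := C_UniformSpace) (fun p => g (fst p) (snd p)) (t, z) ->
  Ccontinuous (fun s => g s z) t.
Proof.
  intros H P HP; destruct (H P HP) as [d Hd]; exists d; intros s Hs.
  apply (Hd (s, z)); split; [exact Hs | apply ball_center].
Qed.

Lemma Ccontinuous_snd_slice (g : R -> C -> C) (t : R) (z : C) :
  continuous (T := RxC) (U := C_UniformSpace) (fun p => g (fst p) (snd p)) (t, z) ->
  Ccontinuous (g t) z.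
Proof.
  intros H P HP; destruct (H P HP) as [d Hd]; exists d; intros y Hy.
  apply (Hd (t, y)); split; [apply ball_center | exact Hy].
Qed.

(** The increment of each integrand is the integral of its derivative over the
    segment from [z0] to [z]; by the tube lemma that derivative stays uniformly
    close to its value at [z0], and the estimate can be integrated. *)
Lemma Cderivable_CInt (g g' : R -> C -> C) (W : RxC -> Prop) (z0 : C) :
  open W -> (forall t, (0 <= t <= 1)%R -> W (t, z0)) ->
  (forall t z, W (t, z) -> Cderivable (g t) z (g' t z) /\
     continuous (T := RxC) (U := C_UniformSpace) (fun p => g (fst p) (snd p)) (t, z) /\
     continuous (T := RxC) (U := C_UniformSpace) (fun p => g' (fst p) (snd p)) (t, z)) ->
  Cderivable (fun z => CInt (fun t => g t z)) z0 (CInt (fun t => g' t z0)).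
Proof.
  intros oW W0 H; apply Cderivable_eps; intros e e0.
  destruct (tube z0 (fun t z => W (t, z) /\ (Cmod (g' t z - g' t z0) <= e)%R))
    as [d [d0 Hd]].
  { intros t Ht.
    assert (e2 : (0 < e / 2)%R) by lra.
    assert (L := proj1 (Ccontinuous_eps _ _) (proj2 (proj2 (H t z0 (W0 t Ht)))) _ e2).
    cbn beta in L; cbn [fst snd] in L.
    assert (L2 : locally (T := RxC) (t, z0)
      (fun p : RxC => (Cmod (g' (fst p) z0 - g' t z0) < e / 2)%R)).
    { destruct L as [q Hq]; exists q; intros [s y] [Hs Hy].
      apply (Hq (s, z0)); split; [exact Hs | apply ball_center]. }
    generalize (filter_and _ _ (oW _ (W0 t Ht)) (filter_and _ _ L L2)).
    apply filter_imp; intros [s y] [H1 [H2 H3]]; split; [exact H1|].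
    cbn [fst snd] in *.
    replace (g' s y - g' s z0) with ((g' s y - g' t z0) + - (g' s z0 - g' t z0)) by ring.
    eapply Rle_trans; [apply Cmod_triangle|]; rewrite Cmod_opp; lra. }
  exists d; split; auto; intros z Hz.
  assert (z0d : (Cmod (z0 - z0) < d)%R)
    by (replace (z0 - z0) with (RtoC 0) by ring; rewrite Cmod_0; auto).
  assert (I : forall y, (Cmod (y - z0) < d)%R -> is_CInt (fun t => g t y) (CInt (fun t => g t y))).
  { intros y Hy; apply is_CInt_CInt; intros t Ht; apply (Ccontinuous_fst_slice g).
    apply H, (Hd t y Ht Hy). }
  assert (I' : is_CInt (fun t => g' t z0) (CInt (fun t => g' t z0))).
  { apply is_CInt_CInt; intros t Ht; apply (Ccontinuous_fst_slice g').
    apply H, (Hd t z0 Ht z0d). }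
  assert (K := is_CInt_minus _ _ _ _ (is_CInt_minus _ _ _ _ (I z Hz) (I z0 z0d))
    (is_CInt_scal (z - z0) _ _ I')).
  rewrite (Cmult_comm _ (z - z0)).
  apply (is_CInt_le _ _ _) with (2 := K); intros t Ht.
  assert (B : forall s : R, (0 <= s <= 1)%R -> (Cmod (z0 + RtoC s * (z - z0) - z0) < d)%R).
  { intros s Hs; replace (z0 + RtoC s * (z - z0) - z0) with (RtoC s * (z - z0)) by ring.
    rewrite Cmod_mult, Cmod_R, Rabs_pos_eq by lra.
    assert (h := Cmod_ge_0 (z - z0)); nra. }
  assert (S : is_CInt (fun s => g' t (z0 + RtoC s * (z - z0)) * (z - z0)) (g t z - g t z0)).
  { apply (is_CInt_segment (g t) (g' t)); intros s Hs.
    destruct (Hd t _ Ht (B s Hs)) as [w _]; destruct (H _ _ w) as [D [_ c]].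
    split; auto; apply (Ccontinuous_snd_slice g'), c. }
  apply (is_CInt_le _ _ _) with (2 := is_CInt_minus _ _ _ _ S (is_CInt_const ((z - z0) * g' t z0))).
  intros s Hs; destruct (Hd t _ Ht (B s Hs)) as [_ b].
  replace (g' t (z0 + RtoC s * (z - z0)) * (z - z0) - (z - z0) * g' t z0)
    with ((g' t (z0 + RtoC s * (z - z0)) - g' t z0) * (z - z0)) by ring.
  rewrite Cmod_mult; apply Rmult_le_compat_r; [apply Cmod_ge_0 | exact b].
Qed.

(** * Sequences with geometric increments *)

Lemma geometric_small (K e : R) :
  (0 <= K)%R -> (0 < e)%R -> exists N, forall n, (N <= n)%nat -> (K / 2 ^ n < e)%R.
Proof.
  intros K0 e0.
  destruct (pow_lt_1_zero (/ 2) ltac:(rewrite Rabs_pos_eq; lra) (e / (K + 1)))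
    as [N HN]; [apply Rdiv_lt_0_compat; lra|].
  exists N; intros n Hn; specialize (HN n Hn).
  assert (i0 : (0 < / 2 ^ n)%R) by (apply Rinv_0_lt_compat, pow_lt; lra).
  rewrite Rabs_pos_eq in HN by (apply pow_le; lra); rewrite pow_inv in HN.
  apply Rmult_lt_compat_l with (r := (K + 1)%R) in HN; [|lra].
  replace ((K + 1) * (e / (K + 1)))%R with e in HN by (field; lra).
  unfold Rdiv; lra.
Qed.

(** The rate is explicit so that, applied pointwise, the lemma yields uniform
    convergence. *)
Lemma Cgeometric_limit (a : nat -> C) (K : R) :
  (forall n, (Cmod (a (S n) - a n) <= K / 2 ^ n)%R) ->
  exists p, forall n, (Cmod (a n - p) <= 2 * K / 2 ^ n)%R.
Proof.
  intros H.
  assert (p2 : forall n, (0 < 2 ^ n)%R) by (intros; apply pow_lt; lra).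
  assert (K0 : (0 <= K)%R).
  { generalize (H O); assert (h := Cmod_ge_0 (a 1%nat - a O)); cbn; intros; lra. }
  assert (D : forall n m, (Cmod (a (n + m)%nat - a n) <= 2 * K / 2 ^ n - 2 * K / 2 ^ (n + m))%R).
  { intros n; induction m as [|m IH].
    - rewrite Nat.add_0_r; replace (a n - a n) with (RtoC 0) by ring; rewrite Cmod_0; lra.
    - replace (n + S m)%nat with (S (n + m)) by lia.
      replace (a (S (n + m)) - a n) with ((a (S (n + m)) - a (n + m)%nat) + (a (n + m)%nat - a n))
        by ring.
      eapply Rle_trans; [apply Cmod_triangle|].
      specialize (H (n + m)%nat); specialize (p2 (n + m)%nat).
      replace (2 * K / 2 ^ S (n + m))%R with (K / 2 ^ (n + m))%R by (cbn; field; lra).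
      replace (2 * K / 2 ^ (n + m))%R with (K / 2 ^ (n + m) + K / 2 ^ (n + m))%R in IH
        by (field; lra).
      lra. }
  assert (small := fun e => geometric_small (2 * K) e ltac:(lra)).
  assert (D' : forall n m, (n <= m)%nat -> (Cmod (a m - a n) <= 2 * K / 2 ^ n)%R).
  { intros n m nm; replace m with (n + (m - n))%nat by lia.
    eapply Rle_trans; [apply D|].
    assert (0 <= 2 * K / 2 ^ (n + (m - n)))%R; [|lra].
    apply Rdiv_le_0_compat; [lra | apply p2]. }
  assert (cauchy : forall pr : C -> R, (forall z w, (Rabs (pr z - pr w) <= Cmod (z - w))%R) ->
     { l | Un_cv (fun n => pr (a n)) l }).
  { intros pr Hpr; apply Rcomplete.R_complete; intros e e0.
    destruct (small (e / 2)%R ltac:(lra)) as [N HN]; exists N; intros n m Hn Hm.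
    unfold Rdist.
    eapply Rle_lt_trans; [apply Hpr|].
    replace (a n - a m) with ((a n - a N) + - (a m - a N)) by ring.
    eapply Rle_lt_trans; [apply Cmod_triangle|]; rewrite Cmod_opp.
    assert (h1 := D' N n Hn); assert (h2 := D' N m Hm); specialize (HN N (Nat.le_refl N)); lra. }
  assert (hf : forall z w : C, (Rabs (fst z - fst w) <= Cmod (z - w))%R).
  { intros z w; eapply Rle_trans; [|apply (Rmax_Cmod (z - w))]; apply Rmax_l. }
  assert (hs : forall z w : C, (Rabs (snd z - snd w) <= Cmod (z - w))%R).
  { intros z w; eapply Rle_trans; [|apply (Rmax_Cmod (z - w))]; apply Rmax_r. }
  destruct (cauchy fst hf) as [x Hx], (cauchy snd hs) as [y Hy].
  pose (p := (x, y) : C).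
  exists p; intros n; apply le_epsilon; intros e e0.
  destruct (Hx (e / 2)%R ltac:(lra)) as [N1 HN1], (Hy (e / 2)%R ltac:(lra)) as [N2 HN2].
  set (m := (n + N1 + N2)%nat).
  replace (a n - p) with (- (a m - a n) + (a m - p)) by ring.
  eapply Rle_trans; [apply Cmod_triangle|]; rewrite Cmod_opp.
  assert (h1 := D' n m ltac:(unfold m; lia)).
  specialize (HN1 m ltac:(unfold m; lia)); specialize (HN2 m ltac:(unfold m; lia)).
  unfold Rdist in HN1, HN2.
  assert (h2 : (Cmod (a m - p) <= e)%R).
  { replace (a m - p) with (RtoC (fst (a m) - x) + Ci * RtoC (snd (a m) - y)).
    - eapply Rle_trans; [apply Cmod_triangle|].
      rewrite Cmod_mult, Cmod_Ci, !Cmod_R; lra.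
    - unfold p; destruct (a m) as [u v]; unfold Cplus, Cminus, Copp, Cmult, Ci, RtoC; apply injective_projections; cbn; ring. }
  lra.
Qed.

(** * Segment integrals and Goursat's theorem *)

Definition Cseg (a b : C) : C -> Prop :=
  fun z => exists t : R, (0 <= t <= 1)%R /\ z = a + RtoC t * (b - a).

Lemma is_segment_integral (f : C -> C) (a b : C) :
  (forall z, Cseg a b z -> Ccontinuous f z) ->
  is_CInt (fun t => f (a + RtoC t * (b - a)) * (b - a)) (segment_integral f a b).
Proof.
  intros H; apply is_CInt_CInt; intros t Ht; apply Ccontinuous_mult; [|apply Ccontinuous_const].
  apply (Ccontinuous_comp f); [apply Ccontinuous_affine|]; apply H; exists t; auto.
Qed.

(** Splitting and reversing segments are both affine reparametrizations of the
    same integral; [u] is the scaling factor and [v] the parameter of the new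
    origin. *)
Lemma segment_integral_lin (f : C -> C) (a b : C) (u v : R) :
  (forall z, Cseg a b z -> Ccontinuous f z) ->
  (0 <= v <= 1)%R -> (0 <= u + v <= 1)%R ->
  is_RInt (V := C_R_NormedModule) (fun t : R => f (a + RtoC t * (b - a)) * (b - a)) v (u + v)
    (segment_integral f (a + RtoC v * (b - a)) (a + RtoC (u + v) * (b - a))).
Proof.
  intros H Hv Huv.
  assert (E : ex_RInt (V := C_R_CompleteNormedModule)
     (fun t : R => f (a + RtoC t * (b - a)) * (b - a)) v (u + v)).
  { apply (ex_RInt_continuous (V := C_R_CompleteNormedModule)).
    intros t Ht; apply Ccontinuous_mult; [|apply Ccontinuous_const].
    apply (Ccontinuous_comp f); [apply Ccontinuous_affine|]; apply H; exists t; split; auto.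
    revert Ht; unfold Rmin, Rmax; destruct (Rle_dec v (u + v)); lra. }
  apply (RInt_correct (V := C_R_CompleteNormedModule)) in E.
  assert (K := E); replace v with (u * 0 + v)%R in K at 1 by ring.
  replace (u + v)%R with (u * 1 + v)%R in K at 1 by ring.
  apply (is_RInt_comp_lin (V := C_R_NormedModule)) in K.
  replace (segment_integral f (a + RtoC v * (b - a)) (a + RtoC (u + v) * (b - a)))
    with (RInt (V := C_R_CompleteNormedModule)
       (fun t : R => f (a + RtoC t * (b - a)) * (b - a)) v (u + v)); [exact E|].
  symmetry; apply is_CInt_unique.
  apply is_CInt_ext with (2 := K); intros t _; rewrite scal_C_R.
  rewrite RtoC_plus, RtoC_mult, RtoC_plus.
  replace (a + RtoC v * (b - a) + RtoC t * (a + (RtoC u + RtoC v) * (b - a) - (a + RtoC v * (b - a))))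
    with (a + (RtoC u * RtoC t + RtoC v) * (b - a)) by ring.
  ring.
Qed.

Lemma segment_integral_split (f : C -> C) (a b : C) :
  (forall z, Cseg a b z -> Ccontinuous f z) ->
  segment_integral f a b = segment_integral f a ((a + b) / 2) + segment_integral f ((a + b) / 2) b.
Proof.
  intros H; apply is_CInt_unique.
  assert (L := segment_integral_lin f a b (/2) 0 H ltac:(lra) ltac:(lra)).
  assert (L' := segment_integral_lin f a b (/2) (/2) H ltac:(lra) ltac:(lra)).
  replace (a + RtoC 0 * (b - a)) with a in L by ring.
  replace (a + RtoC (/2 + 0) * (b - a)) with ((a + b) / 2) in L
    by (rewrite RtoC_plus, RtoC_inv by lra; field).
  replace (a + RtoC (/2) * (b - a)) with ((a + b) / 2) in L' by (rewrite RtoC_inv by lra; field).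
  replace (/2 + /2)%R with 1%R in L' by field.
  replace (a + RtoC 1 * (b - a)) with b in L' by ring.
  rewrite Rplus_0_r in L.
  exact (is_RInt_Chasles (V := C_R_NormedModule) _ _ _ _ _ _ L L').
Qed.

Lemma segment_integral_swap (f : C -> C) (a b : C) :
  (forall z, Cseg a b z -> Ccontinuous f z) ->
  segment_integral f b a = - segment_integral f a b.
Proof.
  intros H.
  assert (L := segment_integral_lin f a b (-1) 1 H ltac:(lra) ltac:(lra)).
  replace (-1 + 1)%R with 0%R in L by ring.
  replace (a + RtoC 0 * (b - a)) with a in L by ring.
  replace (a + RtoC 1 * (b - a)) with b in L by ring.
  apply (is_RInt_swap (V := C_R_NormedModule)) in L.
  apply is_CInt_unique in L; unfold segment_integral at 2; rewrite L.
  change (segment_integral f b a = - - segment_integral f b a); ring.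
Qed.

(** The form in which segment integrals are estimated: comparing with a second
    function avoids computing the integral of a difference each time. *)
Lemma segment_integral_close (f g : C -> C) (a b : C) (M : R) :
  (forall z, Cseg a b z -> Ccontinuous f z /\ Ccontinuous g z /\ (Cmod (f z - g z) <= M)%R) ->
  (Cmod (segment_integral f a b - segment_integral g a b) <= M * Cmod (b - a))%R.
Proof.
  intros H.
  assert (I := is_CInt_minus _ _ _ _
    (is_segment_integral f a b (fun z Hz => proj1 (H z Hz)))
    (is_segment_integral g a b (fun z Hz => proj1 (proj2 (H z Hz))))).
  apply is_CInt_le with (2 := I); intros t Ht.
  replace (f (a + RtoC t * (b - a)) * (b - a) - g (a + RtoC t * (b - a)) * (b - a))
    with ((f (a + RtoC t * (b - a)) - g (a + RtoC t * (b - a))) * (b - a)) by ring.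
  rewrite Cmod_mult; apply Rmult_le_compat_r; [apply Cmod_ge_0|].
  apply H; exists t; auto.
Qed.

Lemma Cseg_ball (a b c z : C) (r : R) :
  (Cmod (a - c) <= r)%R -> (Cmod (b - c) <= r)%R -> Cseg a b z -> (Cmod (z - c) <= r)%R.
Proof.
  intros Ha Hb [t [Ht ->]].
  replace (a + RtoC t * (b - a) - c) with (RtoC (1 - t) * (a - c) + RtoC t * (b - c))
    by (rewrite RtoC_minus; ring).
  eapply Rle_trans; [apply Cmod_triangle|].
  rewrite !Cmod_mult, !Cmod_R, !Rabs_pos_eq by lra; nra.
Qed.

Lemma segment_integral_derive (f f' : C -> C) (a b : C) :
  (forall z, Cseg a b z -> Cderivable f z (f' z) /\ Ccontinuous f' z) ->
  segment_integral f' a b = f b - f a.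
Proof.
  intros H; apply is_CInt_unique, is_CInt_segment; intros t Ht; apply H; exists t; auto.
Qed.

Definition triangle_integral (f : C -> C) (T : C * C * C) : C :=
  let '(a, b, c) := T in
  segment_integral f a b + segment_integral f b c + segment_integral f c a.

Definition triangle_in_disc (r : R) (T : C * C * C) : Prop :=
  let '(a, b, c) := T in (Cmod a <= r /\ Cmod b <= r /\ Cmod c <= r)%R.

Definition triangle_sides (T : C * C * C) (s : R) : Prop :=
  let '(a, b, c) := T in (Cmod (b - a) <= s /\ Cmod (c - b) <= s /\ Cmod (a - c) <= s)%R.

Lemma Cmod_half (z : C) : Cmod (z / 2) = (Cmod z / 2)%R.
Proof.
  rewrite Cmod_div.
  - rewrite Cmod_R, Rabs_pos_eq by lra; reflexivity.
  - intros E; apply RtoC_inj in E; lra.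
Qed.

Lemma Cseg_disc (a b z : C) (r : R) :
  (Cmod a <= r)%R -> (Cmod b <= r)%R -> Cseg a b z -> (Cmod z <= r)%R.
Proof.
  intros Ha Hb S; replace z with (z - 0) by ring.
  apply (Cseg_ball a b 0 z r); [now replace (a - 0) with a by ring |
    now replace (b - 0) with b by ring | exact S].
Qed.

Lemma Cmod_midpoint (a b : C) (r : R) :
  (Cmod a <= r)%R -> (Cmod b <= r)%R -> (Cmod ((a + b) / 2) <= r)%R.
Proof.
  intros Ha Hb; rewrite Cmod_half; assert (T := Cmod_triangle a b); lra.
Qed.

(** The midpoints cut a triangle into four similar ones, whose integrals add up to
    the given one since the inner edges cancel; so one of the four carries at
    least a quarter of the integral.  The last clause records how sides and first
    vertices behave, to make the nested triangles converge. *)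
Lemma triangle_bisect (f : C -> C) (r : R) (T : C * C * C) :
  (forall z, (Cmod z <= r)%R -> Ccontinuous f z) -> triangle_in_disc r T ->
  exists T', triangle_in_disc r T' /\
    (Cmod (triangle_integral f T) <= 4 * Cmod (triangle_integral f T'))%R /\
    forall s, triangle_sides T s ->
      triangle_sides T' (s / 2) /\ (Cmod (fst (fst T') - fst (fst T)) <= s)%R.
Proof.
  destruct T as [[a b] c]; cbn [fst snd].
  intros H [Ha [Hb Hc]].
  set (m := (a + b) / 2); set (n := (b + c) / 2); set (p := (c + a) / 2).
  assert (Hm : (Cmod m <= r)%R) by now apply Cmod_midpoint.
  assert (Hn : (Cmod n <= r)%R) by now apply Cmod_midpoint.
  assert (Hp : (Cmod p <= r)%R) by now apply Cmod_midpoint.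
  assert (G : forall x y, (Cmod x <= r)%R -> (Cmod y <= r)%R ->
    forall z, Cseg x y z -> Ccontinuous f z).
  { intros x y Hx Hy z Hz; apply H, (Cseg_disc x y z r); auto. }
  assert (S : triangle_integral f (a, b, c) =
    triangle_integral f (a, m, p) + triangle_integral f (m, b, n) +
    triangle_integral f (p, n, c) + triangle_integral f (m, n, p)).
  { unfold triangle_integral; rewrite (segment_integral_split f a b), (segment_integral_split f b c),
      (segment_integral_split f c a) by eauto; fold m n p.
    rewrite (segment_integral_swap f m p), (segment_integral_swap f n m),
      (segment_integral_swap f p n) by eauto; ring. }
  assert (B : forall s, triangle_sides (a, b, c) s ->
     (Cmod ((b - a) / 2) <= s / 2 /\ Cmod ((c - b) / 2) <= s / 2 /\ Cmod ((a - c) / 2) <= s / 2)%R).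
  { intros s [S1 [S2 S3]]; rewrite !Cmod_half; lra. }
  assert (sym : forall x y s, (Cmod x <= s)%R -> y = x \/ y = - x -> (Cmod y <= s)%R)
    by (intros x y s Hx [-> | ->]; now rewrite ?Cmod_opp).
  assert (two : RtoC 2 <> 0) by (intros E; apply RtoC_inj in E; lra).
  assert (pos : forall s, triangle_sides (a, b, c) s -> (0 <= s)%R)
    by (intros s [S1 _]; assert (h := Cmod_ge_0 (b - a)); lra).
  pose (A := fun T => Cmod (triangle_integral f T)).
  assert (Q : (A (a,b,c) <= 4 * A (a,m,p))%R \/ (A (a,b,c) <= 4 * A (m,b,n))%R \/
     (A (a,b,c) <= 4 * A (p,n,c))%R \/ (A (a,b,c) <= 4 * A (m,n,p))%R).
  { assert (L : (A (a,b,c) <= A (a,m,p) + A (m,b,n) + A (p,n,c) + A (m,n,p))%R).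
    { unfold A; rewrite S.
      do 3 (eapply Rle_trans; [apply Cmod_triangle|]; apply Rplus_le_compat_r).
      apply Rle_refl. }
    lra. }
  destruct Q as [Q|[Q|[Q|Q]]].
  - exists (a, m, p); split; [repeat split; auto | split; [exact Q|]].
    intros s Hs; destruct (B s Hs) as [B1 [B2 B3]]; specialize (pos s Hs).
    unfold triangle_sides; cbn [fst snd]; replace (a - a) with (RtoC 0) by ring; rewrite Cmod_0.
    repeat split; auto.
    + apply (sym _ _ _ B1); unfold m; solve [left; field; auto | right; field; auto].
    + apply (sym _ _ _ B2); unfold m, p; solve [left; field; auto | right; field; auto].
    + apply (sym _ _ _ B3); unfold p; solve [left; field; auto | right; field; auto].
  - exists (m, b, n); split; [repeat split; auto | split; [exact Q|]].
    intros s Hs; destruct (B s Hs) as [B1 [B2 B3]]; specialize (pos s Hs).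
    unfold triangle_sides; cbn [fst snd]; repeat split.
    + replace (b - m) with ((b - a) / 2) by (unfold m; field; auto); auto.
    + replace (n - b) with ((c - b) / 2) by (unfold n; field; auto); auto.
    + replace (m - n) with ((a - c) / 2) by (unfold m, n; field; auto); auto.
    + replace (m - a) with ((b - a) / 2) by (unfold m; field; auto); lra.
  - exists (p, n, c); split; [repeat split; auto | split; [exact Q|]].
    intros s Hs; destruct (B s Hs) as [B1 [B2 B3]]; specialize (pos s Hs).
    unfold triangle_sides; cbn [fst snd]; repeat split.
    + replace (n - p) with ((b - a) / 2) by (unfold n, p; field; auto); auto.
    + replace (c - n) with ((c - b) / 2) by (unfold n; field; auto); auto.
    + replace (p - c) with ((a - c) / 2) by (unfold p; field; auto); auto.
    + apply (sym ((a - c) / 2)); [lra | right; unfold p; field; auto].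
  - exists (m, n, p); split; [repeat split; auto | split; [exact Q|]].
    intros s Hs; destruct (B s Hs) as [B1 [B2 B3]]; specialize (pos s Hs).
    unfold triangle_sides; cbn [fst snd]; repeat split.
    + apply (sym _ _ _ B3); unfold m, n; solve [left; field; auto | right; field; auto].
    + apply (sym _ _ _ B1); unfold n, p; solve [left; field; auto | right; field; auto].
    + apply (sym _ _ _ B2); unfold m, p; solve [left; field; auto | right; field; auto].
    + replace (m - a) with ((b - a) / 2) by (unfold m; field; auto); lra.
Qed.

(** Bisecting repeatedly, the triangles shrink to a point [p] of the larger disc.
    There [f] is an affine function, whose integral over triangles is zero, plus
    an error [e * |z - p|]; on a triangle of side [s] the error contributes at most
    [9 e s^2], which compensates exactly the factor [4^n] lost in [n] bisections. *)
Lemma Goursat (f f' : C -> C) (r rho : R) (T : C * C * C) :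
  (r < rho)%R -> (forall z, (Cmod z < rho)%R -> Cderivable f z (f' z)) ->
  triangle_in_disc r T -> triangle_integral f T = 0.
Proof.
  intros rR H HT.
  assert (Hc : forall z, (Cmod z <= r)%R -> Ccontinuous f z)
    by (intros z Hz; eapply Cderivable_continuous, H; lra).
  destruct (choice (fun T T' => triangle_in_disc r T -> triangle_in_disc r T' /\
    (Cmod (triangle_integral f T) <= 4 * Cmod (triangle_integral f T'))%R /\
    forall s, triangle_sides T s ->
      triangle_sides T' (s / 2) /\ (Cmod (fst (fst T') - fst (fst T)) <= s)%R))
    as [step Hstep].
  { intros U; destruct (classic (triangle_in_disc r U)) as [i|i].
    - destruct (triangle_bisect f r U Hc i) as [U' HU']; exists U'; auto.
    - exists U; tauto. }
  pose (Ts := fun n => Nat.iter n step T).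
  assert (In : forall n, triangle_in_disc r (Ts n)).
  { induction n as [|n IH]; [exact HT | exact (proj1 (Hstep _ IH))]. }
  assert (Big : forall n, (Cmod (triangle_integral f T) <= 4 ^ n * Cmod (triangle_integral f (Ts n)))%R).
  { induction n as [|n IH]; [cbn; lra|].
    destruct (Hstep _ (In n)) as [_ [h _]]; change (step (Ts n)) with (Ts (S n)) in h.
    cbn [pow]; assert (p4 : (0 < 4 ^ n)%R) by (apply pow_lt; lra); nra. }
  pose (d := (Rmax (Cmod (snd (fst T) - fst (fst T)))
    (Rmax (Cmod (snd T - snd (fst T))) (Cmod (fst (fst T) - snd T))))%R).
  assert (Sd : forall n, triangle_sides (Ts n) (d / 2 ^ n)).
  { induction n as [|n IH].
    - change (Ts O) with T; replace (d / 2 ^ 0)%R with d by (cbn; field).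
      destruct T as [[a b] c]; unfold d; cbn; repeat split.
      + apply Rmax_l.
      + eapply Rle_trans; [|apply Rmax_r]; apply Rmax_l.
      + eapply Rle_trans; [|apply Rmax_r]; apply Rmax_r.
    - destruct (Hstep _ (In n)) as [_ [_ h]]; destruct (h _ IH) as [h' _].
      replace (d / 2 ^ S n)%R with (d / 2 ^ n / 2)%R; [exact h'|].
      cbn; field; apply pow_nonzero; lra. }
  assert (d0 : (0 <= d)%R) by (eapply Rle_trans; [apply Cmod_ge_0 | apply Rmax_l]).
  assert (p2 : forall n, (0 < 2 ^ n)%R) by (intros; apply pow_lt; lra).
  destruct (Cgeometric_limit (fun n => fst (fst (Ts n))) d) as [p Hp].
  { intros n; destruct (Hstep _ (In n)) as [_ [_ h]]; apply (h _ (Sd n)). }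
  assert (small : forall e, (0 < e)%R -> exists n, (3 * (d / 2 ^ n) < e)%R).
  { intros e e0; destruct (geometric_small (3 * d) e ltac:(lra) e0) as [n Hn].
    exists n; specialize (Hn n (Nat.le_refl n)); unfold Rdiv in *; lra. }
  (* The triangles stay in the disc of radius r, hence so does p up to any margin. *)
  assert (Hpr : (Cmod p < rho)%R).
  { destruct (small (rho - r)%R ltac:(lra)) as [n Hn].
    specialize (Hp n); specialize (In n); destruct (Ts n) as [[a b] c]; cbn [fst] in Hp.
    destruct In as [Ia _].
    assert (t := Cmod_triangle a (- (a - p))); rewrite Cmod_opp in t.
    replace (a + - (a - p)) with p in t by ring.
    assert (h : (0 <= d / 2 ^ n)%R) by (apply Rdiv_le_0_compat; auto).
    replace (2 * d / 2 ^ n)%R with (2 * (d / 2 ^ n))%R in Hp by (unfold Rdiv; ring).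
    lra. }
  assert (K : forall e, (0 < e)%R -> (Cmod (triangle_integral f T) <= 9 * d * d * e)%R).
  { intros e e0.
    destruct (proj1 (Cderivable_eps _ _ _) (H p Hpr) e e0) as [q [q0 Hq]].
    destruct (small q q0) as [n Hn].
    eapply Rle_trans; [apply (Big n)|].
    set (s := (d / 2 ^ n)%R) in *.
    assert (s0 : (0 <= s)%R) by (apply Rdiv_le_0_compat; auto).
    replace (9 * d * d * e)%R with (4 ^ n * (9 * s * s * e))%R.
    2:{ unfold s; replace 4%R with (2 * 2)%R by ring; rewrite Rpow_mult_distr.
        field; specialize (p2 n); lra. }
    apply Rmult_le_compat_l; [apply pow_le; lra|].
    specialize (Hp n); specialize (In n); specialize (Sd n); fold s in Sd.
    destruct (Ts n) as [[a b] c]; cbn [fst] in Hp.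
    replace (2 * d / 2 ^ n)%R with (2 * s)%R in Hp by (unfold s, Rdiv; ring).
    destruct In as [Ia [Ib Ic]], Sd as [Sa [Sb Sc]].
    assert (Pa : (Cmod (a - p) <= 3 * s)%R) by lra.
    assert (Pb : (Cmod (b - p) <= 3 * s)%R).
    { replace (b - p) with ((b - a) + (a - p)) by ring.
      eapply Rle_trans; [apply Cmod_triangle|]; lra. }
    assert (Pc : (Cmod (c - p) <= 3 * s)%R).
    { replace (c - p) with (- (a - c) + (a - p)) by ring.
      eapply Rle_trans; [apply Cmod_triangle|]; rewrite Cmod_opp; lra. }
    (* g is the affine approximation of f at p and G a primitive of it. *)
    pose (g := fun z => f p + f' p * (z - p)).
    pose (G := fun z => f p * z + f' p / 2 * ((z - p) * (z - p))).
    assert (two : RtoC 2 <> 0) by (intros E; apply RtoC_inj in E; lra).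
    assert (Dz : forall z, Cderivable (fun y => y - p) z (1 - 0))
      by (intros z; apply Cderivable_minus; [apply Cderivable_id | apply Cderivable_const]).
    assert (HG : forall z, Cderivable G z (g z)).
    { intros z.
      assert (K := Cderivable_plus _ _ _ _ _
        (Cderivable_mult _ _ _ _ _ (Cderivable_const (f p) z) (Cderivable_id z))
        (Cderivable_mult _ _ _ _ _ (Cderivable_const (f' p / 2) z)
          (Cderivable_mult _ _ _ _ _ (Dz z) (Dz z)))).
      cbn beta in K.
      replace (g z) with (0 * z + f p * 1 + (0 * ((z - p) * (z - p)) +
        f' p / 2 * ((1 - 0) * (z - p) + (z - p) * (1 - 0)))); [exact K|].
      unfold g; field; auto. }
    assert (Cg : forall z, Ccontinuous g z).
    { intros z; unfold g; apply Ccontinuous_plus; [apply Ccontinuous_const|].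
      apply Ccontinuous_mult; [apply Ccontinuous_const|].
      eapply Cderivable_continuous, Dz. }
    assert (Z : triangle_integral g (a, b, c) = 0).
    { unfold triangle_integral; rewrite !(segment_integral_derive G g) by auto; ring. }
    assert (near : forall x y, (Cmod x <= r)%R -> (Cmod y <= r)%R ->
       (Cmod (x - p) <= 3 * s)%R -> (Cmod (y - p) <= 3 * s)%R -> (Cmod (y - x) <= s)%R ->
       (Cmod (segment_integral f x y - segment_integral g x y) <= 3 * s * s * e)%R).
    { intros x y Hx Hy Px Py Pxy.
      eapply Rle_trans; [apply (segment_integral_close f g x y (e * (3 * s)))|].
      - intros z Hz; split; [|split; [apply Cg|]].
        + apply Hc, (Cseg_disc x y z r); auto.
        + assert (Pz := Cseg_ball x y p z _ Px Py Hz).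
          replace (f z - g z) with (f z - f p - f' p * (z - p)) by (unfold g; ring).
          eapply Rle_trans; [apply Hq; lra|]; apply Rmult_le_compat_l; lra.
      - replace (3 * s * s * e)%R with (e * (3 * s) * s)%R by ring.
        apply Rmult_le_compat_l; [|exact Pxy].
        apply Rmult_le_pos; lra. }
    replace (triangle_integral f (a, b, c))
      with (triangle_integral f (a, b, c) - triangle_integral g (a, b, c)) by (rewrite Z; ring).
    unfold triangle_integral.
    replace (segment_integral f a b + segment_integral f b c + segment_integral f c a -
      (segment_integral g a b + segment_integral g b c + segment_integral g c a))
      with ((segment_integral f a b - segment_integral g a b) +
        (segment_integral f b c - segment_integral g b c) +
        (segment_integral f c a - segment_integral g c a)) by ring.
    assert (n1 := near a b Ia Ib Pa Pb Sa).
    assert (n2 := near b c Ib Ic Pb Pc Sb).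
    assert (n3 := near c a Ic Ia Pc Pa Sc).
    eapply Rle_trans; [apply Cmod_triangle|].
    assert (t := Cmod_triangle (segment_integral f a b - segment_integral g a b)
      (segment_integral f b c - segment_integral g b c)).
    lra. }
  apply Cmod_eq_0, Rle_antisym; [|apply Cmod_ge_0].
  apply le_epsilon; intros e e0; rewrite Rplus_0_l.
  eapply Rle_trans; [apply (K (e / (9 * d * d + 1))%R)|].
  - apply Rdiv_lt_0_compat; nra.
  - assert (D : (0 < 9 * d * d + 1)%R) by nra.
    apply Rmult_le_reg_r with (1 := D).
    replace (9 * d * d * (e / (9 * d * d + 1)) * (9 * d * d + 1))%R with (9 * d * d * e)%R
      by (field; lra).
    nra.
Qed.

(** By Goursat's theorem the increment of the integral from 0 is the integral over
    the segment from [z] to [y]. *)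
Lemma disc_primitive (f f' : C -> C) (rho : R) :
  (forall z, (Cmod z < rho)%R -> Cderivable f z (f' z)) ->
  forall z, (Cmod z < rho)%R -> Cderivable (segment_integral f 0) z (f z).
Proof.
  intros H z Hz.
  assert (Hc : forall y, (Cmod y < rho)%R -> Ccontinuous f y)
    by (intros y Hy; eapply Cderivable_continuous, H, Hy).
  apply Cderivable_eps; intros e e0.
  assert (L := proj1 (Ccontinuous_eps _ _) (Hc z Hz) e e0).
  destruct (proj1 (locally_Cmod z _) L) as [d [d0 Hd]].
  exists (Rmin d (rho - Cmod z)); split; [apply Rmin_glb_lt; lra|].
  intros y Hy.
  assert (y1 : (Cmod (y - z) < d)%R) by (eapply Rlt_le_trans; [exact Hy | apply Rmin_l]).
  assert (y2 : (Cmod (y - z) < rho - Cmod z)%R) by (eapply Rlt_le_trans; [exact Hy | apply Rmin_r]).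
  assert (y3 : (Cmod y < rho)%R).
  { assert (t := Cmod_triangle (y - z) z); replace (y - z + z) with y in t by ring; lra. }
  set (r := Rmax (Cmod z) (Cmod y)).
  assert (rR : (r < rho)%R) by (apply Rmax_lub_lt; auto).
  assert (r0 : (Cmod 0 <= r)%R).
  { rewrite Cmod_0; eapply Rle_trans; [apply (Cmod_ge_0 z) | apply Rmax_l]. }
  assert (rz : (Cmod z <= r)%R) by apply Rmax_l.
  assert (ry : (Cmod y <= r)%R) by apply Rmax_r.
  assert (Hcr : forall u v, (Cmod u <= r)%R -> (Cmod v <= r)%R ->
    forall x, Cseg u v x -> Ccontinuous f x).
  { intros u v Hu Hv x Hx; apply Hc; assert (t := Cseg_disc u v x r Hu Hv Hx); lra. }
  assert (G := Goursat f f' r rho (RtoC 0, z, y) rR H (conj r0 (conj rz ry))).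
  cbv beta iota delta [triangle_integral] in G.
  rewrite (segment_integral_swap f 0 y) in G by eauto.
  replace (segment_integral f 0 y - segment_integral f 0 z) with (segment_integral f z y).
  2:{ replace (segment_integral f z y) with (segment_integral f z y +
       - (segment_integral f 0 z + segment_integral f z y + - segment_integral f 0 y))
       by (rewrite G; ring); ring. }
  replace (f z * (y - z)) with (segment_integral (fun _ => f z) z y).
  2:{ apply is_CInt_unique, is_CInt_const. }
  apply segment_integral_close; intros x Hx; split; [eauto | split; [apply Ccontinuous_const|]].
  apply Rlt_le, Hd.
  destruct Hx as [t [Ht ->]].
  replace (z + RtoC t * (y - z) - z) with (RtoC t * (y - z)) by ring.
  rewrite Cmod_mult, Cmod_R, Rabs_pos_eq by lra; assert (h := Cmod_ge_0 (y - z)); nra.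
Qed.

(** * Cauchy's formula for functions with a continuous derivative *)

(** The parameter runs over the unit interval, like that of all integrals here. *)
Definition circle (r t : R) : C := RtoC r * (cos (2 * PI * t), sin (2 * PI * t))%R.

Definition two_pi_i : C := RtoC (2 * PI) * Ci.

Lemma two_pi_i_neq0 : two_pi_i <> 0.
Proof.
  apply Cmult_neq_0; [|intros E; apply (f_equal snd) in E; cbn in E; lra].
  intros E; apply RtoC_inj in E; assert (h := PI_RGT_0); lra.
Qed.

Lemma Cmod_circle (r t : R) : (0 <= r)%R -> Cmod (circle r t) = r.
Proof.
  intros r0; unfold circle; rewrite Cmod_mult, Cmod_R, Rabs_pos_eq by auto.
  unfold Cmod; cbn [fst snd].
  replace (_ + _)%R with 1%R; [rewrite sqrt_1; ring|].
  assert (h := sin2_cos2 (2 * PI * t)); unfold Rsqr in h; cbn; lra.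
Qed.

Lemma circle_closed (r : R) : circle r 1 = circle r 0.
Proof.
  unfold circle; rewrite Rmult_1_r, Rmult_0_r, cos_2PI, sin_2PI, cos_0, sin_0; reflexivity.
Qed.

Lemma is_derive_circle (r t : R) :
  is_derive (V := C_R_NormedModule) (circle r) t (two_pi_i * circle r t).
Proof.
  assert (D1 : is_derive (fun s : R => r * cos (2 * PI * s))%R t
                 (- (2 * PI) * (r * sin (2 * PI * t)))%R)
    by (auto_derive; [auto | ring]).
  assert (D2 : is_derive (fun s : R => r * sin (2 * PI * s))%R t
                 (2 * PI * (r * cos (2 * PI * t)))%R)
    by (auto_derive; [auto | ring]).
  assert (K := is_derive_plus (V := C_R_NormedModule) _ _ t _ _
    (is_derive_scal_l (V := C_R_NormedModule) _ t _ (RtoC 1) D1)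
    (is_derive_scal_l (V := C_R_NormedModule) _ t _ Ci D2)).
  rewrite !scal_C_R in K.
  replace (two_pi_i * circle r t) with
    (@plus C_R_NormedModule (RtoC (- (2 * PI) * (r * sin (2 * PI * t))) * RtoC 1)
       (RtoC (2 * PI * (r * cos (2 * PI * t))) * Ci)).
  2:{ apply injective_projections; cbn; unfold plus; cbn; ring. }
  apply (is_derive_ext (V := C_R_NormedModule)) with (2 := K).
  intros s; rewrite !scal_C_R.
  apply injective_projections; cbn; unfold plus; cbn; ring.
Qed.

Lemma Ccontinuous_circle (r t : R) : Ccontinuous (circle r) t.
Proof.
  exact (ex_derive_continuous (K := R_AbsRing) (V := C_R_NormedModule) (circle r) t
    (ex_intro _ _ (is_derive_circle r t))).
Qed.

Lemma Ccontinuous_pow {T : UniformSpace} (f : T -> C) (n : nat) (x : T) :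
  Ccontinuous f x -> Ccontinuous (fun y => f y ^ n) x.
Proof.
  intros H; induction n as [|n IH]; [apply Ccontinuous_const|].
  apply (Ccontinuous_mult f (fun y => f y ^ n)); auto.
Qed.

Lemma Ccontinuous_fst_comp (f : R -> C) (p : RxC) :
  Ccontinuous f (fst p) -> continuous (T := RxC) (U := C_UniformSpace) (fun q => f (fst q)) p.
Proof.
  intros H; destruct p as [t z].
  apply (continuous_comp (U := RxC) (V := R_UniformSpace) (W := C_UniformSpace) fst f);
    [apply continuous_fst | exact H].
Qed.

Lemma Ccontinuous_snd (p : RxC) : continuous (T := RxC) (U := C_UniformSpace) (fun q => snd q) p.
Proof. destruct p; apply continuous_snd. Qed.

Lemma open_Ccontinuous_neq0 {T : UniformSpace} (f : T -> C) :
  (forall x, Ccontinuous f x) -> open (fun x => f x <> 0).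
Proof.
  intros H.
  assert (O : open (fun x => (0 < Cmod (f x))%R)).
  { apply (open_comp (fun x => Cmod (f x)) (fun y : R => (0 < y)%R)); [|apply open_gt].
    intros x _; exact (Ccontinuous_Cmod f x (H x)). }
  intros x Hx; generalize (O x (proj1 (Cmod_gt_0 _) Hx)); apply filter_imp.
  intros y Hy; apply Cmod_gt_0, Hy.
Qed.

Lemma open_Ccontinuous_disc {T : UniformSpace} (f : T -> C) (r : R) :
  (forall x, Ccontinuous f x) -> open (fun x => (Cmod (f x) < r)%R).
Proof.
  intros H; apply (open_comp (fun x => Cmod (f x)) (fun y : R => (y < r)%R)); [|apply open_lt].
  intros x _; exact (Ccontinuous_Cmod f x (H x)).
Qed.

(** Syntax-directed continuity: leaving the choice of the functions to unification
    makes the search diverge. *)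
Ltac cont :=
  lazymatch goal with
  | |- continuous (fun _ => ?c) _ => apply Ccontinuous_const
  | |- continuous (fun p => Cplus (@?f p) (@?g p)) _ => apply (Ccontinuous_plus f g); cont
  | |- continuous (fun p => Cminus (@?f p) (@?g p)) _ => apply (Ccontinuous_minus f g); cont
  | |- continuous (fun p => Cmult (@?f p) (@?g p)) _ => apply (Ccontinuous_mult f g); cont
  | |- continuous (fun p => Cpow (@?f p) _) _ => apply (Ccontinuous_pow f); cont
  | |- continuous (fun p => snd p) _ => apply Ccontinuous_snd
  | |- continuous (fun p => circle ?r (fst p)) _ =>
      apply (Ccontinuous_fst_comp (circle r)); apply Ccontinuous_circle
  | |- continuous (circle ?r) _ => apply Ccontinuous_circle
  | |- continuous (fun p => circle ?r p) _ => apply Ccontinuous_circle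
  | |- continuous (fun p => ?f (fst p)) _ => apply (Ccontinuous_fst_comp f); cont
  | |- continuous (fun p => p) _ => apply continuous_id
  | |- _ => try assumption
  end.

Lemma Cderivable_kernel (c w : C) (k : nat) :
  c - w <> 0 ->
  Cderivable (fun y => (/ (c - y)) ^ k) w (RtoC (INR k) * (/ (c - w)) ^ (S k)).
Proof.
  intros n.
  assert (D : Cderivable (fun y => / (c - y)) w (/ (c - w) * / (c - w))).
  { assert (K := Cderivable_comp _ _ _ _ _ (Cderivable_inv _ n)
      (Cderivable_minus _ _ _ _ _ (Cderivable_const c w) (Cderivable_id w))).
    replace (/ (c - w) * / (c - w)) with ((0 - 1) * - / ((c - w) * (c - w))); [exact K|].
    field; auto. }
  induction k as [|k IH].
  - replace (RtoC (INR 0) * _) with (RtoC 0) by (cbn [INR]; ring); exact (Cderivable_const (RtoC 1) w).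
  - assert (K := Cderivable_mult _ _ _ _ _ D IH).
    replace (RtoC (INR (S k)) * (/ (c - w)) ^ S (S k)) with
      (/ (c - w) * / (c - w) * (/ (c - w)) ^ k + / (c - w) * (RtoC (INR k) * (/ (c - w)) ^ S k));
      [exact K|].
    rewrite S_INR, RtoC_plus; cbn [Cpow]; ring.
Qed.

(** The factor [circle r t], which comes from parametrizing by the angle, is meant
    to be part of the density [phi]. *)
Definition Cauchy_integral (phi : R -> C) (r : R) (k : nat) (w : C) : C :=
  CInt (fun t => phi t * (/ (circle r t - w)) ^ k).

Lemma circle_neq (r t : R) (w : C) : (Cmod w < r)%R -> circle r t - w <> 0.
Proof.
  intros H E; assert (E' : circle r t = w) by (replace w with (w + (circle r t - w)) by (rewrite E; ring); ring).
  assert (r0 : (0 <= r)%R) by (assert (h := Cmod_ge_0 w); lra).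
  rewrite <- E', Cmod_circle in H; lra.
Qed.

Lemma open_circle_neq (r : R) (f : C -> C) : (forall z, Ccontinuous f z) ->
  open (fun p : RxC => circle r (fst p) - f (snd p) <> 0).
Proof.
  intros H; apply open_Ccontinuous_neq0; intros p; apply Ccontinuous_minus; [cont|].
  apply Ccontinuous_comp; [apply Ccontinuous_snd | apply H].
Qed.

Lemma is_CInt_Cauchy_integral (phi : R -> C) (r : R) (k : nat) (w : C) :
  (forall t, Ccontinuous phi t) -> (Cmod w < r)%R ->
  is_CInt (fun t => phi t * (/ (circle r t - w)) ^ k) (Cauchy_integral phi r k w).
Proof.
  intros Hphi Hw; unfold Cauchy_integral; apply is_CInt_CInt; intros t _; cont; [apply Hphi|].
  apply Ccontinuous_inv; [now apply circle_neq | cont].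
Qed.

Lemma Cderivable_Cauchy_integral (phi : R -> C) (r : R) (k : nat) (w : C) :
  (forall t, Ccontinuous phi t) -> (Cmod w < r)%R ->
  Cderivable (Cauchy_integral phi r k) w (RtoC (INR k) * Cauchy_integral phi r (S k) w).
Proof.
  intros Hphi Hw.
  assert (K : Cderivable (Cauchy_integral phi r k) w
    (CInt (fun t => phi t * (RtoC (INR k) * (/ (circle r t - w)) ^ S k)))).
  { apply (Cderivable_CInt (fun t y => phi t * (/ (circle r t - y)) ^ k)
      (fun t y => phi t * (RtoC (INR k) * (/ (circle r t - y)) ^ S k))
      (fun p => circle r (fst p) - snd p <> 0)).
    - apply (open_circle_neq r (fun z => z)); intros z; apply continuous_id.
    - intros t _; now apply circle_neq.
    - intros t z n; cbn [fst snd] in n.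
      assert (ci : continuous (T := RxC) (U := C_UniformSpace)
        (fun p => / (circle r (fst p) - snd p)) (t, z)).
      { apply Ccontinuous_inv; [exact n | cont]. }
      split; [|split].
      + assert (K := Cderivable_mult _ _ _ _ _ (Cderivable_const (phi t) z)
          (Cderivable_kernel (circle r t) z k n)).
        replace (phi t * (RtoC (INR k) * (/ (circle r t - z)) ^ S k)) with
          (0 * (/ (circle r t - z)) ^ k + phi t * (RtoC (INR k) * (/ (circle r t - z)) ^ S k))
          by ring; exact K.
      + cont; apply Hphi.
      + cont; try apply Hphi. }
  replace (RtoC (INR k) * Cauchy_integral phi r (S k) w) with
    (CInt (fun t => phi t * (RtoC (INR k) * (/ (circle r t - w)) ^ S k))); [exact K|].
  apply is_CInt_unique.
  assert (I : is_CInt (fun t => phi t * (/ (circle r t - w)) ^ S k) (Cauchy_integral phi r (S k) w)).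
  { apply is_CInt_Cauchy_integral; assumption. }
  apply is_CInt_ext with (2 := is_CInt_scal (RtoC (INR k)) _ _ I); intros t _; ring.
Qed.

Lemma is_CInt_loop (f f' : C -> C) (c d : C) (r : R) :
  (forall t, (0 <= t <= 1)%R -> Cderivable f (c + d * circle r t) (f' (c + d * circle r t)) /\
     Ccontinuous f' (c + d * circle r t)) ->
  is_CInt (fun t => f' (c + d * circle r t) * (d * (two_pi_i * circle r t))) 0.
Proof.
  intros H.
  assert (D : forall z, Cderivable (fun y => c + d * y) z d).
  { intros z; assert (K := Cderivable_plus _ _ _ _ _ (Cderivable_const c z)
      (Cderivable_mult _ _ _ _ _ (Cderivable_const d z) (Cderivable_id z))).
    cbn beta in K; replace (0 + (0 * z + d * 1)) with d in K by ring; exact K. }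
  replace (RtoC 0) with (f (c + d * circle r 1) - f (c + d * circle r 0))
    by (rewrite circle_closed; ring).
  apply (is_CInt_derive (fun t => f (c + d * circle r t))).
  - intros t Ht; apply (is_derive_C_along f (fun t => c + d * circle r t)); [apply H, Ht|].
    exact (is_derive_C_along (fun y => c + d * y) (circle r) t _ _ (D _) (is_derive_circle r t)).
  - intros t Ht; cont.
    apply (Ccontinuous_comp f'); [cont | apply H, Ht].
Qed.

Lemma Cderivable_zero_const (f : C -> C) :
  (forall t : R, (0 <= t <= 1)%R -> Cderivable f (RtoC t) 0) -> f 1 = f 0.
Proof.
  intros H.
  assert (I : is_CInt (fun t : R => RtoC 0 * (1 - 0)) (f 1 - f 0)).
  { apply (is_CInt_segment f (fun _ => RtoC 0) 0 1); intros t Ht; split; [|apply Ccontinuous_const].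
    replace (0 + RtoC t * (1 - 0)) with (RtoC t) by ring; auto. }
  assert (J := is_CInt_const 0).
  apply is_CInt_unique in I; apply is_CInt_unique in J.
  replace (f 1) with (f 0 + (f 1 - f 0)) by ring; rewrite <- I.
  rewrite (CInt_ext _ (fun _ => RtoC 0)), J by (intros; ring); ring.
Qed.

(** Moving the point [w] to the centre along [s * w] does not change the integral:
    its derivative in [s] is the integral of a derivative along the circle.  At
    the centre the integrand is 1. *)
Lemma circle_index (r : R) (w : C) :
  (Cmod w < r)%R -> is_CInt (fun t => circle r t * / (circle r t - w)) 1.
Proof.
  intros Hw.
  assert (r0 : (0 < r)%R) by (assert (h := Cmod_ge_0 w); lra).
  assert (Hs : forall (s : R), (0 <= s <= 1)%R -> (Cmod (RtoC s * w) < r)%R).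
  { intros s Hs; rewrite Cmod_mult, Cmod_R, Rabs_pos_eq by lra.
    assert (h := Cmod_ge_0 w); nra. }
  pose (Phi := fun s : C => CInt (fun t => circle r t * / (circle r t - s * w))).
  assert (Cid : forall z : C, Ccontinuous (fun y => y) z) by (intros; apply continuous_id).
  assert (D : forall s : R, (0 <= s <= 1)%R -> Cderivable Phi (RtoC s) 0).
  { intros s Hs'.
    replace (RtoC 0) with (CInt (fun t => circle r t *
      (w * (/ (circle r t - RtoC s * w)) ^ 2))).
    - apply (Cderivable_CInt (fun t y => circle r t * / (circle r t - y * w))
        (fun t y => circle r t * (w * (/ (circle r t - y * w)) ^ 2))
        (fun p => circle r (fst p) - snd p * w <> 0)).
      + apply (open_circle_neq r (fun z => z * w)); intros z; cont; apply Cid.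
      + intros t _; apply circle_neq; cbn [snd]; auto.
      + intros t z n; cbn [fst snd] in n.
        assert (ci : continuous (T := RxC) (U := C_UniformSpace)
          (fun p => / (circle r (fst p) - snd p * w)) (t, z)).
        { apply Ccontinuous_inv; [exact n | cont]. }
        split; [|split]; [|cont|cont].
        assert (Dw : Cderivable (fun y => y * w) z (1 * w + z * 0)).
        { apply Cderivable_mult; [apply Cderivable_id | apply Cderivable_const]. }
        assert (K := Cderivable_mult _ _ _ _ _ (Cderivable_const (circle r t) z)
          (Cderivable_comp _ (fun y => y * w) _ _ _ (Cderivable_kernel (circle r t) (z * w) 1 n) Dw)).
        cbn beta in K.
        replace (circle r t * (w * (/ (circle r t - z * w)) ^ 2)) with
          (0 * (/ (circle r t - z * w)) ^ 1 +
            circle r t * ((1 * w + z * 0) * (RtoC (INR 1) * (/ (circle r t - z * w)) ^ 2)))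
          by (cbn [INR]; ring).
        apply Cderivable_ext with (2 := K); intros y; cbn [Cpow]; ring.
    - assert (L := is_CInt_loop (fun y => (/ (RtoC s * w - y)) ^ 1)
         (fun y => RtoC (INR 1) * (/ (RtoC s * w - y)) ^ 2) 0 1 r).
      cbn beta in L.
      apply is_CInt_unique.
      replace (RtoC 0) with (w / two_pi_i * 0) by ring.
      refine (is_CInt_ext _ _ _ _ (is_CInt_scal (w / two_pi_i) _ _ (L _))).
      + intros t Ht; replace (0 + 1 * circle r t) with (circle r t) by ring.
        assert (n := circle_neq r t _ (Hs s Hs')).
        assert (n' : RtoC s * w - circle r t <> 0).
        { intros E; apply n; replace (circle r t - RtoC s * w) with (- (RtoC s * w - circle r t))
            by ring; rewrite E; ring. }
        assert (n2 := two_pi_i_neq0).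
        cbn [INR Cpow]; field; auto.
      + intros t Ht; replace (0 + 1 * circle r t) with (circle r t) by ring.
        assert (n := circle_neq r t _ (Hs s Hs')).
        assert (n' : RtoC s * w - circle r t <> 0).
        { intros E; apply n; replace (circle r t - RtoC s * w) with (- (RtoC s * w - circle r t))
            by ring; rewrite E; ring. }
        split; [apply Cderivable_kernel, n'|].
        cont; apply (Ccontinuous_inv (fun y => RtoC s * w - y)); [exact n' | cont]. }
  apply Cderivable_zero_const in D.
  assert (P0 : Phi 0 = RtoC 1).
  { unfold Phi; rewrite (CInt_ext _ (fun _ => RtoC 1)); [apply is_CInt_unique, is_CInt_const|].
    intros t _; assert (n := circle_neq r t 0).
    replace (circle r t - 0 * w) with (circle r t - 0) by ring.
    specialize (n ltac:(rewrite Cmod_0; lra)).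
    replace (circle r t - 0) with (circle r t) in * by ring; field; auto. }
  rewrite <- P0, <- D; unfold Phi.
  rewrite (CInt_ext _ (fun t => circle r t * / (circle r t - w)))
    by (intros; f_equal; f_equal; ring).
  apply is_CInt_CInt; intros t _; cont; apply Ccontinuous_inv; [now apply circle_neq | cont].
Qed.

(** Shrink the circle to [w] by the homotopy [w + s * (circle r t - w)].  The
    derivative in [s] of the integral is, up to a factor, the integral of the
    derivative of [F] along a closed curve, so the value at [s = 1] is the value at
    [s = 0], which is [F w] by [circle_index].  Continuity of [f] is what allows
    differentiating under the integral sign. *)
Lemma Cauchy_formula_C1 (F f : C -> C) (r rho : R) (w : C) :
  (r < rho)%R ->
  (forall z, (Cmod z < rho)%R -> Cderivable F z (f z) /\ Ccontinuous f z) ->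
  (Cmod w < r)%R ->
  is_CInt (fun t => F (circle r t) * circle r t * / (circle r t - w)) (F w).
Proof.
  intros rR H Hw.
  assert (r0 : (0 < r)%R) by (assert (h := Cmod_ge_0 w); lra).
  assert (n2 := two_pi_i_neq0).
  assert (Hs : forall (s t : R), (0 <= s <= 1)%R -> (Cmod (w + RtoC s * (circle r t - w)) < rho)%R).
  { intros s t Hs; eapply Rle_lt_trans with (2 := rR); apply (Cseg_disc w (circle r t)).
    - lra. - rewrite Cmod_circle; lra. - exists s; auto. }
  pose (Phi := fun s : C => CInt (fun t => F (w + s * (circle r t - w)) *
     (circle r t * / (circle r t - w)))).
  assert (D : forall s : R, (0 <= s <= 1)%R -> Cderivable Phi (RtoC s) 0).
  { intros s Hs'.
    replace (RtoC 0) with (CInt (fun t => f (w + RtoC s * (circle r t - w)) * circle r t)).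
    - apply (Cderivable_CInt
        (fun t y => F (w + y * (circle r t - w)) * (circle r t * / (circle r t - w)))
        (fun t y => f (w + y * (circle r t - w)) * circle r t)
        (fun p => (Cmod (w + snd p * (circle r (fst p) - w)) < rho)%R)).
      + apply (open_Ccontinuous_disc (T := RxC)); intros p; cont.
      + intros t _; apply Hs; auto.
      + intros t z n; cbn [fst snd] in n.
        destruct (H _ n) as [DF Cf].
        split; [|split].
        * assert (Dw : Cderivable (fun y => w + y * (circle r t - w)) z
             (0 + (1 * (circle r t - w) + z * 0))).
          { apply (Cderivable_plus _ _ z _ _ (Cderivable_const w z)).
            exact (Cderivable_mult _ _ z _ _ (Cderivable_id z)
              (Cderivable_const (circle r t - w) z)). }
          assert (K := Cderivable_mult _ _ _ _ _
            (Cderivable_comp F (fun y => w + y * (circle r t - w)) _ _ _ DF Dw)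
            (Cderivable_const (circle r t * / (circle r t - w)) z)).
          cbn beta in K.
          set (a := f (w + z * (circle r t - w))) in *.
          set (b := F (w + z * (circle r t - w))) in *.
          replace (a * circle r t) with
            ((0 + (1 * (circle r t - w) + z * 0)) * a * (circle r t * / (circle r t - w)) + b * 0);
            [exact K|].
          field; now apply circle_neq.
        * apply Ccontinuous_mult.
          -- apply (Ccontinuous_comp F (fun p : RxC => w + snd p * (circle r (fst p) - w))); [cont|].
             eapply Cderivable_continuous, DF.
          -- apply (Ccontinuous_fst_comp (fun t => circle r t * / (circle r t - w))).
             cont; apply Ccontinuous_inv; [now apply circle_neq | cont].
        * apply Ccontinuous_mult; [|cont].
          apply (Ccontinuous_comp f (fun p : RxC => w + snd p * (circle r (fst p) - w))); [cont|].
          exact Cf.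
    - apply is_CInt_unique.
      (* For s <> 0 the integrand is the derivative of F along a circle of radius s r,
         up to the factor 2 pi i s; for s = 0 it is a multiple of circle r. *)
      destruct (Req_dec s 0) as [->|s0].
      + assert (L := is_CInt_loop (fun y => y) (fun _ => RtoC 1) 0 1 r).
        assert (Z : is_CInt (fun t => f (w + RtoC 0 * (circle r t - w)) * circle r t)
          (f w / two_pi_i * 0));
          [|replace (f w / two_pi_i * 0) with (RtoC 0) in Z by ring; exact Z].
        refine (is_CInt_ext _ _ _ _ (is_CInt_scal (f w / two_pi_i) _ _ (L _))).
        * intros t _; replace (w + RtoC 0 * (circle r t - w)) with w by ring; cbn beta; field; auto.
        * intros t _; split; [apply Cderivable_id | apply Ccontinuous_const].
      + assert (s0' : RtoC s <> 0) by (intros E; apply RtoC_inj in E; auto).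
        assert (L := is_CInt_loop F f (w - RtoC s * w) (RtoC s) r).
        replace (RtoC 0) with (/ RtoC s / two_pi_i * 0) by (unfold Cdiv; ring).
        refine (is_CInt_ext _ _ _ _ (is_CInt_scal (/ RtoC s / two_pi_i) _ _ (L _))).
        * intros t _.
          replace (w - RtoC s * w + RtoC s * circle r t) with (w + RtoC s * (circle r t - w)) by ring.
          field; auto.
        * intros t _.
          replace (w - RtoC s * w + RtoC s * circle r t) with (w + RtoC s * (circle r t - w)) by ring.
          apply H, Hs; auto. }
  apply Cderivable_zero_const in D.
  assert (P0 : Phi 0 = F w).
  { unfold Phi; replace (F w) with (F w * 1) by ring.
    apply is_CInt_unique.
    apply is_CInt_ext with (2 := is_CInt_scal (F w) _ _ (circle_index r w Hw)).
    intros t _; replace (w + 0 * (circle r t - w)) with w by ring; reflexivity. }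
  rewrite <- P0, <- D; unfold Phi.
  assert (E : forall t : R, F (w + 1 * (circle r t - w)) * (circle r t * / (circle r t - w)) =
     F (circle r t) * circle r t * / (circle r t - w)).
  { intros t; replace (w + 1 * (circle r t - w)) with (circle r t) by ring; ring. }
  rewrite (CInt_ext _ (fun t => F (circle r t) * circle r t * / (circle r t - w)))
    by (intros; apply E).
  apply is_CInt_CInt; intros t _; cont.
  - apply (Ccontinuous_comp F); [cont|].
    eapply Cderivable_continuous, H; rewrite Cmod_circle; lra.
  - apply Ccontinuous_inv; [now apply circle_neq | cont].
Qed.

(** * Cauchy's formula for holomorphic functions and its consequences *)

Notation Cdiff f z := (ex_derive (K := C_AbsRing) (V := C_NormedModule) f (z : C)).

Lemma Cdiff_derivable (f : C -> C) (z : C) : Cdiff f z -> Cderivable f z (C_derive f z).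
Proof. exact (C_derive_correct f z z). Qed.

Lemma Cdiff_continuous (f : C -> C) (z : C) : Cdiff f z -> Ccontinuous f z.
Proof. intros [l H]; exact (Cderivable_continuous f z l H). Qed.

Lemma locally_disc (c z : C) (r : R) (P : C -> Prop) :
  (Cmod (z - c) < r)%R -> (forall y : C, (Cmod (y - c) < r)%R -> P y) ->
  locally (T := C_UniformSpace) z P.
Proof.
  intros Hz HP.
  assert (O : open (fun y : C => (Cmod (y - c) < r)%R)).
  { apply (open_Ccontinuous_disc (T := C_UniformSpace) (fun y => y - c)); intros x; cont. }
  generalize (O z Hz); apply filter_imp; exact HP.
Qed.

Lemma Cderivable_translate (f : C -> C) (c z l : C) :
  Cderivable f (c + z) l -> Cderivable (fun y => f (c + y)) z l.
Proof.
  intros H.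
  assert (D := Cderivable_plus _ _ z _ _ (Cderivable_const c z) (Cderivable_id z)).
  assert (K := Cderivable_comp f (fun y => c + y) z _ _ H D).
  replace ((0 + 1) * l) with l in K by ring; exact K.
Qed.

Lemma Cderivable_translate_minus (f : C -> C) (c z l : C) :
  Cderivable f (z - c) l -> Cderivable (fun y => f (y - c)) z l.
Proof.
  intros H; apply (Cderivable_ext (fun y => f (- c + y))); [intros; f_equal; ring|].
  apply Cderivable_translate; replace (- c + z) with (z - c) by ring; exact H.
Qed.

(** A primitive [F] of [f] has a continuous derivative, so Cauchy's formula holds
    for [F]; differentiating it twice shows that [f'] is a Cauchy integral, hence
    continuous, and the formula applies to [f] itself. *)
Lemma Cauchy_formula0 (f : C -> C) (r rho : R) (w : C) :
  (r < rho)%R -> (forall z, (Cmod z < rho)%R -> Cdiff f z) -> (Cmod w < r)%R ->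
  is_CInt (fun t => f (circle r t) * circle r t * / (circle r t - w)) (f w).
Proof.
  intros rR H Hw.
  assert (Hd : forall z, (Cmod z < rho)%R -> Cderivable f z (C_derive f z))
    by (intros; apply Cdiff_derivable; auto).
  assert (Hc : forall z, (Cmod z < rho)%R -> Ccontinuous f z)
    by (intros; apply Cdiff_continuous; auto).
  set (F := segment_integral f 0).
  assert (HF : forall z, (Cmod z < rho)%R -> Cderivable F z (f z))
    by (intros z Hz; exact (disc_primitive f (C_derive f) rho Hd z Hz)).
  apply (Cauchy_formula_C1 f (C_derive f) r rho w rR); [|exact Hw].
  intros z Hz; split; [auto|].
  assert (r1 : exists q, (Cmod z < q < rho)%R) by (exists ((Cmod z + rho) / 2)%R; lra).
  destruct r1 as [q [q1 q2]].
  assert (q0 : (0 < q)%R) by (assert (h := Cmod_ge_0 z); lra).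
  pose (phi := fun t => F (circle q t) * circle q t).
  assert (Hphi : forall t, Ccontinuous phi t).
  { intros t; unfold phi; cont; apply (Ccontinuous_comp F); [cont|].
    eapply Cderivable_continuous, HF; rewrite Cmod_circle; lra. }
  assert (near : forall (P : C -> Prop) y, (Cmod y < q)%R ->
    (forall x, (Cmod x < q)%R -> P x) -> locally (T := C_UniformSpace) y P).
  { intros P y Hy HP; apply (locally_disc 0 y q).
    - replace (y - 0) with y by ring; exact Hy.
    - intros x Hx; apply HP; replace (x - 0) with x in Hx by ring; exact Hx. }
  assert (EF : forall y, (Cmod y < q)%R -> Cauchy_integral phi q 1 y = F y).
  { intros y Hy; apply is_CInt_unique.
    refine (is_CInt_ext _ _ _ _ (Cauchy_formula_C1 F f q rho y q2
      (fun z Hz => conj (HF z Hz) (Hc z Hz)) Hy)).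
    intros t _; unfold phi; cbn [Cpow]; ring. }
  assert (Ef : forall y, (Cmod y < q)%R -> RtoC (INR 1) * Cauchy_integral phi q 2 y = f y).
  { intros y Hy.
    assert (D := Cderivable_Cauchy_integral phi q 1 y Hphi Hy).
    apply (Cderivable_ext_loc _ F _ _ (near _ y Hy EF)) in D.
    apply is_C_derive_unique in D; rewrite <- D.
    apply is_C_derive_unique, HF; lra. }
  assert (Ef' : forall y, (Cmod y < q)%R ->
     RtoC (INR 1) * (RtoC (INR 2) * Cauchy_integral phi q 3 y) = C_derive f y).
  { intros y Hy.
    assert (D := Cderivable_mult _ _ _ _ _ (Cderivable_const (RtoC (INR 1)) y)
       (Cderivable_Cauchy_integral phi q 2 y Hphi Hy)).
    apply (Cderivable_ext_loc _ f _ _ (near _ y Hy Ef)) in D.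
    apply is_C_derive_unique in D; rewrite D; ring. }
  apply (continuous_ext_loc (U := C_UniformSpace)) with (1 := near _ z q1 Ef').
  cont; eapply Cderivable_continuous, Cderivable_Cauchy_integral; auto.
Qed.

Definition circle_values (f : C -> C) (c : C) (r : R) : R -> C :=
  fun t => f (c + circle r t) * circle r t.

Section disc.
Context (f : C -> C) (c : C) (r rho : R).
Hypothesis (r0 : (0 < r)%R) (rR : (r < rho)%R).
Hypothesis H : forall z, (Cmod (z - c) < rho)%R -> Cdiff f z.

Lemma Ccontinuous_circle_values t : Ccontinuous (circle_values f c r) t.
Proof.
  apply Ccontinuous_mult; [|cont].
  apply (Ccontinuous_comp f); [cont|].
  apply Cdiff_continuous, H; replace (c + circle r t - c) with (circle r t) by ring.
  rewrite Cmod_circle; lra.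
Qed.

Lemma Cauchy_formula w :
  (Cmod w < r)%R -> f (c + w) = Cauchy_integral (circle_values f c r) r 1 w.
Proof.
  intros Hw; symmetry; apply is_CInt_unique.
  refine (is_CInt_ext _ _ _ _ (Cauchy_formula0 (fun z => f (c + z)) r rho w rR _ Hw)).
  - intros t _; unfold circle_values; cbn [Cpow]; ring.
  - intros z Hz; destruct (H (c + z)) as [l Hl].
    + replace (c + z - c) with z by ring; exact Hz.
    + exists l; apply Cderivable_translate, Hl.
Qed.

Lemma locally_center w (P : C -> Prop) :
  (Cmod w < r)%R -> (forall y, (Cmod y < r)%R -> P (c + y)) ->
  locally (T := C_UniformSpace) (c + w) P.
Proof.
  intros Hw HP.
  apply (locally_disc c (c + w) r).
  { replace (c + w - c) with w by ring; exact Hw. }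
  intros y Hy; replace y with (c + (y - c)) by ring; auto.
Qed.

Lemma Cderivable_Cauchy_center k w :
  (Cmod w < r)%R ->
  Cderivable (fun y => RtoC (INR (fact k)) * Cauchy_integral (circle_values f c r) r (S k) (y - c))
    (c + w) (RtoC (INR (fact (S k))) * Cauchy_integral (circle_values f c r) r (S (S k)) w).
Proof.
  intros Hw.
  apply (Cderivable_translate_minus (fun y => RtoC (INR (fact k)) *
      Cauchy_integral (circle_values f c r) r (S k) y)).
  replace (c + w - c) with w by ring.
  assert (D := Cderivable_mult _ _ _ _ _
      (Cderivable_const (RtoC (INR (fact k))) w)
      (Cderivable_Cauchy_integral (circle_values f c r) r (S k) w Ccontinuous_circle_values Hw)).
  cbn beta in D.
  replace (RtoC (INR (fact (S k))) * Cauchy_integral (circle_values f c r) r (S (S k)) w) with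
    (0 * Cauchy_integral (circle_values f c r) r (S k) w + RtoC (INR (fact k)) *
      (RtoC (INR (S k)) * Cauchy_integral (circle_values f c r) r (S (S k)) w)); [exact D|].
  rewrite fact_simpl, mult_INR, RtoC_mult; ring.
Qed.

Lemma Cderive_n_Cauchy k w :
  (Cmod w < r)%R ->
  Cderive_n f k (c + w) = RtoC (INR (fact k)) * Cauchy_integral (circle_values f c r) r (S k) w.
Proof.
  revert w; induction k as [|k IH]; intros w Hw.
  - cbn [fact INR]; rewrite <- (Cauchy_formula w Hw); cbn; ring.
  - apply is_C_derive_unique.
    refine (Cderivable_ext_loc _ (Cderive_n f k) _ _ _ (Cderivable_Cauchy_center k w Hw)).
    apply locally_center; [exact Hw|]; intros y Hy; rewrite (IH y Hy).
    f_equal; f_equal; ring.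
Qed.

Lemma Cdiff_Cderive_n k w : (Cmod w < r)%R -> Cdiff (Cderive_n f k) (c + w).
Proof.
  intros Hw; eexists.
  refine (Cderivable_ext_loc _ (Cderive_n f k) _ _ _ (Cderivable_Cauchy_center k w Hw)).
  apply locally_center; [exact Hw|]; intros y Hy; rewrite (Cderive_n_Cauchy k y Hy).
  f_equal; f_equal; ring.
Qed.

Lemma Cauchy_estimate k M :
  (forall t : R, (0 <= t <= 1)%R -> (Cmod (f (c + circle r t)%C) <= M)%R) ->
  (Cmod (Cderive_n f k c) <= INR (fact k) * (M / r ^ k))%R.
Proof.
  intros HM.
  assert (c0 : (Cmod 0 < r)%R) by (rewrite Cmod_0; lra).
  assert (E := Cderive_n_Cauchy k 0 c0); replace (c + 0) with c in E by ring.
  rewrite E, Cmod_mult, Cmod_R, Rabs_pos_eq by apply pos_INR.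
  apply Rmult_le_compat_l; [apply pos_INR|].
  refine (is_CInt_le _ _ _ _ (is_CInt_Cauchy_integral _ r (S k) 0 Ccontinuous_circle_values c0)).
  intros t Ht; unfold circle_values.
  assert (n := circle_neq r t 0 c0).
  rewrite !Cmod_mult, Cmod_pow, Cmod_inv by exact n.
  replace (circle r t - 0) with (circle r t) by ring; rewrite Cmod_circle by lra.
  specialize (HM t Ht).
  assert (p : (0 < r ^ k)%R) by (apply pow_lt; exact r0).
  rewrite pow_inv; cbn [pow].
  replace (Cmod (f (c + circle r t)) * r * / (r * r ^ k))%R
    with (Cmod (f (c + circle r t)) / r ^ k)%R by (field; lra).
  apply Rmult_le_compat_r; [apply Rlt_le, Rinv_0_lt_compat, p | exact HM].
Qed.

End disc.

Lemma Cbounded_01 (F : R -> C) :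
  (forall t, (0 <= t <= 1)%R -> Ccontinuous F t) ->
  exists M, (0 <= M)%R /\ forall t, (0 <= t <= 1)%R -> (Cmod (F t) <= M)%R.
Proof.
  intros H.
  destruct (continuity_ab_maj (fun t => Cmod (F t)) 0 1 ltac:(lra)) as [m [Hm _]].
  - intros t Ht; apply continuity_pt_filterlim; exact (Ccontinuous_Cmod F t (H t Ht)).
  - exists (Cmod (F m)); split; [apply Cmod_ge_0 | exact Hm].
Qed.

(** Two limits are shown to be equal by bounding their difference at each rank of
    the approximation. *)
Lemma Cgeometric_zero (z : C) (q M : R) :
  (0 <= q < 1)%R -> (forall k, (Cmod z <= q ^ k * M)%R) -> z = 0.
Proof.
  intros Hq H; apply Cmod_eq_0, Rle_antisym; [|apply Cmod_ge_0].
  apply le_epsilon; intros e e0; rewrite Rplus_0_l.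
  assert (M1 : (0 < Rabs M + 1)%R) by (assert (h := Rabs_pos M); lra).
  destruct (pow_lt_1_zero q ltac:(rewrite Rabs_pos_eq; lra) (e / (Rabs M + 1)))
    as [N HN]; [apply Rdiv_lt_0_compat; assumption|].
  specialize (HN N (Nat.le_refl N)); specialize (H N).
  assert (p : (0 <= q ^ N)%R) by (apply pow_le; lra).
  rewrite Rabs_pos_eq in HN by exact p.
  apply Rmult_lt_compat_r with (r := (Rabs M + 1)%R) in HN; [|exact M1].
  replace (e / (Rabs M + 1) * (Rabs M + 1))%R with e in HN by (field; lra).
  assert (h := RRle_abs M); nra.
Qed.

(** Expanding the kernel in a finite geometric series, the Taylor coefficients
    drop out and only the remainder, of size [(|w| / r)^k], is left. *)
Lemma disc_identity (f : C -> C) (c : C) (rho : R) :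
  (forall z, (Cmod (z - c) < rho)%R -> Cdiff f z) ->
  (forall k, Cderive_n f k c = 0) ->
  forall z, (Cmod (z - c) < rho)%R -> f z = 0.
Proof.
  intros H H0 z Hz.
  set (w := z - c) in *; set (r := ((Cmod w + rho) / 2)%R).
  assert (w0 := Cmod_ge_0 w).
  assert (wr : (Cmod w < r)%R) by (unfold r; lra).
  assert (rR : (r < rho)%R) by (unfold r; lra).
  assert (r0 : (0 < r)%R) by lra.
  assert (c0 : (Cmod 0 < r)%R) by (rewrite Cmod_0; lra).
  set (phi := circle_values f c r).
  assert (Hphi : forall t, Ccontinuous phi t)
    by (intros t; apply (Ccontinuous_circle_values f c r rho r0 rR H)).
  assert (Z : forall k, Cauchy_integral phi r (S k) 0 = 0).
  { intros k; assert (E := Cderive_n_Cauchy f c r rho r0 rR H k 0 c0).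
    replace (c + 0) with c in E by ring; rewrite H0 in E; fold phi in E.
    assert (n : RtoC (INR (fact k)) <> 0).
    { intros F; apply RtoC_inj in F; apply (INR_fact_neq_0 k F). }
    replace (Cauchy_integral phi r (S k) 0)
      with (/ RtoC (INR (fact k)) * (RtoC (INR (fact k)) * Cauchy_integral phi r (S k) 0))
      by (field; auto).
    rewrite <- E; ring. }
  assert (n0 : forall t, circle r t <> 0).
  { intros t E; apply (circle_neq r t 0 c0); rewrite E; ring. }
  (* f z = w^k * (integral of J k) is the remainder of order k of the expansion. *)
  pose (J := fun k t => phi t * (/ circle r t) ^ k * / (circle r t - w)).
  assert (cJ : forall k t, Ccontinuous (J k) t).
  { intros k t; unfold J; apply Ccontinuous_mult; [apply Ccontinuous_mult; [apply Hphi|]|].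
    - apply Ccontinuous_pow, Ccontinuous_inv; [apply n0 | cont].
    - apply Ccontinuous_inv; [apply circle_neq; exact wr | cont]. }
  assert (HJ : forall k, is_CInt (J k) (CInt (J k))).
  { intros k; apply is_CInt_CInt; intros t _; apply cJ. }
  assert (S : forall k, f z = w ^ k * CInt (J k)).
  { induction k as [|k IH].
    - replace z with (c + w) by (unfold w; ring).
      rewrite (Cauchy_formula f c r rho rR H w wr); fold phi.
      cbn [Cpow]; rewrite Cmult_1_l; apply CInt_ext; intros t _; unfold J; cbn [Cpow]; ring.
    - rewrite IH; cbn [Cpow].
      replace (w * w ^ k * CInt (J (S k))) with (w ^ k * (w * CInt (J (S k)))) by ring.
      f_equal; rewrite <- (Cplus_0_l (w * _)), <- (Z k); apply is_CInt_unique.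
      refine (is_CInt_ext _ _ _ _ (is_CInt_plus _ _ _ _
        (is_CInt_Cauchy_integral phi r (S k) 0 Hphi c0) (is_CInt_scal w _ _ (HJ (S k))))).
      intros t _; unfold J; replace (circle r t - 0) with (circle r t) by ring.
      cbn [Cpow]; field; split; [apply circle_neq; exact wr | apply n0]. }
  destruct (Cbounded_01 (J O)) as [M [M0 HM]]; [intros t _; apply cJ|].
  apply (Cgeometric_zero _ (Cmod w / r) M).
  { split; [apply Rdiv_le_0_compat; lra|].
    apply Rmult_lt_reg_r with r; [lra|]; unfold Rdiv; rewrite Rmult_assoc, Rinv_l; lra. }
  intros k; rewrite (S k), Cmod_mult, Cmod_pow.
  unfold Rdiv; rewrite Rpow_mult_distr, Rmult_assoc.
  apply Rmult_le_compat_l; [apply pow_le; lra|].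
  refine (is_CInt_le _ _ _ _ (HJ k)); intros t Ht.
  replace (J k t) with ((/ circle r t) ^ k * J O t) by (unfold J; cbn [Cpow]; ring).
  rewrite Cmod_mult, Cmod_pow, Cmod_inv, Cmod_circle by (auto; lra).
  apply Rmult_le_compat_l; [apply pow_le, Rlt_le, Rinv_0_lt_compat; lra | auto].
Qed.

(** The limit is continuous and inherits Cauchy's formula, whose right-hand side is
    holomorphic in the point of evaluation. *)
Lemma Weierstrass (fn : nat -> C -> C) (f : C -> C) (c : C) (rho K : R) :
  (0 < rho)%R ->
  (forall n z, (Cmod (z - c) < rho)%R -> Cdiff (fn n) z) ->
  (forall n z, (Cmod (z - c) < rho)%R -> (Cmod (fn n z - f z) <= K / 2 ^ n)%R) ->
  Cdiff f c.
Proof.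
  intros R0 Hd Hn.
  assert (K0 : (0 <= K)%R).
  { assert (h := Hn O c); replace (c - c) with (RtoC 0) in h by ring.
    rewrite Cmod_0 in h; specialize (h R0); assert (h' := Cmod_ge_0 (fn O c - f c)).
    cbn in h; lra. }
  assert (p2 : forall n, (0 < 2 ^ n)%R) by (intros; apply pow_lt; lra).
  assert (Hc : forall z, (Cmod (z - c) < rho)%R -> Ccontinuous f z).
  { intros z Hz; apply Ccontinuous_eps; intros e e0.
    destruct (geometric_small (2 * K) e ltac:(lra) e0) as [N HN].
    specialize (HN N (Nat.le_refl N)).
    assert (e3 : (0 < e - 2 * (K / 2 ^ N))%R) by (unfold Rdiv in *; lra).
    assert (C1 := proj1 (Ccontinuous_eps _ _) (Cdiff_continuous _ _ (Hd N z Hz)) _ e3).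
    assert (C2 := locally_disc c z rho _ Hz (fun y Hy => Hy)).
    generalize (filter_and _ _ C1 C2); apply filter_imp.
    intros y [Hy1 Hy2]; revert y Hy1 Hy2.
    enough (En : forall y : C, (Cmod (fn N y - fn N z) < e - 2 * (K / 2 ^ N))%R ->
      (Cmod (y - c) < rho)%R -> (Cmod (f y - f z) < e)%R) by exact En.
    intros y Hy1 Hy2.
    assert (h1 := Hn N y Hy2); assert (h2 := Hn N z Hz).
    replace (f y - f z) with (- (fn N y - f y) + (fn N y - fn N z) + (fn N z - f z)) by ring.
    eapply Rle_lt_trans; [apply Cmod_triangle|].
    eapply Rle_lt_trans; [apply Rplus_le_compat_r, Cmod_triangle|].
    rewrite Cmod_opp; lra. }
  set (r := (rho / 2)%R); assert (r0 : (0 < r)%R) by (unfold r; lra).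
  assert (rR : (r < rho)%R) by (unfold r; lra).
  set (phi := circle_values f c r).
  assert (on : forall t, (Cmod (c + circle r t - c) < rho)%R).
  { intros t; replace (c + circle r t - c) with (circle r t) by ring; rewrite Cmod_circle; lra. }
  assert (Hphi : forall t, Ccontinuous phi t).
  { intros t; apply Ccontinuous_mult; [|cont].
    apply (Ccontinuous_comp f); [cont | apply Hc, on]. }
  assert (E : forall w, (Cmod w < r)%R -> Cauchy_integral phi r 1 w = f (c + w)).
  { intros w Hw.
    assert (wc : (Cmod (c + w - c) < rho)%R) by (replace (c + w - c) with w by ring; lra).
    destruct (Cbounded_01 (fun t => circle r t * (/ (circle r t - w)) ^ 1)) as [M [M0 HM]].
    { intros t _; apply Ccontinuous_mult; [cont|].
      apply Ccontinuous_pow, Ccontinuous_inv; [apply circle_neq; exact Hw | cont]. }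
    assert (Z : Cauchy_integral phi r 1 w - f (c + w) = 0).
    { apply (Cgeometric_zero _ (/ 2) (K * M + K)); [lra|]; intros n.
      rewrite pow_inv.
      replace (Cauchy_integral phi r 1 w - f (c + w)) with
        (- (Cauchy_integral (circle_values (fn n) c r) r 1 w - Cauchy_integral phi r 1 w) +
          (fn n (c + w) - f (c + w)))
        by (rewrite (Cauchy_formula (fn n) c r rho rR (Hd n) w Hw); ring).
      eapply Rle_trans; [apply Cmod_triangle|]; rewrite Cmod_opp.
      rewrite Rmult_plus_distr_l; apply Rplus_le_compat.
      2:{ rewrite Rmult_comm; apply (Hn n _ wc). }
      replace (/ 2 ^ n * (K * M))%R with (K / 2 ^ n * M)%R by (unfold Rdiv; ring).
      refine (is_CInt_le _ _ _ _ (is_CInt_minus _ _ _ _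
        (is_CInt_Cauchy_integral _ r 1 w
          (Ccontinuous_circle_values (fn n) c r rho r0 rR (Hd n)) Hw)
        (is_CInt_Cauchy_integral phi r 1 w Hphi Hw))).
      intros t Ht; unfold phi, circle_values.
      replace (fn n (c + circle r t) * circle r t * (/ (circle r t - w)) ^ 1 -
        f (c + circle r t) * circle r t * (/ (circle r t - w)) ^ 1) with
        ((fn n (c + circle r t) - f (c + circle r t)) * (circle r t * (/ (circle r t - w)) ^ 1))
        by ring.
      rewrite Cmod_mult; apply Rmult_le_compat; try apply Cmod_ge_0; auto. }
    replace (f (c + w)) with (Cauchy_integral phi r 1 w - (Cauchy_integral phi r 1 w - f (c + w)))
      by ring.
    rewrite Z; ring. }
  assert (c0 : (Cmod (c - c) < r)%R)
    by (replace (c - c) with (RtoC 0) by ring; rewrite Cmod_0; lra).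
  eexists; refine (Cderivable_ext_loc (fun y => Cauchy_integral phi r 1 (y - c)) f _ _ _ _).
  - apply (locally_disc c c r _ c0); intros y Hy.
    rewrite E by exact Hy; f_equal; ring.
  - apply (Cderivable_translate_minus (Cauchy_integral phi r 1)).
    apply (Cderivable_Cauchy_integral phi r 1 (c - c) Hphi c0).
Qed.

(** * Holomorphic functions on open and star-shaped sets *)

Lemma open_disc (U : C -> Prop) (z : C) :
  open U -> U z -> exists r : R, (0 < r)%R /\ forall y, (Cmod (y - z) < r)%R -> U y.
Proof. intros oU Uz; apply (proj1 (locally_Cmod z U)), oU, Uz. Qed.

Lemma Cmod_diag (z : C) (r : R) : (0 < r)%R -> (Cmod (z - z) < r)%R.
Proof. intros r0; replace (z - z) with (RtoC 0) by ring; rewrite Cmod_0; exact r0. Qed.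

Lemma holomorphic_Cderive_n (U : C -> Prop) (f : C -> C) (k : nat) :
  open U -> holomorphic_on U f -> holomorphic_on U (Cderive_n f k).
Proof.
  intros oU H z Uz; destruct (open_disc U z oU Uz) as [r [r0 Hr]].
  replace z with (z + 0) by ring.
  apply (Cdiff_Cderive_n f z (r / 2) r); [lra | lra | intros y Hy; apply H, Hr, Hy |].
  rewrite Cmod_0; lra.
Qed.

Lemma holomorphic_C_derive (U : C -> Prop) (f : C -> C) :
  open U -> holomorphic_on U f -> holomorphic_on U (C_derive f).
Proof. exact (holomorphic_Cderive_n U f 1). Qed.

Lemma holomorphic_plus (U : C -> Prop) (f g : C -> C) :
  holomorphic_on U f -> holomorphic_on U g -> holomorphic_on U (fun z => f z + g z).
Proof.
  intros Hf Hg z Uz; destruct (Hf z Uz) as [a Ha], (Hg z Uz) as [b Hb].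
  exists (a + b); exact (Cderivable_plus f g z a b Ha Hb).
Qed.

Lemma holomorphic_scal (U : C -> Prop) (c : C) (f : C -> C) :
  holomorphic_on U f -> holomorphic_on U (fun z => c * f z).
Proof.
  intros Hf z Uz; destruct (Hf z Uz) as [a Ha].
  eexists; exact (Cderivable_mult _ f z _ a (Cderivable_const c z) Ha).
Qed.

Lemma Cderive_n_shift (f : C -> C) (k : nat) : Cderive_n f (S k) = Cderive_n (C_derive f) k.
Proof. unfold Cderive_n; now rewrite Nat.iter_succ_r. Qed.

Lemma Cderive_n_ext_open (U : C -> Prop) (f g : C -> C) (k : nat) :
  open U -> (forall z, U z -> f z = g z) ->
  forall z, U z -> Cderive_n f k z = Cderive_n g k z.
Proof.
  intros oU E; induction k as [|k IH]; [exact E|].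
  exact (C_derive_ext_open U _ _ oU IH).
Qed.

Lemma Cderive_n_zero (k : nat) (z : C) : Cderive_n (fun _ => RtoC 0) k z = 0.
Proof.
  revert z; induction k as [|k IH]; intros z; [reflexivity|].
  change (C_derive (Cderive_n (fun _ => RtoC 0) k) z = 0); apply is_C_derive_unique.
  apply (Cderivable_ext (fun _ => RtoC 0)); [intros; symmetry; apply IH | apply Cderivable_const].
Qed.

(** Star-shaped open sets are the natural domains for the Duhamel product, whose
    value at [z] only depends on the segment from 0 to [z]. *)
Definition starlike (V : C -> Prop) : Prop :=
  open V /\ V 0 /\ forall z (t : R), V z -> (0 <= t <= 1)%R -> V (RtoC t * z).

Lemma Cderivable_scaled (f : C -> C) (s z l : C) :
  Cderivable f (s * z) l -> Cderivable (fun y => f (s * y)) z (s * l).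
Proof.
  intros H.
  assert (D := Cderivable_mult _ _ z _ _ (Cderivable_const s z) (Cderivable_id z)).
  assert (K := Cderivable_comp f (fun y => s * y) z _ _ H D).
  cbn beta in K; replace (0 * z + s * 1) with s in K by ring; exact K.
Qed.

Lemma starlike_derive_unique (V : C -> Prop) (f g h : C -> C) :
  starlike V -> f 0 = g 0 ->
  (forall z, V z -> Cderivable f z (h z)) -> (forall z, V z -> Cderivable g z (h z)) ->
  forall z, V z -> f z = g z.
Proof.
  intros [oV [V0 sV]] E0 Hf Hg z Vz.
  assert (K := Cderivable_zero_const (fun s => f (z * s) - g (z * s))).
  cbn beta in K.
  replace (z * 1) with z in K by ring; replace (z * 0) with (RtoC 0) in K by ring.
  rewrite E0 in K.
  replace (f z) with (g z + (f z - g z)) by ring; rewrite K; [ring|].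
  intros t Ht.
  assert (Vt : V (z * RtoC t)) by (rewrite Cmult_comm; auto).
  assert (D := Cderivable_minus _ _ _ _ _ (Cderivable_scaled f z (RtoC t) _ (Hf _ Vt))
    (Cderivable_scaled g z (RtoC t) _ (Hg _ Vt))).
  replace (z * h (z * RtoC t) - z * h (z * RtoC t)) with (RtoC 0) in D by ring; exact D.
Qed.

Lemma Ccontinuous_ray (z : C) (t : R) : Ccontinuous (fun s : R => RtoC s * z) t.
Proof.
  apply Ccontinuous_mult; [|apply Ccontinuous_const].
  apply Ccontinuous_RtoC, continuous_id.
Qed.

(** Along the segment from 0 to [z], the set of parameters at which all derivatives
    vanish is closed by continuity and open by the local identity theorem; its
    supremum is therefore 1. *)
Lemma starlike_identity (V : C -> Prop) (f : C -> C) :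
  starlike V -> holomorphic_on V f -> (forall k, Cderive_n f k 0 = 0) ->
  forall z, V z -> f z = 0.
Proof.
  intros [oV [V0 sV]] Hf H0 z Vz.
  pose (P := fun t : R => forall k, Cderive_n f k (RtoC t * z) = 0).
  assert (P0 : P 0%R) by (intros k; replace (RtoC 0 * z) with (RtoC 0) by ring; apply H0).
  assert (nbhd : forall (t : R) (Q : C -> Prop),
    locally (T := C_UniformSpace) (RtoC t * z) Q ->
    exists d : R, (0 < d)%R /\ forall s, (Rabs (s - t) < d)%R -> Q (RtoC s * z)).
  { intros t Q HQ; destruct (Ccontinuous_ray z t Q HQ) as [d Hd].
    exists d; split; [apply cond_pos | exact Hd]. }
  assert (Popen : forall t, (0 <= t <= 1)%R -> P t ->
    exists d : R, (0 < d)%R /\ forall s, (Rabs (s - t) < d)%R -> P s).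
  { intros t Ht Pt; apply (nbhd t (fun y => forall k, Cderive_n f k y = 0)), locally_Cmod.
    destruct (open_disc V _ oV (sV z t Vz Ht)) as [r [r0 Hr]].
    exists r; split; [exact r0|]; intros y Hy k.
    rewrite <- (Cderive_n_zero k y).
    apply (Cderive_n_ext_open (fun y => (Cmod (y - RtoC t * z) < r)%R)); [| |exact Hy].
    - apply (open_Ccontinuous_disc (T := C_UniformSpace) (fun y => y - RtoC t * z)).
      intros x; cont.
    - apply (disc_identity f (RtoC t * z) r); [intros x Hx; apply Hf, Hr, Hx | exact Pt]. }
  assert (Pclosed : forall t, (0 <= t <= 1)%R -> (forall s, (0 <= s < t)%R -> P s) -> P t).
  { intros t Ht Ps k; apply NNPP; intros n.
    assert (m0 := proj1 (Cmod_gt_0 _) n).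
    assert (L := proj1 (Ccontinuous_eps _ _) (Cdiff_continuous _ _
      (holomorphic_Cderive_n V f k oV Hf _ (sV z t Vz Ht))) _ m0).
    destruct (nbhd t _ L) as [d [d0 Hd]].
    destruct (Req_dec t 0) as [->|t0]; [apply n, P0|].
    set (s := Rmax 0 (t - d / 2)).
    assert (Hs : (0 <= s < t)%R) by (split; [apply Rmax_l | apply Rmax_lub_lt; lra]).
    assert (s2 : (t - d / 2 <= s)%R) by apply Rmax_r.
    assert (B := Hd s ltac:(apply Rabs_def1; lra)).
    rewrite (Ps s Hs k) in B.
    replace (0 - Cderive_n f k (RtoC t * z)) with (- Cderive_n f k (RtoC t * z)) in B by ring.
    rewrite Cmod_opp in B; lra. }
  destruct (completeness (fun t => (0 <= t <= 1)%R /\ forall s, (0 <= s <= t)%R -> P s))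
    as [m [ub lub]].
  { exists 1%R; intros t [Ht _]; lra. }
  { exists 0%R; split; [lra|]; intros s Hs; replace s with 0%R by lra; exact P0. }
  assert (m0 : (0 <= m)%R).
  { apply ub; split; [lra|]; intros s Hs; replace s with 0%R by lra; exact P0. }
  assert (m1 : (m <= 1)%R) by (apply lub; intros t [Ht _]; lra).
  assert (below : forall s, (0 <= s < m)%R -> P s).
  { intros s Hs; apply NNPP; intros N.
    assert (m <= s)%R; [|lra]; apply lub; intros t [Ht Pt].
    destruct (Rle_dec t s) as [|ts]; [assumption|]; exfalso; apply N, Pt; lra. }
  assert (Pm : P m) by (apply Pclosed; auto; lra).
  destruct (Req_dec m 1) as [->|mn].
  - assert (E := Pm O); replace (RtoC 1 * z) with z in E by ring; exact E.
  - destruct (Popen m (conj m0 m1) Pm) as [d [d0 Hd]].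
    exfalso; set (t := Rmin 1 (m + d / 2)).
    assert (t1 : (t <= 1)%R) by apply Rmin_l.
    assert (t2 : (t <= m + d / 2)%R) by apply Rmin_r.
    assert (t3 : (m < t)%R) by (apply Rmin_glb_lt; lra).
    assert (t <= m)%R; [|lra]; apply ub; split; [lra|]; intros s Hs.
    destruct (Rlt_dec s m); [apply below; lra | apply Hd, Rabs_def1; lra].
Qed.

Lemma starlike_local_bound (V : C -> Prop) (f : C -> C) (z0 : C) :
  starlike V -> holomorphic_on V f -> V z0 ->
  exists d M : R, (0 < d)%R /\ (0 <= M)%R /\ forall (z : C) (t : R), (Cmod (z - z0) < d)%R ->
    (0 <= t <= 1)%R -> V z /\ (Cmod (f (RtoC t * z)%C) <= M)%R.
Proof.
  intros [oV [V0 sV]] Hf Vz.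
  assert (cf : forall t : R, (0 <= t <= 1)%R -> Ccontinuous f (RtoC t * z0))
    by (intros t Ht; apply Cdiff_continuous, Hf, sV; auto).
  destruct (Cbounded_01 (fun t => f (RtoC t * z0))) as [M [M0 HM]].
  { intros t Ht; apply (Ccontinuous_comp f); [apply Ccontinuous_ray | auto]. }
  destruct (tube z0 (fun t z => (Cmod (f (RtoC t * z)%C) <= M + 1)%R)) as [d [d0 Hd]].
  { intros t Ht.
    assert (c : continuous (T := RxC) (U := C_UniformSpace)
       (fun p => f (RtoC (fst p) * snd p)) (t, z0)).
    { apply (Ccontinuous_comp f (fun p : RxC => RtoC (fst p) * snd p)); [|exact (cf t Ht)].
      apply Ccontinuous_mult; [|apply Ccontinuous_snd].
      apply (Ccontinuous_fst_comp RtoC), Ccontinuous_RtoC, continuous_id. }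
    generalize (proj1 (Ccontinuous_eps _ _) c 1%R Rlt_0_1); apply filter_imp.
    intros [s y]; cbn [fst snd]; intros Hy; specialize (HM t Ht).
    replace (f (RtoC s * y)) with ((f (RtoC s * y) - f (RtoC t * z0)) + f (RtoC t * z0)) by ring.
    eapply Rle_trans; [apply Cmod_triangle|]; lra. }
  destruct (open_disc V z0 oV Vz) as [r [r0 Hr]].
  exists (Rmin d r), (M + 1)%R; split; [apply Rmin_glb_lt; auto | split; [lra|]].
  intros z t Hz Ht; split.
  - apply Hr; eapply Rlt_le_trans; [exact Hz | apply Rmin_r].
  - apply Hd; auto; eapply Rlt_le_trans; [exact Hz | apply Rmin_l].
Qed.

(** * Convolution and the Duhamel product *)

(** The integral of [v xi * k (z - xi)] over the segment from 0 to [z], with the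
    segment parametrized so that [z] enters only as a parameter of the integrand. *)
Definition convolution (v k : C -> C) (z : C) : C :=
  z * CInt (fun t => v (RtoC t * z) * k ((1 - RtoC t) * z)).

Lemma starlike_reverse (V : C -> Prop) (z : C) (t : R) :
  starlike V -> V z -> (0 <= t <= 1)%R -> V ((1 - RtoC t) * z).
Proof.
  intros [_ [_ sV]] Vz Ht; rewrite <- RtoC_minus; apply sV; auto; lra.
Qed.

Lemma Ccontinuous_reverse_ray (z : C) (t : R) : Ccontinuous (fun s : R => (1 - RtoC s) * z) t.
Proof.
  apply Ccontinuous_mult; [|apply Ccontinuous_const].
  apply Ccontinuous_minus; [apply Ccontinuous_const|].
  apply Ccontinuous_RtoC, continuous_id.
Qed.

Lemma is_CInt_convolution (V : C -> Prop) (v k : C -> C) (z : C) :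
  starlike V -> holomorphic_on V v -> holomorphic_on V k -> V z ->
  is_CInt (fun t => z * (v (RtoC t * z) * k ((1 - RtoC t) * z))) (convolution v k z).
Proof.
  intros sV Hv Hk Vz; apply is_CInt_scal, is_CInt_CInt; intros t Ht.
  apply Ccontinuous_mult.
  - apply (Ccontinuous_comp v); [apply Ccontinuous_ray|].
    apply Cdiff_continuous, Hv; apply sV; auto.
  - apply (Ccontinuous_comp k (fun s : R => (1 - RtoC s) * z)).
    + apply Ccontinuous_reverse_ray.
    + apply Cdiff_continuous, Hk, starlike_reverse; auto.
Qed.

Lemma duhamel_convolution (V : C -> Prop) (v w : C -> C) (z : C) :
  starlike V -> holomorphic_on V v -> holomorphic_on V w -> V z ->
  duhamel v w z = w 0 * v z + convolution v (C_derive w) z.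
Proof.
  intros sV Hv Hw Vz; unfold duhamel; f_equal; apply is_CInt_unique.
  refine (is_CInt_ext _ _ _ _ (is_CInt_convolution V v (C_derive w) z sV Hv _ Vz)).
  - intros t _.
    replace (0 + RtoC t * (z - 0)) with (RtoC t * z) by ring.
    replace (z - RtoC t * z) with ((1 - RtoC t) * z) by ring; ring.
  - apply holomorphic_C_derive; [apply sV | exact Hw].
Qed.

Lemma convolution_comm (V : C -> Prop) (v k : C -> C) (z : C) :
  starlike V -> holomorphic_on V v -> holomorphic_on V k -> V z ->
  convolution v k z = convolution k v z.
Proof.
  intros sV Hv Hk Vz.
  assert (I := is_CInt_convolution V v k z sV Hv Hk Vz).
  apply (is_RInt_swap (V := C_R_NormedModule)) in I.
  assert (I1 := is_RInt_comp_lin (V := C_R_NormedModule)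
    (fun t => z * (v (RtoC t * z) * k ((1 - RtoC t) * z))) (Ropp 1) 1 0 1 (- convolution v k z)).
  replace (Ropp 1 * 0 + 1)%R with 1%R in I1 by ring.
  replace (Ropp 1 * 1 + 1)%R with 0%R in I1 by ring.
  specialize (I1 I).
  assert (I' : is_CInt (fun t => - (z * (k (RtoC t * z) * v ((1 - RtoC t) * z))))
                 (- convolution v k z)).
  { refine (is_CInt_ext _ _ _ _ I1); intros t _; rewrite scal_C_R.
    rewrite RtoC_plus, RtoC_mult, RtoC_opp.
    replace ((- RtoC 1 * RtoC t + RtoC 1) * z) with ((1 - RtoC t) * z)
      by ring.
    replace ((1 - (- RtoC 1 * RtoC t + RtoC 1)) * z) with (RtoC t * z)
      by ring.
    ring. }
  assert (J := is_CInt_plus _ _ _ _ I' (is_CInt_convolution V k v z sV Hk Hv Vz)).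
  assert (Z : is_CInt (fun _ => RtoC 0) (- convolution v k z + convolution k v z)).
  { refine (is_CInt_ext _ _ _ _ J); intros t _; ring. }
  apply is_CInt_unique in Z; assert (Z0 := is_CInt_const 0); apply is_CInt_unique in Z0.
  rewrite Z0 in Z.
  replace (convolution k v z)
    with (convolution v k z + (- convolution v k z + convolution k v z)) by ring.
  rewrite <- Z; ring.
Qed.

(** Differentiation under the integral sign gives an integrand which differs from
    the desired one by the derivative in [t] of [t * v (t z) * k ((1 - t) z)]; the
    integral of the latter is [v z * k 0]. *)
Lemma Cderivable_convolution (V : C -> Prop) (v k : C -> C) (z : C) :
  starlike V -> holomorphic_on V v -> holomorphic_on V k -> V z ->
  Cderivable (convolution v k) z (k 0 * v z + convolution v (C_derive k) z).
Proof.
  intros sV Hv Hk Vz.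
  assert (oV : open V) by apply sV.
  assert (Hv' := holomorphic_C_derive V v oV Hv).
  assert (Hk' := holomorphic_C_derive V k oV Hk).
  pose (v' := C_derive v); pose (k' := C_derive k).
  fold v' in Hv'; fold k' in Hk'; fold k'.
  pose (I' := CInt (fun t => RtoC t * v' (RtoC t * z) * k ((1 - RtoC t) * z) +
     v (RtoC t * z) * ((1 - RtoC t) * k' ((1 - RtoC t) * z)))).
  assert (Cfst : forall p : RxC, continuous (T := RxC) (U := C_UniformSpace) (fun q => RtoC (fst q)) p).
  { intros p; apply (Ccontinuous_fst_comp RtoC), Ccontinuous_RtoC, continuous_id. }
  assert (cv : forall (h : C -> C) (p : RxC), holomorphic_on V h -> V (RtoC (fst p) * snd p) ->
     continuous (T := RxC) (U := C_UniformSpace) (fun q => h (RtoC (fst q) * snd q)) p).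
  { intros h p Hh Hp; apply (Ccontinuous_comp h (fun q : RxC => RtoC (fst q) * snd q)).
    - apply Ccontinuous_mult; [apply Cfst | apply Ccontinuous_snd].
    - apply Cdiff_continuous, Hh, Hp. }
  assert (ck : forall (h : C -> C) (p : RxC), holomorphic_on V h -> V ((1 - RtoC (fst p)) * snd p) ->
     continuous (T := RxC) (U := C_UniformSpace) (fun q => h ((1 - RtoC (fst q)) * snd q)) p).
  { intros h p Hh Hp; apply (Ccontinuous_comp h (fun q : RxC => (1 - RtoC (fst q)) * snd q)).
    - apply Ccontinuous_mult; [|apply Ccontinuous_snd].
      apply Ccontinuous_minus; [apply Ccontinuous_const | apply Cfst].
    - apply Cdiff_continuous, Hh, Hp. }
  assert (D : Cderivable (fun y => CInt (fun t => v (RtoC t * y) * k ((1 - RtoC t) * y))) z I').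
  { apply (Cderivable_CInt (fun t y => v (RtoC t * y) * k ((1 - RtoC t) * y))
      (fun t y => RtoC t * v' (RtoC t * y) * k ((1 - RtoC t) * y) +
        v (RtoC t * y) * ((1 - RtoC t) * k' ((1 - RtoC t) * y)))
      (fun p => V (RtoC (fst p) * snd p) /\ V ((1 - RtoC (fst p)) * snd p))).
    - apply open_and.
      + apply (open_comp (fun p : RxC => RtoC (fst p) * snd p) V); [|exact oV].
        intros p _; exact (Ccontinuous_mult _ _ p (Cfst p) (Ccontinuous_snd p)).
      + apply (open_comp (fun p : RxC => (1 - RtoC (fst p)) * snd p) V); [|exact oV].
        intros p _; exact (Ccontinuous_mult _ _ p
          (Ccontinuous_minus _ _ p (Ccontinuous_const 1 p) (Cfst p)) (Ccontinuous_snd p)).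
    - intros t Ht; cbn [fst snd]; split; [apply sV; auto | apply starlike_reverse; auto].
    - intros t y [V1 V2]; cbn [fst snd] in V1, V2; split; [|split].
      + exact (Cderivable_mult _ _ y _ _
          (Cderivable_scaled v (RtoC t) y _ (Cdiff_derivable v _ (Hv _ V1)))
          (Cderivable_scaled k (1 - RtoC t) y _ (Cdiff_derivable k _ (Hk _ V2)))).
      + apply Ccontinuous_mult; [apply cv | apply ck]; auto.
      + apply Ccontinuous_plus; apply Ccontinuous_mult.
        * apply Ccontinuous_mult; [apply Cfst | apply cv; auto].
        * apply ck; auto.
        * apply cv; auto.
        * apply Ccontinuous_mult; [|apply ck; auto].
          apply Ccontinuous_minus; [apply Ccontinuous_const | apply Cfst]. }
  assert (D2 := Cderivable_mult _ _ _ _ _ (Cderivable_id z) D); cbn beta in D2.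
  replace (k 0 * v z + convolution v k' z) with
    (1 * CInt (fun t => v (RtoC t * z) * k ((1 - RtoC t) * z)) + z * I'); [exact D2|].
  assert (r1 : forall (h : C -> C) (t : R), holomorphic_on V h -> (0 <= t <= 1)%R ->
     Ccontinuous (fun s : R => h (RtoC s * z)) t).
  { intros h t Hh Ht; apply (Ccontinuous_comp h); [apply Ccontinuous_ray|].
    apply Cdiff_continuous, Hh; apply sV; auto. }
  assert (r2 : forall (h : C -> C) (t : R), holomorphic_on V h -> (0 <= t <= 1)%R ->
     Ccontinuous (fun s : R => h ((1 - RtoC s) * z)) t).
  { intros h t Hh Ht; apply (Ccontinuous_comp h (fun s : R => (1 - RtoC s) * z)).
    - apply Ccontinuous_reverse_ray.
    - apply Cdiff_continuous, Hh, starlike_reverse; auto. }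
  assert (r3 : forall t : R, Ccontinuous RtoC t)
    by (intros t; apply Ccontinuous_RtoC, continuous_id).
  assert (r4 : forall t : R, Ccontinuous (fun s : R => 1 - RtoC s) t)
    by (intros t; apply Ccontinuous_minus; [apply Ccontinuous_const | apply r3]).
  (* The total derivative that accounts for the difference.  The variable is complex so
     that the rules for complex derivatives apply; only values in [0, 1] matter. *)
  pose (G := fun s : C => s * (v (s * z) * k ((1 - s) * z))).
  pose (g := fun s : C => 1 * (v (s * z) * k ((1 - s) * z)) +
      s * (z * v' (s * z) * k ((1 - s) * z) + v (s * z) * (- z * k' ((1 - s) * z)))).
  assert (DG : forall t : R, (0 <= t <= 1)%R -> Cderivable G (RtoC t) (g (RtoC t))).
  { intros t Ht.
    assert (V1 : V (z * RtoC t)) by (rewrite Cmult_comm; apply sV; auto).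
    assert (V2 : V (z + - z * RtoC t)).
    { replace (z + - z * RtoC t) with ((1 - RtoC t) * z) by ring; apply starlike_reverse; auto. }
    assert (E1 := Cderivable_scaled v z (RtoC t) _ (Cdiff_derivable v _ (Hv _ V1))).
    assert (E2 := Cderivable_scaled (fun y => k (z + y)) (- z) (RtoC t) _
      (Cderivable_translate k z _ _ (Cdiff_derivable k _ (Hk _ V2)))).
    assert (E3 := Cderivable_mult _ _ _ _ _ (Cderivable_id (RtoC t))
      (Cderivable_mult _ _ _ _ _ E1 E2)).
    cbn beta in E3.
    replace (g (RtoC t)) with
      (1 * (v (z * RtoC t) * k (z + - z * RtoC t)) +
       RtoC t * (z * v' (z * RtoC t) * k (z + - z * RtoC t) +
        v (z * RtoC t) * (- z * k' (z + - z * RtoC t)))).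
    - apply (Cderivable_ext (fun y => y * (v (z * y) * k (z + - z * y)))); [|exact E3].
      intros y; unfold G; replace (z + - z * y) with ((1 - y) * z) by ring.
      now rewrite (Cmult_comm z y).
    - unfold g; replace (z + - z * RtoC t) with ((1 - RtoC t) * z) by ring.
      now rewrite (Cmult_comm z (RtoC t)). }
  assert (K1 : is_CInt (fun t => g (RtoC t)) (v z * k 0)).
  { assert (L := is_CInt_derive (fun t => G (RtoC t)) (fun t => g (RtoC t) * 1)).
    replace (v z * k 0) with (G (RtoC 1) - G (RtoC 0)).
    2:{ unfold G; replace (RtoC 1 * z) with z by ring.
        replace ((1 - RtoC 1) * z) with (RtoC 0) by ring; ring. }
    refine (is_CInt_ext _ _ _ _ (L _ _)).
    - intros t _; ring.
    - intros t Ht.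
      apply (is_derive_C_along G RtoC t (g (RtoC t)) 1 (DG t Ht)).
      apply (is_derive_ext (V := C_R_NormedModule)) with (2 := is_derive_affine 0 1 t).
      intros s; change (0 + RtoC s * 1 = RtoC s); ring.
    - intros t Ht; apply Ccontinuous_mult; [|apply Ccontinuous_const]; unfold g.
      assert (cz := fun c : C => Ccontinuous_const c t).
      assert (c1 := Ccontinuous_mult _ _ t (r1 v t Hv Ht) (r2 k t Hk Ht)).
      assert (c2 := Ccontinuous_mult _ _ t (Ccontinuous_mult _ _ t (cz z) (r1 v' t Hv' Ht))
        (r2 k t Hk Ht)).
      assert (c3 := Ccontinuous_mult _ _ t (r1 v t Hv Ht)
        (Ccontinuous_mult _ _ t (cz (- z)) (r2 k' t Hk' Ht))).
      exact (Ccontinuous_plus _ _ t (Ccontinuous_mult _ _ t (cz 1) c1)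
        (Ccontinuous_mult _ _ t (r3 t) (Ccontinuous_plus _ _ t c2 c3))). }
  assert (K2 := is_CInt_convolution V v k' z sV Hv Hk' Vz).
  assert (K3 := is_CInt_plus _ _ _ _ K1 K2).
  assert (K4 : is_CInt (fun t => v (RtoC t * z) * k ((1 - RtoC t) * z))
    (CInt (fun t => v (RtoC t * z) * k ((1 - RtoC t) * z)))).
  { apply is_CInt_CInt; intros t Ht; apply Ccontinuous_mult; [apply r1 | apply r2]; auto. }
  assert (K5 : is_CInt (fun t => RtoC t * v' (RtoC t * z) * k ((1 - RtoC t) * z) +
     v (RtoC t * z) * ((1 - RtoC t) * k' ((1 - RtoC t) * z))) I').
  { apply is_CInt_CInt; intros t Ht; apply Ccontinuous_plus; apply Ccontinuous_mult.
    - apply Ccontinuous_mult; [apply r3 | apply r1; auto].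
    - apply r2; auto.
    - apply r1; auto.
    - apply Ccontinuous_mult; [apply r4 | apply r2; auto]. }
  assert (K6 := is_CInt_plus _ _ _ _ (is_CInt_scal 1 _ _ K4) (is_CInt_scal z _ _ K5)).
  apply is_CInt_unique in K3; apply is_CInt_unique in K6.
  rewrite <- K6, (Cmult_comm (k 0)), <- K3; apply CInt_ext; intros t _; unfold g; ring.
Qed.

Lemma holomorphic_convolution (V : C -> Prop) (v k : C -> C) :
  starlike V -> holomorphic_on V v -> holomorphic_on V k -> holomorphic_on V (convolution v k).
Proof.
  intros sV Hv Hk z Vz; eexists; exact (Cderivable_convolution V v k z sV Hv Hk Vz).
Qed.

Lemma Cderivable_duhamel (V : C -> Prop) (v w : C -> C) (z : C) :
  starlike V -> holomorphic_on V v -> holomorphic_on V w -> V z ->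
  Cderivable (duhamel v w) z (w 0 * C_derive v z + duhamel v (C_derive w) z).
Proof.
  intros sV Hv Hw Vz; assert (oV : open V) by apply sV.
  assert (Hw' := holomorphic_C_derive V w oV Hw).
  rewrite (duhamel_convolution V v (C_derive w) z sV Hv Hw' Vz).
  assert (D := Cderivable_plus _ _ _ _ _
    (Cderivable_mult _ _ _ _ _ (Cderivable_const (w 0) z) (Cdiff_derivable v z (Hv z Vz)))
    (Cderivable_convolution V v (C_derive w) z sV Hv Hw' Vz)).
  cbn beta in D; replace (0 * v z + w 0 * C_derive v z) with (w 0 * C_derive v z) in D by ring.
  refine (Cderivable_ext_loc _ _ _ _ _ D).
  generalize (oV z Vz); apply filter_imp; intros y Vy; symmetry.
  exact (duhamel_convolution V v w y sV Hv Hw Vy).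
Qed.

Lemma holomorphic_duhamel (V : C -> Prop) (v w : C -> C) :
  starlike V -> holomorphic_on V v -> holomorphic_on V w -> holomorphic_on V (duhamel v w).
Proof.
  intros sV Hv Hw z Vz; eexists; exact (Cderivable_duhamel V v w z sV Hv Hw Vz).
Qed.

(** Both sides are derivatives of the same convolution. *)
Lemma duhamel_comm (V : C -> Prop) (v w : C -> C) (z : C) :
  starlike V -> holomorphic_on V v -> holomorphic_on V w -> V z ->
  duhamel v w z = duhamel w v z.
Proof.
  intros sV Hv Hw Vz.
  rewrite (duhamel_convolution V v w z sV Hv Hw Vz), (duhamel_convolution V w v z sV Hw Hv Vz).
  assert (D1 := Cderivable_convolution V v w z sV Hv Hw Vz).
  assert (D2 := Cderivable_convolution V w v z sV Hw Hv Vz).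
  apply is_C_derive_unique in D2; rewrite <- D2; symmetry; apply is_C_derive_unique.
  refine (Cderivable_ext_loc _ _ _ _ _ D1).
  generalize (proj1 sV z Vz); apply filter_imp; intros y Vy.
  exact (convolution_comm V v w y sV Hv Hw Vy).
Qed.

Lemma duhamel_0 (v w : C -> C) : duhamel v w 0 = v 0 * w 0.
Proof.
  unfold duhamel, segment_integral.
  rewrite (CInt_ext _ (fun _ => RtoC 0)) by (intros; ring).
  assert (Z := is_CInt_const 0); apply is_CInt_unique in Z; rewrite Z; ring.
Qed.

(** If [w 0 = 0], the derivative of the product is the product with [w'], so each
    order of vanishing of [w] passes to the product. *)
Lemma Cderive_n_duhamel (V : C -> Prop) (v w : C -> C) (n : nat) :
  starlike V -> holomorphic_on V v -> holomorphic_on V w ->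
  (forall j, (j <= n)%nat -> Cderive_n w j 0 = 0) ->
  forall j, (j <= n)%nat -> Cderive_n (duhamel v w) j 0 = 0.
Proof.
  intros sV Hv; revert w; induction n as [|n IH]; intros w Hw H j Hj.
  - replace j with O by lia; change (duhamel v w 0 = 0).
    rewrite duhamel_0; assert (E := H O (Nat.le_refl O)); change (w 0 = 0) in E; rewrite E; ring.
  - assert (E := H O ltac:(lia)); change (w 0 = 0) in E.
    destruct j as [|j]; [change (duhamel v w 0 = 0); rewrite duhamel_0, E; ring|].
    rewrite Cderive_n_shift; transitivity (Cderive_n (duhamel v (C_derive w)) j 0).
    + apply (Cderive_n_ext_open V); [apply sV | | apply sV].
      intros z Vz; assert (D := Cderivable_duhamel V v w z sV Hv Hw Vz).
      apply is_C_derive_unique in D; rewrite D, E; ring.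
    + apply IH; [| |lia].
      * apply holomorphic_C_derive; [apply sV | exact Hw].
      * intros i Hi; rewrite <- Cderive_n_shift; apply H; lia.
Qed.

(** Since [h 0 = 0], the derivative of [duhamel u h] is [duhamel u h']; two functions
    that vanish at 0 and have the same derivative are equal, so the equation can
    be integrated [m] times. *)
Lemma duhamel_lift (V : C -> Prop) (u : C -> C) (m : nat) :
  starlike V -> holomorphic_on V u -> forall h f, holomorphic_on V h -> holomorphic_on V f ->
  (forall j, (j < m)%nat -> Cderive_n h j 0 = 0) ->
  (forall j, (j < m)%nat -> Cderive_n f j 0 = 0) ->
  (forall z, V z -> duhamel u (Cderive_n h m) z = Cderive_n f m z) ->
  forall z, V z -> duhamel u h z = f z.
Proof.
  intros sV Hu; induction m as [|m IH]; intros h f Hh Hf h0 f0 E; [exact E|].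
  assert (oV : open V) by apply sV.
  assert (eh := h0 O ltac:(lia)); assert (ef := f0 O ltac:(lia)).
  change (h 0 = 0) in eh; change (f 0 = 0) in ef.
  rewrite !Cderive_n_shift in E.
  assert (E' : forall z, V z -> duhamel u (C_derive h) z = C_derive f z).
  { apply (IH (C_derive h) (C_derive f)); try (apply holomorphic_C_derive; auto); auto;
      intros j Hj; rewrite <- Cderive_n_shift; [apply h0 | apply f0]; lia. }
  apply (starlike_derive_unique V (duhamel u h) f (C_derive f) sV).
  - rewrite duhamel_0, eh, ef; ring.
  - intros z Vz; assert (D := Cderivable_duhamel V u h z sV Hu Hh Vz).
    rewrite E' in D by exact Vz; rewrite eh in D.
    replace (0 * C_derive u z + C_derive f z) with (C_derive f z) in D by ring; exact D.
  - intros z Vz; apply Cdiff_derivable, Hf, Vz.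
Qed.

(** * Volterra equations of the second kind *)

Definition Volterra_iterate (f k : C -> C) (n : nat) : C -> C :=
  Nat.iter n (fun phi => convolution phi k) f.

Fixpoint Neumann_sum (f k : C -> C) (n : nat) (z : C) : C :=
  match n with
  | O => f z
  | S m => Neumann_sum f k m z + Volterra_iterate f k (S m) z
  end.

Lemma holomorphic_Volterra_iterate (V : C -> Prop) (f k : C -> C) (n : nat) :
  starlike V -> holomorphic_on V f -> holomorphic_on V k ->
  holomorphic_on V (Volterra_iterate f k n).
Proof.
  intros sV Hf Hk; induction n as [|n IH]; [exact Hf|].
  exact (holomorphic_convolution V _ k sV IH Hk).
Qed.

Lemma holomorphic_Neumann_sum (V : C -> Prop) (f k : C -> C) (n : nat) :
  starlike V -> holomorphic_on V f -> holomorphic_on V k ->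
  holomorphic_on V (Neumann_sum f k n).
Proof.
  intros sV Hf Hk; induction n as [|n IH]; [exact Hf|].
  exact (holomorphic_plus V _ _ IH (holomorphic_Volterra_iterate V f k (S n) sV Hf Hk)).
Qed.

Lemma convolution_plus (V : C -> Prop) (u v k : C -> C) (z : C) :
  starlike V -> holomorphic_on V u -> holomorphic_on V v -> holomorphic_on V k -> V z ->
  convolution (fun y => u y + v y) k z = convolution u k z + convolution v k z.
Proof.
  intros sV Hu Hv Hk Vz.
  assert (I := is_CInt_plus _ _ _ _ (is_CInt_convolution V u k z sV Hu Hk Vz)
    (is_CInt_convolution V v k z sV Hv Hk Vz)).
  assert (J := is_CInt_convolution V _ k z sV (holomorphic_plus V u v Hu Hv) Hk Vz).
  apply is_CInt_unique in I; apply is_CInt_unique in J.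
  rewrite <- I, <- J; apply CInt_ext; intros; ring.
Qed.

Lemma Neumann_sum_step (V : C -> Prop) (f k : C -> C) (n : nat) :
  starlike V -> holomorphic_on V f -> holomorphic_on V k ->
  forall z, V z -> Neumann_sum f k (S n) z = f z + convolution (Neumann_sum f k n) k z.
Proof.
  intros sV Hf Hk; induction n as [|n IH]; intros z Vz; [reflexivity|].
  change (Neumann_sum f k (S n) z + convolution (Volterra_iterate f k (S n)) k z =
    f z + convolution (fun y => Neumann_sum f k n y + Volterra_iterate f k (S n) y) k z).
  rewrite (convolution_plus V); auto using holomorphic_Neumann_sum, holomorphic_Volterra_iterate.
  rewrite IH by exact Vz; ring.
Qed.

Lemma is_RInt_exp (c b : R) : is_RInt (V := R_NormedModule) (fun t => c * (b * exp (b * t)))%R 0 1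
  (c * exp b - c)%R.
Proof.
  replace (c * exp b - c)%R with (minus (c * exp (b * 1)) (c * exp (b * 0)))%R.
  2:{ rewrite Rmult_1_r, Rmult_0_r, exp_0; unfold minus, plus, opp; cbn; ring. }
  apply (is_RInt_derive (V := R_CompleteNormedModule) (fun t => c * exp (b * t))%R).
  - intros t _; auto_derive; [auto | ring].
  - intros t _; apply (ex_derive_continuous (K := R_AbsRing) (V := R_NormedModule)).
    auto_derive; auto.
Qed.

(** The weight [exp (L * s)] along the ray through [z] makes the Volterra operator a
    contraction with factor 1/2 as soon as [L] is at least twice [|z| * M]: this is
    what halves the bound at each step. *)
Lemma Volterra_iterate_bound (V : C -> Prop) (f k : C -> C) (z : C) (F M L : R) :
  starlike V -> holomorphic_on V f -> holomorphic_on V k -> V z ->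
  (0 <= F)%R -> (0 <= M)%R -> (2 * (Cmod z * M) <= L)%R ->
  (forall t : R, (0 <= t <= 1)%R ->
    (Cmod (f (RtoC t * z)%C) <= F)%R /\ (Cmod (k (RtoC t * z)%C) <= M)%R) ->
  forall n (s : R), (0 <= s <= 1)%R ->
    (Cmod (Volterra_iterate f k n (RtoC s * z)%C) <= F / 2 ^ n * exp (L * s))%R.
Proof.
  intros sV Hf Hk Vz F0 M0 HL H.
  assert (p2 : forall n, (0 < 2 ^ n)%R) by (intros; apply pow_lt; lra).
  assert (z0 := Cmod_ge_0 z).
  assert (L0 : (0 <= L)%R) by nra.
  induction n as [|n IH]; intros s Hs.
  - change (Cmod (f (RtoC s * z)%C) <= F / 1 * exp (L * s))%R.
    assert (e1 : (1 <= exp (L * s))%R).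
    { assert (h := exp_ineq1_le (L * s)); assert (0 <= L * s)%R by nra; lra. }
    destruct (H s Hs) as [h _]; unfold Rdiv; rewrite Rinv_1; nra.
  - assert (I := is_CInt_convolution V (Volterra_iterate f k n) k (RtoC s * z) sV
      (holomorphic_Volterra_iterate V f k n sV Hf Hk) Hk ltac:(apply sV; auto)).
    set (c := (F / 2 ^ S n)%R).
    assert (c0 : (0 <= c)%R) by (apply Rdiv_le_0_compat; auto).
    assert (c2 : (F / 2 ^ n)%R = (2 * c)%R) by (unfold c; cbn; field; specialize (p2 n); lra).
    rewrite c2 in IH.
    apply Rle_trans with (c * exp (L * s) - c)%R; [|lra].
    refine (is_CInt_bound _ _ _ _ _ I (is_RInt_exp c (L * s))); intros t Ht.
    assert (ts : (0 <= t * s <= 1)%R) by nra.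
    assert (B1 := IH (t * s)%R ts).
    assert (ts' : (0 <= (1 - t) * s <= 1)%R) by nra.
    destruct (H _ ts') as [_ B2].
    replace (RtoC t * (RtoC s * z)) with (RtoC (t * s) * z) by (rewrite RtoC_mult; ring).
    replace ((1 - RtoC t) * (RtoC s * z)) with (RtoC ((1 - t) * s) * z)
      by (rewrite RtoC_mult, RtoC_minus; ring).
    rewrite !Cmod_mult, Cmod_R, Rabs_pos_eq by lra.
    replace (L * (t * s))%R with (L * s * t)%R in B1 by ring.
    set (e := exp (L * s * t)) in *; assert (e0 : (0 < e)%R) by apply exp_pos.
    set (A := Cmod (Volterra_iterate f k n (RtoC (t * s) * z))) in *.
    set (B := Cmod (k (RtoC ((1 - t) * s) * z))) in *.
    assert (A0 : (0 <= A)%R) by apply Cmod_ge_0.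
    assert (B0 : (0 <= B)%R) by apply Cmod_ge_0.
    apply Rle_trans with (s * Cmod z * (2 * c * e * M))%R.
    + apply Rmult_le_compat_l; [apply Rmult_le_pos; lra|].
      apply Rmult_le_compat; auto.
    + replace (s * Cmod z * (2 * c * e * M))%R with (s * c * e * (2 * (Cmod z * M)))%R by ring.
      replace (c * (L * s * e))%R with (s * c * e * L)%R by ring.
      apply Rmult_le_compat_l; [|exact HL].
      apply Rmult_le_pos; [apply Rmult_le_pos|]; lra.
Qed.

Lemma Volterra_iterate_local_bound (V : C -> Prop) (f k : C -> C) (z0 : C) :
  starlike V -> holomorphic_on V f -> holomorphic_on V k -> V z0 ->
  exists d K : R, (0 < d)%R /\ (0 <= K)%R /\ forall z, (Cmod (z - z0) < d)%R ->
    V z /\ forall n (s : R), (0 <= s <= 1)%R ->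
      (Cmod (Volterra_iterate f k n (RtoC s * z)%C) <= K / 2 ^ n)%R.
Proof.
  intros sV Hf Hk Vz0.
  destruct (starlike_local_bound V f z0 sV Hf Vz0) as [d1 [F [d10 [F0 HF]]]].
  destruct (starlike_local_bound V k z0 sV Hk Vz0) as [d2 [M [d20 [M0 HM]]]].
  (* |z| <= |z0| + d1 on the disc considered, so this L suits all its points. *)
  set (L := (2 * ((Cmod z0 + d1) * M))%R).
  assert (z00 := Cmod_ge_0 z0).
  assert (L0 : (0 <= L)%R) by (unfold L; apply Rmult_le_pos; [lra|]; apply Rmult_le_pos; lra).
  exists (Rmin d1 d2), (F * exp L)%R; split; [apply Rmin_glb_lt; auto|].
  assert (eL := exp_pos L).
  split; [apply Rmult_le_pos; lra|]; intros z Hz.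
  assert (h1 : (Cmod (z - z0) < d1)%R) by (eapply Rlt_le_trans; [exact Hz | apply Rmin_l]).
  assert (h2 : (Cmod (z - z0) < d2)%R) by (eapply Rlt_le_trans; [exact Hz | apply Rmin_r]).
  assert (Vz : V z) by apply (HF z 0%R h1 ltac:(lra)).
  split; [exact Vz|]; intros n s Hs.
  assert (mz : (Cmod z <= Cmod z0 + d1)%R).
  { replace z with ((z - z0) + z0) by ring; eapply Rle_trans; [apply Cmod_triangle|]; lra. }
  assert (B := Volterra_iterate_bound V f k z F M L sV Hf Hk Vz F0 M0).
  apply Rle_trans with (F / 2 ^ n * exp (L * s))%R.
  - apply B; auto.
    + unfold L; apply Rmult_le_compat_l; [lra|]; apply Rmult_le_compat_r; auto.
    + intros t Ht; split; [apply (HF z t h1 Ht) | apply (HM z t h2 Ht)].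
  - replace (F * exp L / 2 ^ n)%R with (F / 2 ^ n * exp L)%R by (unfold Rdiv; ring).
    apply Rmult_le_compat_l; [apply Rdiv_le_0_compat; [auto | apply pow_lt; lra]|].
    destruct (Req_dec s 1) as [->|s1]; [rewrite Rmult_1_r; apply Rle_refl|].
    destruct (Req_dec L 0) as [E|L1]; [rewrite E, Rmult_0_l; apply Rle_refl|].
    apply Rlt_le, exp_increasing; nra.
Qed.

(** The Neumann series converges geometrically, locally uniformly, so its sum is
    holomorphic, and the equation is the limit of the recursion satisfied by the
    partial sums. *)
Theorem Volterra_equation (V : C -> Prop) (f k : C -> C) :
  starlike V -> holomorphic_on V f -> holomorphic_on V k ->
  exists u, holomorphic_on V u /\ forall z, V z -> u z = f z + convolution u k z.
Proof.
  intros sV Hf Hk.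
  (* The limit p must not depend on the bound K, which is only available locally:
     two bounds give the same limit. *)
  assert (lim : forall z, exists p, V z -> forall K : R,
    (forall n, (Cmod (Volterra_iterate f k n z) <= K / 2 ^ n)%R) ->
    forall n, (Cmod (Neumann_sum f k n z - p) <= 2 * K / 2 ^ n)%R).
  { intros z; destruct (classic (V z)) as [Vz|]; [|exists 0; tauto].
    assert (G : forall K, (forall n, (Cmod (Volterra_iterate f k n z) <= K / 2 ^ n)%R) ->
      exists p, forall n, (Cmod (Neumann_sum f k n z - p) <= 2 * K / 2 ^ n)%R).
    { intros K HK; apply Cgeometric_limit; intros n; cbn [Neumann_sum].
      replace (Neumann_sum f k n z + Volterra_iterate f k (S n) z - Neumann_sum f k n z)
        with (Volterra_iterate f k (S n) z) by ring.
      eapply Rle_trans; [apply HK|].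
      assert (h : (0 <= K / 2 ^ S n)%R) by (eapply Rle_trans; [apply Cmod_ge_0 | apply HK]).
      assert (p : (0 < 2 ^ n)%R) by (apply pow_lt; lra).
      replace (K / 2 ^ n)%R with (2 * (K / 2 ^ S n))%R by (cbn; field; lra); lra. }
    destruct (Volterra_iterate_local_bound V f k z sV Hf Hk Vz) as [d [K [d0 [K0 HK]]]].
    destruct (G K) as [p Hp].
    { intros n; replace z with (RtoC 1 * z) by ring.
      apply (proj2 (HK z (Cmod_diag z d d0))); lra. }
    exists p; intros _ K' HK'; destruct (G K' HK') as [p' Hp'].
    assert (E : p - p' = 0).
    { apply (Cgeometric_zero _ (/ 2) (2 * K + 2 * K')); [lra|]; intros n; rewrite pow_inv.
      replace (p - p') with (- (Neumann_sum f k n z - p) + (Neumann_sum f k n z - p')) by ring.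
      eapply Rle_trans; [apply Cmod_triangle|]; rewrite Cmod_opp.
      specialize (Hp n); specialize (Hp' n); unfold Rdiv in *; lra. }
    replace p with p'; [exact Hp'|].
    replace p' with (p - (p - p')) by ring; rewrite E; ring. }
  destruct (choice _ lim) as [u Hu].
  assert (hu : holomorphic_on V u).
  { intros z0 Vz0.
    destruct (Volterra_iterate_local_bound V f k z0 sV Hf Hk Vz0) as [d [K [d0 [K0 HK]]]].
    apply (Weierstrass (Neumann_sum f k) u z0 d (2 * K)); [exact d0 | |].
    - intros n z Hz; apply (holomorphic_Neumann_sum V f k n sV Hf Hk), (HK z Hz).
    - intros n z Hz; apply Hu; [apply (HK z Hz)|]; intros m.
      replace z with (RtoC 1 * z) by ring; apply (proj2 (HK z Hz)); lra. }
  exists u; split; [exact hu|]; intros z Vz.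
  destruct (Volterra_iterate_local_bound V f k z sV Hf Hk Vz) as [d [K [d0 [K0 HK]]]].
  destruct (HK z (Cmod_diag z d d0)) as [_ HKz].
  destruct (starlike_local_bound V k z sV Hk Vz) as [d2 [M [d20 [M0 HM]]]].
  assert (near : forall n (t : R), (0 <= t <= 1)%R ->
    (Cmod (Neumann_sum f k n (RtoC t * z)%C - u (RtoC t * z)%C) <= 2 * K / 2 ^ n)%R).
  { intros n t Ht; apply Hu; [apply sV; auto|]; intros m; apply HKz, Ht. }
  assert (E : u z - (f z + convolution u k z) = 0).
  { apply (Cgeometric_zero _ (/ 2) (2 * K + Cmod z * (2 * K * M))); [lra|]; intros n.
    rewrite pow_inv.
    assert (p : (0 < 2 ^ n)%R) by (apply pow_lt; lra).
    replace (u z - (f z + convolution u k z)) with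
      (- (Neumann_sum f k (S n) z - u z) +
        (convolution (Neumann_sum f k n) k z - convolution u k z))
      by (rewrite (Neumann_sum_step V f k n sV Hf Hk z Vz); ring).
    eapply Rle_trans; [apply Cmod_triangle|]; rewrite Cmod_opp, Rmult_plus_distr_l.
    apply Rplus_le_compat.
    - assert (h := near (S n) 1%R ltac:(lra)); replace (RtoC 1 * z) with z in h by ring.
      eapply Rle_trans; [exact h|].
      replace (2 * K / 2 ^ S n)%R with (K * / 2 ^ n)%R by (cbn; field; lra).
      assert (i : (0 < / 2 ^ n)%R) by (apply Rinv_0_lt_compat, p); nra.
    - refine (is_CInt_le _ _ _ _ (is_CInt_minus _ _ _ _
        (is_CInt_convolution V _ k z sV (holomorphic_Neumann_sum V f k n sV Hf Hk) Hk Vz)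
        (is_CInt_convolution V u k z sV hu Hk Vz))).
      intros t Ht.
      replace (z * (Neumann_sum f k n (RtoC t * z) * k ((1 - RtoC t) * z)) -
        z * (u (RtoC t * z) * k ((1 - RtoC t) * z))) with
        (z * ((Neumann_sum f k n (RtoC t * z) - u (RtoC t * z)) * k ((1 - RtoC t) * z))) by ring.
      rewrite !Cmod_mult.
      replace (/ 2 ^ n * (Cmod z * (2 * K * M)))%R with (Cmod z * (2 * K / 2 ^ n * M))%R
        by (unfold Rdiv; ring).
      apply Rmult_le_compat_l; [apply Cmod_ge_0|].
      apply Rmult_le_compat; try apply Cmod_ge_0; [apply near, Ht|].
      rewrite <- RtoC_minus; apply (HM z (1 - t)%R (Cmod_diag z d2 d20)); lra. }
  replace (u z) with (f z + convolution u k z + (u z - (f z + convolution u k z))) by ring.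
  rewrite E; ring.
Qed.

(** Dividing by [g 0] turns the equation into a Volterra equation of the second
    kind with kernel [- g' / g 0]. *)
Theorem duhamel_divide (V : C -> Prop) (f g : C -> C) :
  starlike V -> holomorphic_on V f -> holomorphic_on V g -> g 0 <> 0 ->
  exists u, holomorphic_on V u /\ forall z, V z -> duhamel u g z = f z.
Proof.
  intros sV Hf Hg n.
  assert (Hg' := holomorphic_C_derive V g (proj1 sV) Hg).
  destruct (Volterra_equation V (fun z => / g 0 * f z) (fun z => - / g 0 * C_derive g z))
    as [u [hu Eu]]; auto using holomorphic_scal.
  exists u; split; [exact hu|]; intros z Vz.
  rewrite (duhamel_convolution V u g z sV hu Hg Vz), (Eu z Vz).
  assert (I := is_CInt_convolution V u _ z sV hu (holomorphic_scal V (- / g 0) _ Hg') Vz).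
  assert (J := is_CInt_scal (- / g 0) _ _ (is_CInt_convolution V u _ z sV hu Hg' Vz)).
  apply is_CInt_unique in I; apply is_CInt_unique in J.
  rewrite <- I.
  rewrite (CInt_ext _ (fun t => - / g 0 * (z * (u (RtoC t * z) * C_derive g ((1 - RtoC t) * z)))))
    by (intros; ring).
  rewrite J; field; exact n.
Qed.

(** * Germs and continuity of the coefficient functionals *)

(** With a Lebesgue number of the cover, the sets chosen at the points of a fine
    enough grid form a subcover. *)
Lemma Ccompact_image_01 (gamma : R -> C) :
  (forall t, Ccontinuous gamma t) ->
  Ccompact (fun z => exists t : R, (0 <= t <= 1)%R /\ z = gamma t).
Proof.
  intros Hg F Fo Fc.
  assert (D : forall t : R, exists d : posreal, (0 <= t <= 1)%R ->
    exists U, F U /\ forall s : R, (Rabs (s - t) < 2 * d)%R -> U (gamma s)).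
  { intros t; destruct (excluded_middle_informative (0 <= t <= 1)%R) as [Ht|Ht].
    2:{ exists (mkposreal 1 Rlt_0_1); tauto. }
    destruct (Fc (gamma t)) as [U [FU Ut]]; [exists t; auto|].
    destruct (Hg t U (Fo U FU _ Ut)) as [d Hd].
    (* Half the radius, so that a ball about a nearby point still fits. *)
    assert (p : (0 < d / 2)%R) by (destruct d as [d d0]; cbn; lra).
    exists (mkposreal _ p); intros _; exists U; split; [exact FU|]; intros s Hs.
    apply Hd; cbn in Hs.
    change (Rabs (s - t) < d)%R; lra. }
  destruct (choice _ D) as [delta Hdelta].
  destruct (compactness_value_1d 0 1 delta) as [d Hd].
  assert (Leb : forall x : R, exists U, (0 <= x <= 1)%R -> F U /\
    forall y : R, (Rabs (y - x) < d)%R -> U (gamma y)).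
  { intros x; destruct (classic (0 <= x <= 1)%R) as [Hx|Hx].
    2:{ exists (fun _ => True); tauto. }
    apply NNPP; intros N; apply (Hd x Hx); intros [u [Hu [Hxu Hdu]]]; apply N.
    destruct (Hdelta u Hu) as [U [FU HU]]; exists U; intros _; split; [exact FU|].
    intros y Hy; apply HU.
    replace (y - u)%R with ((y - x) + (x - u))%R by ring.
    eapply Rle_lt_trans; [apply Rabs_triang|]; lra. }
  destruct (choice _ Leb) as [cover Hcover].
  assert (d0 := cond_pos d).
  destruct (nfloor_ex (/ d)) as [N [_ HN]]; [apply Rlt_le, Rinv_0_lt_compat, d0|].
  set (M := (INR N + 1)%R) in *.
  assert (iN := pos_INR N).
  assert (M0 : (0 < M)%R) by (unfold M; lra).
  assert (Md : (/ M < d)%R).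
  { rewrite <- (Rinv_inv d); apply Rinv_lt_contravar; [|exact HN].
    apply Rmult_lt_0_compat; [apply Rinv_0_lt_compat, d0 | exact M0]. }
  assert (grid : forall i, (i <= N)%nat -> (0 <= INR i / M <= 1)%R).
  { intros i Hi; apply le_INR in Hi; assert (h := pos_INR i); split.
    - apply Rdiv_le_0_compat; lra.
    - apply Rmult_le_reg_r with M; [exact M0|].
      unfold Rdiv; rewrite Rmult_assoc, Rinv_l, Rmult_1_r, Rmult_1_l by lra; unfold M; lra. }
  exists (map (fun i => cover (INR i / M)%R) (seq 0 (S N))); split.
  - intros U HU; apply in_map_iff in HU; destruct HU as [i [<- Hi]].
    apply in_seq in Hi; apply Hcover, grid; lia.
  - intros z [t [Ht ->]].
    destruct (nfloor_ex (t * M)) as [i [i1 i2]]; [apply Rmult_le_pos; lra|].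
    (* The minimum only matters for t = 1. *)
    set (j := Nat.min i N).
    exists (cover (INR j / M)%R); split.
    { apply in_map_iff; exists j; split; [reflexivity|]; apply in_seq; unfold j; lia. }
    apply (Hcover _ (grid j ltac:(unfold j; lia))).
    assert (tM : (t * M <= M)%R) by (rewrite <- (Rmult_1_l M) at 2; apply Rmult_le_compat_r; lra).
    assert (B : (INR j <= t * M <= INR j + 1)%R).
    { unfold j; destruct (Nat.le_gt_cases i N) as [l|l].
      - rewrite Nat.min_l by exact l; lra.
      - rewrite Nat.min_r by lia; apply lt_INR in l; fold M; split; [lra|exact tM]. }
    eapply Rle_lt_trans; [|exact Md].
    replace (t - INR j / M)%R with ((t * M - INR j) * / M)%R by (field; lra).
    assert (iM : (0 < / M)%R) by (apply Rinv_0_lt_compat, M0).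
    rewrite Rabs_mult, !Rabs_pos_eq by lra.
    rewrite <- (Rmult_1_l (/ M)) at 2; apply Rmult_le_compat_r; lra.
Qed.

(** The interior of the largest star-shaped subset of [U] is again star-shaped, because
    dilation by a positive factor is open. *)
Lemma open_nbhd_starlike (Q U : C -> Prop) :
  Cconvex Q -> Q 0 -> open_nbhd Q U ->
  exists V, starlike V /\ Cincl Q V /\ Cincl V U.
Proof.
  intros cQ Q0 HU.
  destruct (open_nbhd_star Q U cQ Q0 HU) as [W [[oW iW] HW]].
  pose (S z := forall t : R, (0 <= t <= 1)%R -> U (RtoC t * z)).
  pose (V z := locally (T := C_UniformSpace) z S).
  assert (QV : Cincl Q V).
  { intros z Qz; change (locally (T := C_UniformSpace) z S).
    generalize (oW z (iW z Qz)); apply filter_imp.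
    intros y Wy t Ht; exact (HW y t Wy Ht). }
  exists V; split; [split; [|split]|split; [exact QV|]].
  - intros z Hz; exact (locally_locally z S Hz).
  - exact (QV _ Q0).
  - intros z t Vz Ht; destruct (Req_dec t 0) as [->|t0].
    { replace (RtoC 0 * z) with (RtoC 0) by ring; exact (QV _ Q0). }
    assert (t1 : (0 < t)%R) by lra.
    assert (tn : RtoC t <> 0) by (intros E; apply RtoC_inj in E; auto).
    destruct (proj1 (locally_Cmod z S) Vz) as [r [r0 Hr]].
    apply locally_Cmod; exists (t * r)%R; split; [apply Rmult_lt_0_compat; auto|].
    intros y Hy s Hs.
    replace (RtoC s * y) with (RtoC (s * t) * (y / RtoC t)) by (rewrite RtoC_mult; field; auto).
    apply Hr; [|nra].
    replace (y / RtoC t - z) with (/ RtoC t * (y - RtoC t * z)) by (field; auto).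
    rewrite Cmod_mult, Cmod_inv, Cmod_R, Rabs_pos_eq by (auto; lra).
    apply Rmult_lt_reg_l with t; [exact t1|].
    rewrite <- Rmult_assoc, Rinv_r, Rmult_1_l by lra; exact Hy.
  - intros z Vz; assert (E := locally_singleton z S Vz 1%R ltac:(lra)).
    replace (RtoC 1 * z) with z in E by ring; exact E.
Qed.

Lemma holomorphic_incl (U V : C -> Prop) (f : C -> C) :
  Cincl V U -> holomorphic_on U f -> holomorphic_on V f.
Proof. intros i H z Vz; apply H, i, Vz. Qed.

Lemma Hol_germ (Q V : C -> Prop) (f : C -> C) :
  open V -> Cincl Q V -> holomorphic_on V f -> Hol Q (germ Q f).
Proof. intros oV i H; exists f, V; repeat split; auto. Qed.

Lemma Hol_starlike2 (Q : C -> Prop) (a b : germs Q) :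
  Cconvex Q -> Q 0 -> Hol Q a -> Hol Q b ->
  exists f g V, starlike V /\ Cincl Q V /\ holomorphic_on V f /\ holomorphic_on V g /\
    a = germ Q f /\ b = germ Q g.
Proof.
  intros cQ Q0 [f [U1 [HU1 [Hf ->]]]] [g [U2 [HU2 [Hg ->]]]].
  destruct (open_nbhd_starlike Q _ cQ Q0 (open_nbhd_and Q U1 U2 HU1 HU2)) as [V [sV [QV VU]]].
  exists f, g, V; repeat split; auto; try apply sV.
  - apply (holomorphic_incl U1); [intros z Vz; apply VU, Vz | exact Hf].
  - apply (holomorphic_incl U2); [intros z Vz; apply VU, Vz | exact Hg].
Qed.

Lemma germ_eq_on (Q V : C -> Prop) (f g : C -> C) :
  open V -> Cincl Q V -> (forall z, V z -> f z = g z) -> germ Q f = germ Q g.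
Proof. intros oV i E; apply germP; exists V; repeat split; auto. Qed.

Lemma Cderive_n_lincomb (V : C -> Prop) (f g : C -> C) (c d : C) (j : nat) :
  open V -> holomorphic_on V f -> holomorphic_on V g ->
  forall z, V z ->
    Cderive_n (fun y => c * f y + d * g y) j z = c * Cderive_n f j z + d * Cderive_n g j z.
Proof.
  intros oV Hf Hg; induction j as [|j IH]; intros z Vz; [reflexivity|].
  change (C_derive (Cderive_n (fun y => c * f y + d * g y) j) z =
    c * C_derive (Cderive_n f j) z + d * C_derive (Cderive_n g j) z).
  rewrite (C_derive_ext_open V _ _ oV IH z Vz); apply is_C_derive_unique.
  assert (D := Cderivable_plus _ _ _ _ _
    (Cderivable_mult _ _ _ _ _ (Cderivable_const c z)
      (Cdiff_derivable _ z (holomorphic_Cderive_n V f j oV Hf z Vz)))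
    (Cderivable_mult _ _ _ _ _ (Cderivable_const d z)
      (Cdiff_derivable _ z (holomorphic_Cderive_n V g j oV Hg z Vz)))).
  cbn beta in D.
  match type of D with is_derive _ _ ?l => replace (c * _ + d * _) with l by ring end.
  exact D.
Qed.

Lemma Hol_lincomb (A : C -> Prop) (a b : germs A) (c d : C) :
  A 0 -> Hol A a -> Hol A b ->
  Hol A (gadd (gscal c a) (gscal d b)) /\
  forall j, deriv0 j (gadd (gscal c a) (gscal d b)) = c * deriv0 j a + d * deriv0 j b.
Proof.
  intros A0 [f [U1 [HU1 [Hf ->]]]] [g [U2 [HU2 [Hg ->]]]].
  assert (HU := open_nbhd_and A U1 U2 HU1 HU2).
  set (U := fun z => U1 z /\ U2 z) in HU; destruct HU as [oU iU].
  assert (Hf' : holomorphic_on U f) by (intros z [Uz _]; apply Hf, Uz).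
  assert (Hg' : holomorphic_on U g) by (intros z [_ Uz]; apply Hg, Uz).
  rewrite !gscal_germ, gadd_germ; split.
  - apply (Hol_germ A U _ oU iU), holomorphic_plus; apply holomorphic_scal; assumption.
  - intros j; rewrite !deriv0_germ by exact A0.
    exact (Cderive_n_lincomb U f g c d j oU Hf' Hg' 0 (iU _ A0)).
Qed.

Lemma gscal_1 (A : C -> Prop) (a : germs A) : gscal 1 a = a.
Proof.
  rewrite <- (repK A a), gscal_germ; f_equal.
  apply functional_extensionality; intros z; ring.
Qed.

(** Together with [gscal_1], this makes sums and multiples special cases of linear
    combinations. *)
Lemma gscal_gadd0 (A : C -> Prop) (c : C) (a : germs A) :
  gscal c a = gadd (gscal c a) (gscal 0 a).
Proof.
  rewrite <- (repK A a), !gscal_germ, gadd_germ; f_equal.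
  apply functional_extensionality; intros z; ring.
Qed.

Lemma Hol_gadd (A : C -> Prop) (a b : germs A) :
  A 0 -> Hol A a -> Hol A b ->
  Hol A (gadd a b) /\ forall j, deriv0 j (gadd a b) = deriv0 j a + deriv0 j b.
Proof.
  intros A0 Ha Hb; destruct (Hol_lincomb A a b 1 1 A0 Ha Hb) as [H D].
  rewrite !gscal_1 in H, D; split; [exact H|]; intros j; rewrite D; ring.
Qed.

Lemma Hol_gscal (A : C -> Prop) (a : germs A) (c : C) :
  A 0 -> Hol A a -> Hol A (gscal c a) /\ forall j, deriv0 j (gscal c a) = c * deriv0 j a.
Proof.
  intros A0 Ha; destruct (Hol_lincomb A a a c 0 A0 Ha Ha) as [H D].
  rewrite <- gscal_gadd0 in H, D; split; [exact H|]; intros j; rewrite D; ring.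
Qed.

(** Cauchy's estimate on a circle about 0 inside [U] bounds the derivative by the
    values on that circle, which is compact. *)
Lemma deriv0_ind_nbhd0 (K : C -> Prop) (j : nat) (e : R) :
  K 0 -> (0 < e)%R -> ind_nbhd0 K (fun b => Hol K b /\ (Cmod (deriv0 j b) < e)%R).
Proof.
  intros K0 e0; split; [tauto|split].
  - intros a b c d [Ha ea] [Hb eb] Hcd.
    destruct (Hol_lincomb K a b c d K0 Ha Hb) as [H D]; split; [exact H|]; rewrite D.
    eapply Rle_lt_trans; [apply Cmod_triangle|]; rewrite !Cmod_mult.
    assert (c0 := Cmod_ge_0 c); assert (d0 := Cmod_ge_0 d).
    set (m := Rmax (Cmod (deriv0 j a)) (Cmod (deriv0 j b))).
    assert (ma : (Cmod (deriv0 j a) <= m)%R) by apply Rmax_l.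
    assert (mb : (Cmod (deriv0 j b) <= m)%R) by apply Rmax_r.
    assert (me : (m < e)%R) by (apply Rmax_lub_lt; auto).
    assert (m0 : (0 <= m)%R) by (eapply Rle_trans; [apply Cmod_ge_0 | exact ma]).
    nra.
  - intros U [oU iU].
    destruct (open_disc U 0 oU (iU _ K0)) as [rho [rho0 Hrho]].
    set (r := (rho / 2)%R); assert (r0 : (0 < r)%R) by (unfold r; lra).
    assert (r1 : (r < rho)%R) by (unfold r; lra).
    assert (p0 : (0 < r ^ j)%R) by (apply pow_lt, r0).
    assert (f0 : (0 < INR (fact j))%R) by apply INR_fact_lt_0.
    exists (fun z => exists t : R, (0 <= t <= 1)%R /\ z = circle r t),
      (e / 2 * (r ^ j / INR (fact j)))%R.
    split; [apply Ccompact_image_01; intros t; apply Ccontinuous_circle|].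
    split; [|split].
    + intros z [t [_ ->]]; apply Hrho; replace (circle r t - 0) with (circle r t) by ring.
      rewrite Cmod_circle; lra.
    + apply Rmult_lt_0_compat; [lra | apply Rdiv_lt_0_compat; assumption].
    + intros f Hf Hb; split; [exact (Hol_germ K U f oU iU Hf)|].
      rewrite deriv0_germ by exact K0.
      eapply Rle_lt_trans.
      * apply (Cauchy_estimate f 0 r rho r0 r1 (fun z Hz => Hf z (Hrho z Hz)) j).
        intros t Ht; apply Rlt_le, Hb; exists t; split; [exact Ht | ring].
      * replace (INR (fact j) * (e / 2 * (r ^ j / INR (fact j)) / r ^ j))%R with (e / 2)%R
          by (field; lra).
        lra.
Qed.

Lemma deriv0_ind_open (K : C -> Prop) (j : nat) :
  K 0 -> ind_open K (fun b => Hol K b /\ deriv0 j b <> 0).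
Proof.
  intros K0; split; [tauto|]; intros a [Ha na].
  assert (e0 := proj1 (Cmod_gt_0 _) na).
  exists (fun b => Hol K b /\ (Cmod (deriv0 j b) < Cmod (deriv0 j a))%R).
  split; [exact (deriv0_ind_nbhd0 K j _ K0 e0)|]; intros b [Hb eb].
  destruct (Hol_gadd K a b K0 Ha Hb) as [H D]; split; [exact H|]; rewrite D; intros E.
  replace (deriv0 j b) with (- deriv0 j a + (deriv0 j a + deriv0 j b)) in eb by ring.
  rewrite E in eb; replace (- deriv0 j a + 0) with (- deriv0 j a) in eb by ring.
  rewrite Cmod_opp in eb; lra.
Qed.

Lemma Hol_restr (A B : C -> Prop) (a : germs A) :
  Cincl B A -> B 0 -> Hol A a ->
  Hol B (restr B a) /\ forall j, deriv0 j (restr B a) = deriv0 j a.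
Proof.
  intros i B0 [f [U [[oU iU] [Hf ->]]]]; rewrite restr_germ by exact i; split.
  - apply (Hol_germ B U f oU); [intros z Bz; apply iU, i, Bz | exact Hf].
  - intros j; rewrite !deriv0_germ; auto.
Qed.

Lemma Cderivable_monomial (c z : C) (m : nat) :
  Cderivable (fun y => c * y ^ S m) z (c * RtoC (INR (S m)) * z ^ m).
Proof.
  revert c; induction m as [|m IH]; intros c.
  - assert (D := Cderivable_scaled (fun y => y) c z 1 (Cderivable_id (c * z))).
    replace (c * RtoC (INR 1) * z ^ 0) with (c * 1) by (cbn; ring).
    apply (Cderivable_ext (fun y => c * y)); [intros y; cbn; ring | exact D].
  - assert (D := Cderivable_mult _ _ _ _ _ (Cderivable_id z) (IH c)); cbn beta in D.
    replace (c * RtoC (INR (S (S m))) * z ^ S m)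
      with (1 * (c * z ^ S m) + z * (c * RtoC (INR (S m)) * z ^ m)).
    + apply (Cderivable_ext (fun y => y * (c * y ^ S m))); [intros y; cbn; ring | exact D].
    + rewrite (S_INR (S m)), RtoC_plus; cbn [Cpow]; ring.
Qed.

Lemma Cderive_n_monomial (c : C) (m j : nat) :
  (j < m)%nat -> Cderive_n (fun y => c * y ^ m) j 0 = 0.
Proof.
  revert c m; induction j as [|j IH]; intros c m Hj; (destruct m as [|m]; [lia|]).
  - cbn; ring.
  - rewrite Cderive_n_shift.
    replace (C_derive (fun y => c * y ^ S m)) with (fun y => c * RtoC (INR (S m)) * y ^ m).
    + apply IH; lia.
    + apply functional_extensionality; intros y; symmetry.
      apply is_C_derive_unique, Cderivable_monomial.
Qed.

(** * Ideals of the Duhamel algebra *)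

Definition vanishing (Q : C -> Prop) (n : nat) (h : germs Q) : Prop :=
  Hol Q h /\ forall j, (j <= n)%nat -> deriv0 j h = 0.

Lemma Hol_monomial (Q : C -> Prop) (c : C) (m : nat) : Hol Q (germ Q (fun z => c * z ^ S m)).
Proof.
  apply (Hol_germ Q (fun _ => True)); [apply open_true | intros z _; exact I |].
  intros z _; eexists; apply Cderivable_monomial.
Qed.

Lemma Hol_const (Q : C -> Prop) (c : C) : Hol Q (germ Q (fun _ => c)).
Proof.
  apply (Hol_germ Q (fun _ => True)); [apply open_true | intros z _; exact I |].
  intros z _; eexists; apply Cderivable_const.
Qed.

Lemma deriv0_gzero (Q : C -> Prop) (j : nat) : Q 0 -> deriv0 j (gzero Q) = 0.
Proof. intros Q0; unfold gzero; rewrite deriv0_germ by exact Q0; apply Cderive_n_zero. Qed.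

Lemma gduhamel_comm (Q : C -> Prop) (a b : germs Q) :
  Cconvex Q -> Q 0 -> Hol Q a -> Hol Q b -> gduhamel a b = gduhamel b a.
Proof.
  intros cQ Q0 Ha Hb.
  destruct (Hol_starlike2 Q a b cQ Q0 Ha Hb) as [f [g [V [sV [QV [Hf [Hg [-> ->]]]]]]]].
  rewrite !gduhamel_germ by assumption.
  apply (germ_eq_on Q V); [apply sV | exact QV|]; intros z Vz.
  exact (duhamel_comm V f g z sV Hf Hg Vz).
Qed.

Lemma vanishing_ideal (Q : C -> Prop) (n : nat) :
  Cconvex Q -> Q 0 -> duhamel_ideal Q (vanishing Q n).
Proof.
  intros cQ Q0; split; [|split; [|split]].
  - split; [apply Hol_const | intros j _; apply deriv0_gzero, Q0].
  - intros a b [Ha Za] [Hb Zb]; destruct (Hol_gadd Q a b Q0 Ha Hb) as [H D].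
    split; [exact H|]; intros j Hj; rewrite D, Za, Zb by exact Hj; ring.
  - intros c a [Ha Za]; destruct (Hol_gscal Q a c Q0 Ha) as [H D].
    split; [exact H|]; intros j Hj; rewrite D, Za by exact Hj; ring.
  - intros v a Hv [Ha Za].
    rewrite (gduhamel_comm Q a v cQ Q0 Ha Hv).
    enough (vanishing Q n (gduhamel v a)) by (split; assumption).
    destruct (Hol_starlike2 Q v a cQ Q0 Hv Ha) as [f [g [V [sV [QV [Hf [Hg [-> ->]]]]]]]].
    rewrite gduhamel_germ by assumption; split.
    + apply (Hol_germ Q V); [apply sV | exact QV | exact (holomorphic_duhamel V f g sV Hf Hg)].
    + intros j Hj; rewrite deriv0_germ by exact Q0.
      apply (Cderive_n_duhamel V f g n sV Hf Hg); [|exact Hj].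
      intros i Hi; rewrite <- (deriv0_germ Q) by exact Q0; exact (Za i Hi).
Qed.

(** The complement is the union of the preimages of the open sets given by
    [deriv0 j h <> 0], and these conditions can be read on the first space of
    the projective system, since its compact set contains 0. *)
Lemma vanishing_closed (Q : C -> Prop) (Qs : nat -> C -> Prop) (n : nat) :
  Q 0 -> Cincl (Qs 0%nat) Q -> Qs 0%nat 0 -> proj_closed Q Qs (vanishing Q n).
Proof.
  intros Q0 i Qs0; split; [tauto|]; intros a [Ha Na].
  assert (Ej : exists j, (j <= n)%nat /\ deriv0 j a <> 0).
  { apply NNPP; intros N; apply Na; split; [exact Ha|]; intros j Hj.
    apply NNPP; intros E; apply N; exists j; auto. }
  destruct Ej as [j [Hj nj]].
  exists O, (fun m b => Hol (Qs m) b /\ deriv0 j b <> 0); split.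
  - intros m Hm; replace m with O by lia; split; [exact (deriv0_ind_open _ j Qs0)|].
    destruct (Hol_restr Q (Qs O) a i Qs0 Ha) as [H D]; split; [exact H | rewrite D; exact nj].
  - intros b Hb P; split; [exact Hb|]; intros [_ Z].
    destruct (P O (Nat.le_refl O)) as [_ nb].
    destruct (Hol_restr Q (Qs O) b i Qs0 Hb) as [_ D]; rewrite D in nb; exact (nb (Z j Hj)).
Qed.

Lemma vanishing_proper (Q : C -> Prop) (n : nat) : Q 0 -> proper Q (vanishing Q n).
Proof.
  intros Q0; split; intros H.
  - assert (E : germ Q (fun z => 1 * z ^ S n) = gzero Q).
    { apply H; split; [apply Hol_monomial|]; intros j Hj.
      rewrite deriv0_germ by exact Q0; apply Cderive_n_monomial; lia. }
    apply germP in E; destruct E as [U [[oU iU] E]].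
    destruct (open_disc U 0 oU (iU _ Q0)) as [r [r0 Hr]].
    assert (Ur : U (RtoC (r / 2))).
    { apply Hr; replace (RtoC (r / 2) - 0) with (RtoC (r / 2)) by ring.
      rewrite Cmod_R, Rabs_pos_eq; lra. }
    apply E, (f_equal Cmod) in Ur; rewrite Cmod_mult, Cmod_1, Cmod_pow, Cmod_R, Cmod_0 in Ur.
    rewrite Rabs_pos_eq in Ur by lra.
    assert (p : (0 < (r / 2) ^ S n)%R) by (apply pow_lt; lra); lra.
  - destruct (proj2 (H (germ Q (fun _ => RtoC 1))) (Hol_const Q 1)) as [_ Z].
    assert (E := Z O ltac:(lia)); rewrite deriv0_germ in E by exact Q0.
    apply RtoC_inj in E; lra.
Qed.

Lemma germ_deriv0_zero (Q : C -> Prop) (h : germs Q) :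
  Cconvex Q -> Q 0 -> Hol Q h -> (forall j, deriv0 j h = 0) -> h = gzero Q.
Proof.
  intros cQ Q0 Hh Z.
  destruct (Hol_starlike2 Q h h cQ Q0 Hh Hh) as [f [_ [V [sV [QV [Hf [_ [E _]]]]]]]].
  rewrite E; apply (germ_eq_on Q V); [apply sV | exact QV|].
  apply (starlike_identity V f sV Hf); intros k.
  rewrite <- (deriv0_germ Q) by exact Q0; rewrite <- E; apply Z.
Qed.

(** By lifting it is enough to divide the [m]-th derivatives, and the divisor is then
    nonzero at 0. *)
Lemma germ_divides (Q : C -> Prop) (h f : germs Q) (m : nat) :
  Cconvex Q -> Q 0 -> Hol Q h -> Hol Q f ->
  (forall j, (j < m)%nat -> deriv0 j h = 0) -> deriv0 m h <> 0 ->
  (forall j, (j < m)%nat -> deriv0 j f = 0) ->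
  exists u, Hol Q u /\ f = gduhamel u h.
Proof.
  intros cQ Q0 Hh Hf Zh nh Zf.
  destruct (Hol_starlike2 Q h f cQ Q0 Hh Hf) as [h' [f' [V [sV [QV [Hh' [Hf' [-> ->]]]]]]]].
  assert (oV := proj1 sV).
  rewrite deriv0_germ in nh by exact Q0.
  destruct (duhamel_divide V (Cderive_n f' m) (Cderive_n h' m) sV
    (holomorphic_Cderive_n V f' m oV Hf') (holomorphic_Cderive_n V h' m oV Hh') nh)
    as [u [Hu Eu]].
  exists (germ Q u); split; [exact (Hol_germ Q V u oV QV Hu)|].
  rewrite gduhamel_germ by assumption.
  apply (germ_eq_on Q V); [exact oV | exact QV|]; intros z Vz; symmetry.
  refine (duhamel_lift V u m sV Hu h' f' Hh' Hf' _ _ Eu z Vz);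
    intros j Hj; rewrite <- (deriv0_germ Q) by exact Q0; auto.
Qed.

(** An element of least order [m] divides every germ of order at least [m], and
    [m] is positive since an element of order 0 divides everything. *)
Lemma proper_ideal_vanishing (Q : C -> Prop) (T : germs Q -> Prop) :
  Cconvex Q -> Q 0 -> (forall h, T h -> Hol Q h) -> duhamel_ideal Q T -> proper Q T ->
  exists n, forall h, T h <-> vanishing Q n h.
Proof.
  intros cQ Q0 TH [T0 [_ [_ TI]]] [P1 P2].
  destruct (dec_inh_nat_subset_has_unique_least_element
    (fun m => exists h, T h /\ deriv0 m h <> 0)) as [m [[[h [Th nh]] least] _]].
  { intros m; apply classic. }
  { apply NNPP; intros N; apply P1; intros h; split; [|intros ->; exact T0].
    intros Th; apply (germ_deriv0_zero Q h cQ Q0 (TH h Th)); intros j.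
    apply NNPP; intros n; apply N; exists j, h; auto. }
  assert (Z : forall j a, (j < m)%nat -> T a -> deriv0 j a = 0).
  { intros j a Hj Ta; apply NNPP; intros n.
    assert (m <= j)%nat; [|lia]; apply least; exists a; auto. }
  assert (D : forall f, Hol Q f -> (forall j, (j < m)%nat -> deriv0 j f = 0) -> T f).
  { intros f Hf Zf.
    destruct (germ_divides Q h f m cQ Q0 (TH h Th) Hf (fun j Hj => Z j h Hj Th) nh Zf)
      as [u [Hu ->]].
    exact (proj1 (TI u h Hu Th)). }
  destruct m as [|n].
  - exfalso; apply P2; intros f; split; [apply TH|]; intros Hf; apply D; [exact Hf | lia].
  - exists n; intros f; split.
    + intros Tf; split; [exact (TH f Tf)|]; intros j Hj; apply Z; [lia | exact Tf].
    + intros [Hf Zf]; apply D; [exact Hf|]; intros j Hj; apply Zf; lia.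
Qed.

Theorem corollary22 :
  forall (Q : C -> Prop) (Qs : nat -> C -> Prop),
    Cconvex Q -> locally_closed Q -> Q 0 ->
    fundamental_sequence Q Qs -> (forall n, Cconvex (Qs n)) -> Qs 0%nat 0 ->
    forall T : germs Q -> Prop, (forall h, T h -> Hol Q h) ->
      ((duhamel_ideal Q T /\ proj_closed Q Qs T /\ proper Q T) <->
       exists n : nat,
         forall h, T h <-> (Hol Q h /\ forall j, (j <= n)%nat -> deriv0 j h = 0)).
Proof.
  intros Q Qs cQ _ Q0 [_ [iQs _]] _ Qs0 T TH; split.
  - intros [TI [_ TP]]; exact (proper_ideal_vanishing Q T cQ Q0 TH TI TP).
  - intros [n E].
    assert (TE : T = vanishing Q n).
    { apply functional_extensionality; intros h.
      apply propositional_extensionality, E. }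
    subst T; split; [|split].
    + exact (vanishing_ideal Q n cQ Q0).
    + exact (vanishing_closed Q Qs n Q0 (iQs O) Qs0).
    + exact (vanishing_proper Q n Q0).
Qed.
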